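(* Every natural linear differential operation of order $>0$ on tensor bundles (i.e. from a tensor bundle $\mathcal V$ to a tensor bundle $\mathcal W$ over $n$-dimensional manifolds) is obtained from the exterior differential $d:\Gamma(\Omega^m)\to\Gamma(\Omega^{m+1})$ on differential forms by composition with tensor operations (contraction, permutation of indices, tensor product with the identity operator) and linear combination.
   Context: $\mathbb K=\mathbb R$ or $\mathbb C$; manifolds are smooth $\mathbb K$-manifolds (real smooth, resp. complex analytic) of dimension $n$. $\Omega^m$ is the bundle of exterior $m$-forms, and $\Gamma$ denotes sections. A tensor bundle $\mathcal V$ with typical fibre $V$ is the vector bundle associated with the (co)frame bundle by a finite-dimensional rational representation $V$ of $\mathrm{GL}_n=\mathrm{GL}_n(\mathbb K)$; it embeds as a subbundle into a product of bundles of tensors of types $(p,q)$. $\mathrm{GL}_n^{(k)}$ denotes the group of $k$-jets at $0$ of local diffeomorphisms of $\mathbb K^n$ fixing $0$. $V^{(k)}=\bigoplus_{l=0}^{k}\mathrm S^l(\mathbb K^{n})^*\otimes V$ is the space of $k$-jets at $0$ of $V$-valued functions on $\mathbb K^n$ (local sections of $\mathcal V$), with the $\mathrm{GL}_n^{(k+1)}$-action induced by the transformation of tensor fields under local diffeomorphisms fixing $0$; it is not the tensor product action. $\mathrm{GL}_n^{(k+1)}$ acts on the typical fibre $W$ of $\mathcal W$ through $\mathrm{GL}_n$. A differential operation $D$ of order $\le k$ from $\mathcal V$ to $\mathcal W$ is a map on sections induced by a morphism of bundles from the $k$-jet bundle of $\mathcal V$ to $\mathcal W$ ($Dv(z)$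 depends only on the $k$-jet of $v$ at $z$); its order is the minimal such $k$. It is natural if its fibre map $\delta:V^{(k)}\to W$, in local coordinates, does not depend on the point and is $\mathrm{GL}_n^{(k+1)}$-equivariant; it is linear if $\delta$ is linear. Tensor operations are the pointwise ($\mathrm{GL}_n$-equivariant, order $0$) operations listed in the claim, including the injections of and projections onto direct summands of tensor bundles obtained from them. *)

(* Defs.v *)
From mathcomp Require Import all_boot all_order all_algebra all_fingroup.
From mathcomp Require Import mpoly complex reals.

Set Implicit Arguments.
Unset Strict Implicit.
Unset Printing Implicit Defensive.

Import GRing.Theory.
Local Open Scope ring_scope.

Inductive ground := RealNumbers | ComplexNumbers.

Definition ground_field (R : realType) (F : ground) : fieldType :=
  match F with RealNumbers => R | ComplexNumbers => R[i] end.

Section NaturalOperations.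
Variables (K : fieldType) (n : nat).

(* A matrix of rational functions on GL_n regular outside det = 0: numerators
   are polynomials in the n * n matrix entries (numbered as by mxvec), and the
   common denominator is a power of the determinant. *)
Definition rational_action r (P : 'M[{mpoly K[n * n]}]_r) (e : nat)
    (g : 'M[K]_n) : 'M[K]_r :=
  (\det g) ^- e *: map_mx (meval (mxvec g 0)) P.

(* A tensor bundle is given by a rational representation of GL_n on its typical
   fibre K^rank, acting on column vectors. *)
Record tensor_bundle := TensorBundle {
  rank : nat;
  numer : 'M[{mpoly K[n * n]}]_rank;
  denom_exp : nat;
  rational_action1 : rational_action numer denom_exp 1%:M = 1%:M;
  rational_actionM : {in unitmx &, forall g h : 'M[K]_n,
    rational_action numer denom_exp (g *m h) =
      rational_action numer denom_exp g *m rational_action numer denom_exp h}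
}.

Definition fibre (V : tensor_bundle) := 'cV[K]_(rank V).

Definition rho (V : tensor_bundle) (g : 'M[K]_n) : 'M[K]_(rank V) :=
  rational_action (numer V) (denom_exp V) g.

(* Polynomial sections over K^n; every jet is the jet of one of them. *)
Definition psection (V : tensor_bundle) := 'cV[{mpoly K[n]}]_(rank V).

(* k-jets at 0, stored as Taylor coefficients. *)
Definition jet (k : nat) (V : tensor_bundle) :=
  {ffun 'X_{1..n < k.+1} -> fibre V}.

Definition jet0 k V (v : psection V) : jet k V :=
  [ffun m : 'X_{1..n < k.+1} => \col_i (v i 0)@_m].

Definition taylor k V (a : jet k V) : psection V :=
  \col_i \sum_(m : 'X_{1..n < k.+1}) a m i 0 *: 'X_[m].

Definition jet_at k V (z : 'cV[K]_n) (v : psection V) : jet k V :=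
  jet0 k (map_mx (comp_mpoly [tuple 'X_i + (z i 0)%:MP | i < n]) v).

Definition jacobian (phi : n.-tuple {mpoly K[n]}) : 'M[{mpoly K[n]}]_n :=
  \matrix_(i, j) (tnth phi i)^`M(j).

Definition jacobian0 (phi : n.-tuple {mpoly K[n]}) : 'M[K]_n :=
  map_mx (fun p : {mpoly K[n]} => p@_0%MM) (jacobian phi).

(* The elements of GL_n^(k), each represented by its Taylor polynomial; by the
   inverse function theorem these are all the k-jets at 0 of local
   diffeomorphisms fixing 0. *)
Definition diffeo_jet (k : nat) (phi : n.-tuple {mpoly K[n]}) : Prop :=
  (forall i, (tnth phi i)@_0%MM = 0 /\ (msize (tnth phi i) <= k.+1)%N) /\
  jacobian0 phi \in unitmx.

(* b = phi . a in V^(k), i.e. b(phi(x)) = rho(phi'(x)) a(x) modulo terms of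
   degree > k. Denominators are cleared: \det (jacobian phi) is invertible
   modulo such terms, so that phi and a determine b. *)
Definition jet_act k (V : tensor_bundle) (phi : n.-tuple {mpoly K[n]})
    (a b : jet k V) : Prop :=
  let J := jacobian phi in
  jet0 k ((\det J) ^+ denom_exp V *: map_mx (comp_mpoly phi) (taylor b)
            : psection V) =
  jet0 k (map_mx (mmap (@mpolyC n K) (mxvec J 0)) (numer V) *m taylor a
            : psection V).

Definition natural k (V W : tensor_bundle) (delta : jet k V -> fibre W) : Prop :=
  forall (phi : n.-tuple {mpoly K[n]}) (a b : jet k V),
    diffeo_jet k.+1 phi -> jet_act phi a b ->
    delta b = rho W (jacobian0 phi) *m delta a.

Definition order_le k (V W : tensor_bundle) (delta : jet k V -> fibre W)
    (l : nat) : Prop :=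
  forall a b : jet k V,
    (forall m : 'X_{1..n < k.+1}, (mdeg m <= l)%N -> a m = b m) ->
    delta a = delta b.

Definition has_order k (V W : tensor_bundle) (delta : jet k V -> fibre W)
    (l : nat) : Prop :=
  order_le delta l /\ forall l', order_le delta l' -> (l <= l')%N.

(* Tensors with p upper (contravariant) and q lower (covariant) indices, by
   components in A; with A := {mpoly K[n]} these are polynomial tensor fields. *)
Definition tensor (A : Type) (p q : nat) :=
  {ffun p.-tuple 'I_n * q.-tuple 'I_n -> A}.

Definition tensor_act p q (g : 'M[K]_n) (t : tensor K^o p q) : tensor K^o p q :=
  [ffun x => \sum_y (\prod_(a < p) g (tnth x.1 a) (tnth y.1 a)) *
                    (\prod_(b < q) invmx g (tnth y.2 b) (tnth x.2 b)) * t y].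

Notation tfield := (tensor {mpoly K[n]}).

Definition contraction p q (t : tfield p.+1 q.+1) : tfield p q :=
  [ffun x : p.-tuple 'I_n * q.-tuple 'I_n =>
    \sum_(k < n) t ([tuple of k :: x.1], [tuple of k :: x.2])].

Definition permutation p q (s : 'S_p) (s' : 'S_q) (t : tfield p q) : tfield p q :=
  [ffun x : p.-tuple 'I_n * q.-tuple 'I_n =>
    t ([tuple tnth x.1 (s i) | i < p], [tuple tnth x.2 (s' i) | i < q])].

(* Tensor product with the Kronecker delta. *)
Definition tensor_id p q (t : tfield p q) : tfield p.+1 q.+1 :=
  [ffun x : p.+1.-tuple 'I_n * q.+1.-tuple 'I_n =>
    (thead x.1 == thead x.2)%:R * t ([tuple of behead x.1], [tuple of behead x.2])].

Inductive tensor_op :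
    forall p q p' q' : nat, (tfield p q -> tfield p' q') -> Prop :=
  | tensor_op_contraction p q : tensor_op (@contraction p q)
  | tensor_op_permutation p q s s' : tensor_op (@permutation p q s s')
  | tensor_op_id p q : tensor_op (@tensor_id p q)
  | tensor_op_comp p q p' q' p'' q'' (A : tfield p' q' -> tfield p'' q'')
      (B : tfield p q -> tfield p' q') :
      tensor_op A -> tensor_op B -> tensor_op (A \o B).

(* The projection of T^(0,m) onto its direct summand Omega^m, the
   skew-symmetric tensors. *)
Definition alternation m (t : tfield 0 m) : tfield 0 m :=
  (m`!%:R^-1 : K) *: \sum_(s : 'S_m) ((-1) ^+ s : K) *: permutation 1%g s t.

(* (d t)_{i_0 .. i_m} = \sum_j (-1)^j \partial_{i_j} t_{i_0 .. ^i_j .. i_m},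
   the exterior differential when t is skew-symmetric. *)
Definition ext_diff m (t : tfield 0 m) : tfield 0 m.+1 :=
  [ffun x : 0.-tuple 'I_n * m.+1.-tuple 'I_n => \sum_(j < m.+1)
    (-1) ^+ j * (t (x.1, [tuple tnth x.2 (lift j i) | i < m]))^`M(tnth x.2 j)].

(* The operations obtained from d : Omega^m -> Omega^(m+1) (written on T^(0,m)
   by projecting to Omega^m first) by composition with tensor operations and
   linear combination; tensor operations themselves may enter the linear
   combinations, since an operation of positive order may have a summand of
   order 0. *)
Inductive obtained_from_d :
    forall p q p' q' : nat, (tfield p q -> tfield p' q') -> Prop :=
  | obtained_d m : obtained_from_d (@ext_diff m \o @alternation m)
  | obtained_tensor_op p q p' q' (A : tfield p q -> tfield p' q') :
      tensor_op A -> obtained_from_d A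
  | obtained_postcomp p q p' q' p'' q'' (A : tfield p' q' -> tfield p'' q'')
      (D : tfield p q -> tfield p' q') :
      tensor_op A -> obtained_from_d D -> obtained_from_d (A \o D)
  | obtained_precomp p q p' q' p'' q'' (D : tfield p' q' -> tfield p'' q'')
      (B : tfield p q -> tfield p' q') :
      obtained_from_d D -> tensor_op B -> obtained_from_d (D \o B)
  | obtained_zero p q p' q' :
      obtained_from_d (fun _ : tfield p q => 0 : tfield p' q')
  | obtained_lin p q p' q' (c : K) (D D' : tfield p q -> tfield p' q') :
      obtained_from_d D -> obtained_from_d D' ->
      obtained_from_d (fun t => c *: D t + D' t).

(* V as a direct summand of a finite product of bundles of tensors of types
   (p_a, q_a), a < nfactors: injection and projection, by components. *)
Record summand (V : tensor_bundle) := Summand {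
  nfactors : nat;
  upper : 'I_nfactors -> nat;
  lower : 'I_nfactors -> nat;
  inj : forall a, {linear fibre V -> tensor K^o (upper a) (lower a)};
  proj : forall a, {linear tensor K^o (upper a) (lower a) -> fibre V};
  inj_equivariant : forall a g v, g \in unitmx ->
    inj a (rho V g *m v) = tensor_act g (inj a v);
  proj_equivariant : forall a g t, g \in unitmx ->
    proj a (tensor_act g t) = rho V g *m proj a t;
  injK : forall v, \sum_a proj a (inj a v) = v
}.

Arguments upper {V} s a.
Arguments lower {V} s a.
Arguments inj {V} s a.
Arguments proj {V} s a.

Definition inj_section V (i : summand V) a (v : psection V) :
    tfield (upper i a) (lower i a) :=
  [ffun x => \sum_(j < rank V) inj i a (delta_mx j 0) x *: v j 0].

Arguments inj_section {V} i a v.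

Definition tensor_at p q (z : 'cV[K]_n) (t : tfield p q) : tensor K^o p q :=
  [ffun x => (t x).@[fun i => z i 0]].

(* The operation v |-> delta (k-jet of v at z) is the composite of the injection
   i of V, a matrix of operations obtained from d, and the projection of W. *)
Definition obtained_along k V W (delta : jet k V -> fibre W)
    (i : summand V) (j : summand W) : Prop :=
  exists E : forall a b, tfield (upper i a) (lower i a) ->
                         tfield (upper j b) (lower j b),
    (forall a b, obtained_from_d (E a b)) /\
    forall (v : psection V) (z : 'cV[K]_n),
      delta (jet_at k z v) =
      \sum_a \sum_b proj j b (tensor_at z (E a b (inj_section i a v))).

(* Tensor operations between V and W are those of ambient tensor bundles; all
   ways of exhibiting V and W as direct summands are required to work, so that
   their choice cannot absorb an operation that is not of the required form. *)
Definition is_obtained_from_d k V W (delta : jet k V -> fibre W) : Prop :=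
  inhabited (summand V) /\ inhabited (summand W) /\
  forall (i : summand V) (j : summand W), obtained_along delta i j.

End NaturalOperations.

(* Main.v *)
(* A linear fibre map delta is tested on the jets of x^l v, with x a linear form
   and v in the fibre V. Transforming x^s v by the shears X + y x^d shows that
   delta vanishes on all x^l v with l > 1 as soon as its order is at most l;
   hence the order is one, and the symbol D_i v = delta(X_i v) satisfies
   D_i drho(E_kj) + D_j drho(E_ki) = 0 besides GL_n-equivariance.
   In components D becomes an array from T^(p,q) to T^(p',q').
   - For p = 0 the relation says that D is skew in i and the lower indices, so
     the operation is an equivariant map after d o alternation, and equivariant
     maps are tensor operations by the first fundamental theorem.
   - For p > 0 the relation expresses a positive sum of squares of the entries of
     D as a negative one when all traces of D vanish, so that D = 0 then. As D is
     determined by its traces, it is a combination of the D S^m, m > 0, where S is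
     the sum of all contractions followed by the insertions of the identity;
     these factor through T^(p-1,q-1), and one concludes by induction on p.
   A rational representation V embeds as a summand in tensors because its matrix
   coefficients are linear forms on the algebra of symmetric kernels, whose
   canonical element sum_AB y_AB y_BA is invertible, again by positivity. *)

(* All positivity arguments rest on one hypothesis, [conj_pos]: K has an endomorphism conj such that
   a sum of f conj(f) vanishes only if every f does. The identity serves over R and complex
   conjugation over C, so both ground fields are treated at once, without an ordering of K. The
   obstacle for p > 0 is that a contraction followed by d is natural, so the relation on D cannot
   force D = 0 without a condition on traces. The operator S handles this because the Hermitian
   product of S D with D is the sum of the squared traces of D; hence S D = 0 implies D = 0. This is
   known for natural D only, not for all arrays, so S is not inverted: a polynomial relation between
   its powers, from Cayley-Hamilton, takes the place of the inverse. Inverse matrices are kept out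
   of equivariance by moving lower indices to the other side. It then becomes polynomial in the
   entries of g after clearing powers of \det, and can be polarized or differentiated. Likewise the
   action on jets is an equation of polynomials modulo a power of the maximal ideal. *)
From HB Require Import structures.
Require Import Defs.
From mathcomp Require Import all_boot all_order all_algebra all_fingroup.
From mathcomp Require Import mpoly complex reals ring.

Set Implicit Arguments.
Unset Strict Implicit.
Unset Printing Implicit Defensive.

Import GRing.Theory.
Local Open Scope ring_scope.

(** * Polynomials vanishing on GL_n *)

Section Density.
Variable K : fieldType.
Hypothesis char0 : forall m, m.+1%:R != 0 :> K.

Lemma natr_inj0 : injective (fun m : nat => m%:R : K).
Proof.
have lt_neq a b : (a < b)%N -> a%:R != b%:R :> K.
  move=> ab; rewrite eq_sym -subr_eq0 -natrB; last exact: ltnW.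
  by case: (b - a)%N (subn_gt0 a b) => [|c _]; [rewrite ab | exact: char0].
move=> a b /eqP; case: (ltngtP a b) => // /lt_neq; first by move/negP.
by rewrite eq_sym => /negP.
Qed.

(** Zero is excluded because the variable will be the factor of a homothety, which has to stay
    invertible; the positive integers already give too many roots. *)
Lemma poly_vanish (p : {poly K}) :
  (forall s, s != 0 -> p.[s] = 0) -> p = 0.
Proof.
move=> p0; apply/eqP/negPn/negP => nz.
have := @max_poly_roots _ p [seq m.+1%:R | m <- iota 0 (size p)] nz.
rewrite size_map size_iota ltnn => H; suff: false by [].
apply: H.
  by apply/allP => x /mapP[m _ ->]; apply/eqP/p0/char0.
by rewrite map_inj_uniq ?iota_uniq // => a b /natr_inj0 [].
Qed.

Lemma digits_inj B N (a b : 'I_N -> nat) :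
  (forall i, a i < B)%N -> (forall i, b i < B)%N ->
  (\sum_i a i * B ^ i = \sum_i b i * B ^ i)%N -> a =1 b.
Proof.
elim: N a b => [|N IH] a b Ha Hb; first by move=> _ [].
have B0 : (0 < B)%N by apply: leq_ltn_trans (Ha ord0).
have split_low c : (\sum_(i < N.+1) c i * B ^ i =
    c ord0 + (\sum_(i < N) c (lift ord0 i) * B ^ i) * B)%N.
  rewrite big_ord_recl expn0 muln1 big_distrl /=; congr (_ + _)%N.
  by apply: eq_bigr => i _; rewrite /bump /= add1n expnS mulnA mulnAC.
rewrite !split_low => E.
have E0 : a ord0 = b ord0.
  have := congr1 (modn^~ B) E.
  by rewrite /= ![(_ + _ * B)%N]addnC !modnMDl !modn_small.
move: E; rewrite E0 => /addnI /eqP; rewrite eqn_pmul2r // => /eqP E i.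
have [j ->|->] := unliftP ord0 i; last exact: E0.
by apply: (IH (a \o lift ord0) (b \o lift ord0)) => //= k.
Qed.

(* Kronecker substitution X_j := s ^ (B ^ j) with B above the degree. *)
Lemma mpoly_vanish N (p : {mpoly K[N]}) :
  (forall c, p.@[c] = 0) -> p = 0.
Proof.
move=> p0; set B := (msize p).
pose code (m : 'X_{1..N}) := (\sum_i m i * B ^ i)%N.
have code_inj : {in msupp p &, injective code}.
  have dig m i : m \in msupp p -> (m i < B)%N.
    move/msize_mdeg_lt; apply: leq_ltn_trans.
    by rewrite mdegE (bigD1 i) //= leq_addr.
  move=> m m' Hm Hm' E; apply/mnmP; apply: (digits_inj (B := B)) => // i;
    exact: dig.
pose q : {poly K} := \sum_(m <- msupp p) p@_m *: 'X^(code m).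
have q0 : q = 0.
  apply: poly_vanish => s _.
  rewrite -[RHS](p0 (fun i => s ^+ (B ^ i))) mevalE /q horner_sum.
  apply: eq_bigr => m _; rewrite hornerZ hornerXn; congr (_ * _).
  rewrite /code expr_sum; apply: eq_bigr => i _.
  by rewrite -exprM mulnC.
apply/mpolyP => m; rewrite mcoeff0.
have [Hm|/memN_msupp_eq0 //] := boolP (m \in msupp p).
have := congr1 (fun r : {poly K} => r`_(code m)) q0.
rewrite coef0 /q coef_sum (bigD1_seq m) ?msupp_uniq //=.
rewrite coefZ coefXn eqxx mulr1 big_seq_cond big1 ?addr0 //.
move=> m' /andP[Hm' ne]; rewrite coefZ coefXn.
by case: eqP => [/code_inj E|]; rewrite ?mulr0 //; rewrite -E ?eqxx in ne.
Qed.

End Density.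

Section GL.
Variables (K : fieldType) (n : nat).
Hypothesis char0 : forall m, m.+1%:R != 0 :> K.

Definition mxvars : 'M[{mpoly K[n * n]}]_n :=
  \matrix_(i, j) 'X_(mxvec_index i j).

Lemma mmap_mxvars (A : comNzRingType) (f : {rmorphism K -> A}) (J : 'M[A]_n) :
  map_mx (mmap f (mxvec J 0)) mxvars = J.
Proof.
by apply/matrixP => i j; rewrite !mxE mmapX mmap1U mxvecE.
Qed.

Lemma meval_mxvars (g : 'M[K]_n) : map_mx (meval (mxvec g 0)) mxvars = g.
Proof. by apply/matrixP => i j; rewrite !mxE mevalXU mxvecE. Qed.

Lemma meval_det_mxvars (g : 'M[K]_n) : (\det mxvars).@[mxvec g 0] = \det g.
Proof. by rewrite -[in RHS](meval_mxvars g) det_map_mx. Qed.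

(** The product of p with the determinant vanishes on all matrices, and polynomials have no zero
    divisors; the determinant is not the zero polynomial, since its value at 1 is 1. *)
Lemma mpoly_vanish_gl (p : {mpoly K[n * n]}) :
  (forall g : 'M[K]_n, g \in unitmx -> p.@[mxvec g 0] = 0) -> p = 0.
Proof.
move=> p0.
have /eqP : p * \det mxvars = 0.
  apply: (mpoly_vanish char0) => c.
  pose g : 'M[K]_n := vec_mx (\row_i c i).
  have -> : (p * \det mxvars).@[c] = (p * \det mxvars).@[mxvec g 0].
    by apply: meval_eq => i; rewrite vec_mxK mxE.
  rewrite mevalM meval_det_mxvars.
  have [/p0 -> |] := boolP (g \in unitmx); first by rewrite mul0r.
  by rewrite unitmxE unitfE negbK => /eqP->; rewrite mulr0.
rewrite mulf_eq0 => /orP[/eqP //|/eqP det0].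
have := meval_det_mxvars 1%:M.
by rewrite det0 meval0 det1 => /esym /eqP; rewrite oner_eq0.
Qed.

End GL.

(** * Tensor powers and the first fundamental theorem *)

Section Tuples.

Definition rix (T : Type) p q (a : p.-tuple T) (s : 'I_q -> 'I_p) : q.-tuple T :=
  [tuple tnth a (s i) | i < q].

Lemma tnth_rix T p q (a : p.-tuple T) (s : 'I_q -> 'I_p) i :
  tnth (rix a s) i = tnth a (s i).
Proof. by rewrite tnth_mktuple. Qed.

Lemma rix_comp T p q r (a : p.-tuple T) (s : 'I_q -> 'I_p) (u : 'I_r -> 'I_q) :
  rix (rix a s) u = rix a (s \o u).
Proof. by apply: eq_from_tnth => i; rewrite !tnth_rix. Qed.

Lemma eq_rix T p q (a : p.-tuple T) (s u : 'I_q -> 'I_p) :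
  s =1 u -> rix a s = rix a u.
Proof. by move=> E; apply: eq_from_tnth => i; rewrite !tnth_rix E. Qed.

Lemma rix_id T p (a : p.-tuple T) : rix a id = a.
Proof. by apply: eq_from_tnth => i; rewrite !tnth_rix. Qed.

Lemma rixM T p (a : p.-tuple T) (s t : 'S_p) :
  rix a (s * t)%g = rix (rix a t) s.
Proof. by rewrite rix_comp; apply: eq_rix => i; rewrite /= permM. Qed.

Lemma rixK T p (s : 'S_p) :
  cancel (fun a : p.-tuple T => rix a s) (fun a : p.-tuple T => rix a (s^-1)%g).
Proof.
move=> a; rewrite rix_comp -[RHS]rix_id; apply: eq_rix => i /=.
by rewrite permKV.
Qed.

Lemma rixVK T p (s : 'S_p) :
  cancel (fun a : p.-tuple T => rix a (s^-1)%g) (fun a : p.-tuple T => rix a s).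
Proof.
move=> a; rewrite rix_comp -[RHS]rix_id; apply: eq_rix => i /=.
by rewrite permK.
Qed.

Lemma rix_bij (T : Type) p (s : 'S_p) : bijective (fun a : p.-tuple T => rix a s).
Proof. by exists (fun a : p.-tuple T => rix a (s^-1)%g); [exact: rixK | exact: rixVK]. Qed.

Lemma eq_rix_perm (T : eqType) p (s : 'S_p) (a b : p.-tuple T) :
  (rix a s == rix b s) = (a == b).
Proof. exact: (inj_eq (bij_inj (rix_bij T s))). Qed.

Lemma sum_rix (T : finType) (R : nmodType) p (s : 'S_p) (F : p.-tuple T -> R) :
  \sum_a F a = \sum_a F (rix a s).
Proof. by rewrite (reindex _ (onW_bij _ (rix_bij T s))). Qed.

Lemma prod_sum_tuple (R : comNzRingType) (T : finType) p (F : 'I_p -> T -> R) :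
  \prod_i \sum_k F i k = \sum_(t : p.-tuple T) \prod_i F i (tnth t i).
Proof.
rewrite bigA_distr_bigA (reindex (fun t : p.-tuple T => [ffun i => tnth t i])) /=.
  by apply: eq_bigr => t _; apply: eq_bigr => i _; rewrite ffunE.
exists (fun f : {ffun 'I_p -> T} => [tuple f i | i < p]) => x _.
  by apply: eq_from_tnth => i; rewrite tnth_mktuple ffunE.
by apply/ffunP => i; rewrite ffunE tnth_mktuple.
Qed.

End Tuples.

Section TensorPower.
Variable n : nat.

(** Entries of the p-th tensor power of g, with rows and columns numbered by words. *)
Definition gpow (R : comNzRingType) p (g : 'M[R]_n) (a b : p.-tuple 'I_n) : R :=
  \prod_i g (tnth a i) (tnth b i).

Lemma gpow_rix (R : comNzRingType) p (g : 'M[R]_n) (s : 'S_p) a b :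
  gpow g (rix a s) (rix b s) = gpow g a b.
Proof.
rewrite /gpow [RHS](reindex_inj (@perm_inj _ s)).
by apply: eq_bigr => i _; rewrite !tnth_rix.
Qed.

Lemma gpow1 (R : comNzRingType) p (a b : p.-tuple 'I_n) :
  gpow (1%:M : 'M[R]_n) a b = (a == b)%:R.
Proof.
rewrite /gpow; have [->|/eqP ne] := eqVneq a b.
  by rewrite big1 // => i _; rewrite mxE eqxx.
have [i Hi] : exists i, tnth a i != tnth b i.
  apply/existsP; rewrite -negb_forall; apply/negP => /forallP E.
  by apply: ne; apply: eq_from_tnth => i; apply/eqP.
by rewrite (bigD1 i) //= mxE (negbTE Hi) mul0r.
Qed.

Lemma gpowM (R : comNzRingType) p (g h : 'M[R]_n) (a b : p.-tuple 'I_n) :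
  gpow (g *m h) a b = \sum_c gpow g a c * gpow h c b.
Proof.
rewrite /gpow; under eq_bigr do rewrite mxE.
rewrite prod_sum_tuple; apply: eq_bigr => c _.
by rewrite big_split.
Qed.

Lemma gpowZ (R : comNzRingType) p (s : R) (g : 'M[R]_n) (a b : p.-tuple 'I_n) :
  gpow (s *: g) a b = s ^+ p * gpow g a b.
Proof.
rewrite /gpow; under eq_bigr do rewrite mxE.
by rewrite big_split /= prodr_const card_ord.
Qed.

Lemma gpow_map (R S : comNzRingType) (f : {rmorphism R -> S}) p (g : 'M[R]_n)
    (a b : p.-tuple 'I_n) : gpow (map_mx f g) a b = f (gpow g a b).
Proof. by rewrite /gpow rmorph_prod; apply: eq_bigr => i _; rewrite mxE. Qed.

End TensorPower.

(** * Words and the monomials they spell *)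

Section Words.
Variables (K : fieldType) (N : nat).

Definition wmon d (w : d.-tuple 'I_N) : 'X_{1..N} := (\sum_i U_(tnth w i))%MM.

Lemma wmonE d (w : d.-tuple 'I_N) j : wmon w j = count_mem j w.
Proof.
rewrite mnm_sumE -sum1_count big_tuple [RHS]big_mkcond /=.
by apply: eq_bigr => i _; rewrite mnm1E; case: eqP.
Qed.

Lemma mdeg_wmon d (w : d.-tuple 'I_N) : mdeg (wmon w) = d.
Proof.
rewrite /wmon mdeg_sum; under eq_bigr do rewrite mdeg1.
by rewrite sum1_card card_ord.
Qed.

Lemma wmon_inj d (w w' : d.-tuple 'I_N) :
  wmon w = wmon w' -> exists s : 'S_d, w = rix w' s.
Proof.
move=> E; have /tuple_permP[s Es] : perm_eq w w'.
  by apply/allP => j _; rewrite /= -!wmonE E.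
by exists s; apply: val_inj.
Qed.

Lemma wmon_rix d (w : d.-tuple 'I_N) (s : 'S_d) : wmon (rix w s) = wmon w.
Proof.
rewrite /wmon [RHS](reindex_inj (@perm_inj _ s)).
by apply: eq_bigr => i _; rewrite tnth_rix.
Qed.

Lemma wmon_surj (m : 'X_{1..N}) d :
  mdeg m = d -> exists w : d.-tuple 'I_N, wmon w = m.
Proof.
elim: d m => [|d IH] m Hm.
  exists [tuple]; rewrite /wmon big_ord0.
  by apply/esym/eqP; rewrite -mdeg_eq0 Hm.
have [j Hj] : exists j, m j != 0%N.
  apply/existsP; rewrite -negb_forall; apply/negP => /forallP m0.
  by move: Hm; rewrite mdegE big1 // => i _; apply/eqP.
have Em : m = (m - U_(j) + U_(j))%MM by rewrite submK // lep1mP.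
have [|w Ew] := IH (m - U_(j))%MM.
  by apply: succn_inj; rewrite -Hm [in RHS]Em mdegD mdeg1 addn1.
exists [tuple of j :: w].
rewrite /wmon big_ord_recl /= Em addmC -Ew /wmon; congr (_ + _)%MM.
by apply: eq_bigr => i _; rewrite tnthS.
Qed.

Lemma mpolyX_wmon (R : comNzRingType) d (w : d.-tuple 'I_N) :
  'X_[wmon w] = \prod_i 'X_(tnth w i) :> {mpoly R[N]}.
Proof. by rewrite /wmon mprodXE. Qed.

(** Once terms with equal monomials are collected, every coefficient is zero; so the monomials may
    be replaced by arbitrary values that depend on the monomial only. *)
Lemma monomial_sum0 (I : finType) (F : I -> K) (mu : I -> 'X_{1..N})
    (z : 'X_{1..N} -> K) :
  \sum_i F i *: 'X_[mu i] = 0 :> {mpoly K[N]} -> \sum_i F i * z (mu i) = 0.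
Proof.
move=> S0; pose S := undup [seq mu i | i : I].
have -> : \sum_i F i * z (mu i) =
    \sum_(m <- S) z m * (\sum_i F i *: 'X_[mu i] : {mpoly K[N]})@_m.
  under [RHS]eq_bigr do rewrite raddf_sum /= mulr_sumr.
  rewrite exchange_big; apply: eq_bigr => i _.
  rewrite (bigD1_seq (mu i)) ?undup_uniq //=; last first.
    by rewrite mem_undup; apply: map_f; rewrite mem_enum.
  rewrite mcoeffZ mcoeffX eqxx mulr1 mulrC big1 ?addr0 // => m ne.
  by rewrite mcoeffZ mcoeffX eq_sym (negbTE ne) !mulr0.
by rewrite S0 big1 // => m _; rewrite mcoeff0 mulr0.
Qed.

End Words.

(** * Polarization and separation of degrees *)

Section Polarization.
Variables (K : fieldType) (n : nat).
Hypothesis char0 : forall m, m.+1%:R != 0 :> K.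
Local Notation idx d := (d.-tuple 'I_n).

(** Spells the entry (a, b) of the tensor power as a monomial in the entries of g ([gpow_mxvars]);
    permuting both words by the same element of S_d leaves the monomial unchanged. *)
Definition pair_word d (a b : idx d) : d.-tuple 'I_(n * n) :=
  [tuple mxvec_index (tnth a i) (tnth b i) | i < d].

Lemma mxvec_index_inj (i i' j j' : 'I_n) :
  mxvec_index i j = mxvec_index i' j' -> i = i' /\ j = j'.
Proof.
move=> E; have [f fK _] := curry_mxvec_bij n n.
have := etrans (esym (fK (i, j) isT)) (etrans (congr1 f E) (fK (i', j') isT)).
by case.
Qed.

Lemma gpow_mxvars d (a b : idx d) :
  gpow (mxvars K n) a b = 'X_[wmon (pair_word a b)].
Proof.
rewrite mpolyX_wmon; apply: eq_bigr => i _.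
by rewrite mxE tnth_mktuple.
Qed.

Lemma meval_gpow d (a b : idx d) (g : 'M[K]_n) :
  'X_[wmon (pair_word a b)].@[mxvec g 0] = gpow g a b.
Proof. by rewrite -gpow_mxvars -gpow_map meval_mxvars. Qed.

Lemma pair_word_rix d (a b a' b' : idx d) (s : 'S_d) :
  pair_word a b = rix (pair_word a' b') s -> a = rix a' s /\ b = rix b' s.
Proof.
move=> E; suff H i : tnth a i = tnth (rix a' s) i /\ tnth b i = tnth (rix b' s) i.
  by split; apply: eq_from_tnth => i; have [] := H i.
have := congr1 (fun w => tnth w i) E.
by rewrite /= !tnth_rix !tnth_mktuple => /mxvec_index_inj.
Qed.

(** Tensor powers of invertible matrices span the S_d-invariant kernels: two of their entries are
    the same monomial exactly when the index pairs lie in one S_d-orbit. *)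
Lemma polarization d (F Z : idx d -> idx d -> K) :
  (forall g, g \in unitmx -> \sum_a \sum_b F a b * gpow g a b = 0) ->
  (forall (s : 'S_d) a b, Z (rix a s) (rix b s) = Z a b) ->
  \sum_a \sum_b F a b * Z a b = 0.
Proof.
move=> F0 symZ; rewrite pair_bigA /=.
pose mu (x : idx d * idx d) := wmon (pair_word x.1 x.2).
(* By its symmetry Z depends on the monomial only; the default 0 is never reached at a monomial
   [mu x]. *)
pose z m := if [pick x | mu x == m] is Some x then Z x.1 x.2 else 0.
have zmu x : z (mu x) = Z x.1 x.2.
  rewrite /z; case: pickP => [y /eqP /wmon_inj[s /pair_word_rix[-> ->]]|/(_ x)].
    exact: symZ.
  by rewrite eqxx.
under eq_bigr do rewrite -zmu.
apply: monomial_sum0; apply: (mpoly_vanish_gl char0) => g Ug.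
rewrite raddf_sum /= -[RHS](F0 g Ug) pair_bigA.
by apply: eq_bigr => x _; rewrite mevalZ meval_gpow.
Qed.

(** Testing F against the orbit of (a, b), counted with multiplicity, gives d! F a b. *)
Lemma polarization_sym d (F : idx d -> idx d -> K) :
  (forall g, g \in unitmx -> \sum_a \sum_b F a b * gpow g a b = 0) ->
  (forall (s : 'S_d) a b, F (rix a s) (rix b s) = F a b) ->
  forall a b, F a b = 0.
Proof.
move=> F0 symF a b.
pose Z a' b' : K := \sum_(s : 'S_d) ((a' == rix a s) && (b' == rix b s))%:R.
have symZ (s : 'S_d) a' b' : Z (rix a' s) (rix b' s) = Z a' b'.
  rewrite /Z (reindex_inj (mulgI s)) /=; apply: eq_bigr => t _.
  by rewrite !rixM !eq_rix_perm.
have := polarization F0 symZ.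
rewrite /Z; under eq_bigr => a' _ do under eq_bigr => b' _ do rewrite mulr_sumr.
under eq_bigr => a' _ do rewrite exchange_big.
rewrite exchange_big /= (eq_bigr (fun=> F a b)).
  rewrite sumr_const => /eqP; rewrite -mulr_natr mulf_eq0 => /orP[/eqP //|].
  by rewrite -[#|_|]prednK ?(negbTE (char0 _)) //; apply/card_gt0P; exists 1%g.
move=> s _; rewrite (bigD1 (rix a s)) //= (bigD1 (rix b s)) //= !eqxx mulr1 symF.
rewrite !big1 ?addr0 //.
  move=> a' ne; apply: big1 => b' _; by rewrite (negbTE ne) mulr0.
by move=> b' ne; rewrite (negbTE ne) mulr0.
Qed.

(** At s g the sum becomes a polynomial in s with coefficients f d g, which vanishes for every
    nonzero s. *)
Lemma homothety_split D (f : nat -> 'M[K]_n -> K) :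
  (forall g, g \in unitmx -> \sum_(d < D) f d g = 0) ->
  (forall d s g, f d (s *: g) = s ^+ d * f d g) ->
  forall (d : 'I_D) g, g \in unitmx -> f d g = 0.
Proof.
move=> f0 fZ d g Ug.
have : \poly_(d < D) f d g = 0.
  apply: (poly_vanish char0) => s s0.
  rewrite horner_poly -[RHS](f0 (s *: g)).
    by apply: eq_bigr => i _; rewrite fZ mulrC.
  by rewrite unitmxZ ?unitfE.
by move/(congr1 (fun q : {poly K} => q`_d)); rewrite coef_poly coef0 ltn_ord.
Qed.

End Polarization.

(** * The commutant of the tensor powers *)

Section FirstFundamentalTheorem.
Variables (K : fieldType) (n : nat).
Hypothesis char0 : forall m, m.+1%:R != 0 :> K.
Local Notation idx d := (d.-tuple 'I_n).

Definition intertwines m m' (X : idx m -> idx m' -> K) := forall g, g \in unitmx ->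
  forall a b, \sum_c X a c * gpow g c b = \sum_c gpow g a c * X c b.

Lemma sum_eqr (I : finType) (F : I -> K) b : \sum_i F i * (i == b)%:R = F b.
Proof.
rewrite (bigD1 b) //= eqxx mulr1 big1 ?addr0 // => i ne.
by rewrite (negbTE ne) mulr0.
Qed.

Lemma sum_eql (I : finType) (F : I -> K) b : \sum_i (i == b)%:R * F i = F b.
Proof. by under eq_bigr do rewrite mulrC; rewrite sum_eqr. Qed.

(** An entry of the commutator of X with Z is a linear form in Z, with coefficients F below; it
    vanishes on tensor powers, hence on symmetric kernels by polarization. *)
Lemma intertwines_symmetric m (X Z : idx m -> idx m -> K) :
  intertwines X -> (forall (s : 'S_m) a b, Z (rix a s) (rix b s) = Z a b) ->
  forall a b, \sum_c X a c * Z c b = \sum_c Z a c * X c b.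
Proof.
move=> HX symZ a b; apply/eqP; rewrite -subr_eq0; apply/eqP.
pose F c d : K := X a c * (d == b)%:R - (c == a)%:R * X d b.
have expand (Y : idx m -> idx m -> K) : \sum_c \sum_d F c d * Y c d =
    \sum_c X a c * Y c b - \sum_c Y a c * X c b.
  under eq_bigr do under eq_bigr do rewrite mulrBl.
  under eq_bigr do rewrite big_split /= sumrN.
  rewrite big_split /= sumrN; congr (_ - _).
    apply: eq_bigr => c _; under eq_bigr do rewrite mulrAC.
    by rewrite sum_eqr.
  rewrite exchange_big /=; apply: eq_bigr => d _.
  under eq_bigr do rewrite -mulrA.
  by rewrite sum_eql mulrC.
rewrite -expand; apply: (polarization char0) => // g Ug.
by rewrite expand HX // subrr.
Qed.

(* Double centralizer: a linear projection P of the m x m kernels onto the span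
   of the permutations, averaged so that it commutes with S_m acting on the
   left, is given by symmetric kernels; these commute with X, so that
   P(X) = X P(1) = X. *)
Lemma fft_square m (X : idx m -> idx m -> K) : intertwines X ->
  exists c : 'S_m * 'S_m -> K, forall a b,
    X a b = \sum_j c j * (b == rix a (j.2 * j.1)%g)%:R.
Proof.
move=> HX; pose U : vectType K := {ffun idx m * idx m -> K^o}.
pose R (s : 'S_m) : U := [ffun x => (x.2 == rix x.1 s)%:R].
pose RR : {vspace U} := <<[tuple R (enum_val i) | i < #|{perm 'I_m}|]>>%VS.
have memR s : R s \in RR.
  apply/memv_span/tnthP; exists (enum_rank s).
  by rewrite tnth_mktuple enum_rankK.
(* Matrix of a linear projection onto the span RR of the permutation kernels, in the basis of
   elementary kernels. *)
pose k0 (x y : idx m * idx m) : K := projv RR [ffun z => (z == y)%:R : K^o] x.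
have k0E (Y : U) x : projv RR Y x = \sum_y k0 x y * Y y.
  have {1}-> : Y = \sum_y (Y y : K) *: ([ffun z => (z == y)%:R : K^o] : U).
    apply/ffunP => z; rewrite sum_ffunE.
    under eq_bigr do rewrite !ffunE /= /GRing.scale /= eq_sym.
    by rewrite sum_eqr.
  rewrite linear_sum sum_ffunE; apply: eq_bigr => y _.
  by rewrite linearZ !ffunE /= /GRing.scale /= mulrC.
have fact0 : m`!%:R != 0 :> K.
  by rewrite -[m`!]prednK ?fact_gt0.
(* The average makes k, at fixed c and d, a symmetric kernel in (a, b). *)
pose k (a c b d : idx m) : K := m`!%:R^-1 *
  \sum_(s : 'S_m) k0 (rix a s, c) (rix b s, d).
have symk c d (s : 'S_m) a b : k (rix a s) c (rix b s) d = k a c b d.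
  rewrite /k; congr (_ * _); rewrite [RHS](reindex_inj (mulIg s)) /=.
  by apply: eq_bigr => t _; rewrite !rixM.
pose sh (Y : idx m -> idx m -> K) (s : 'S_m) : U :=
  [ffun x => Y (rix x.1 (s^-1)%g) x.2].
have kE Y a c : \sum_b \sum_d k a c b d * Y b d =
    m`!%:R^-1 * \sum_(s : 'S_m) (projv RR (sh Y s) (rix a s, c) : K).
  rewrite mulr_sumr pair_bigA /= /k.
  under eq_bigr do rewrite -mulrA mulr_suml mulr_sumr.
  rewrite exchange_big /=; apply: eq_bigr => s _.
  rewrite -mulr_sumr; congr (_ * _); rewrite k0E.
  rewrite -(pair_bigA _ (fun b d => k0 (rix a s, c) (rix b s, d) * Y b d)) /=.
  rewrite (eq_bigr (fun y => k0 (rix a s, c) (y.1, y.2) * Y (rix y.1 (s^-1)%g) y.2)).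
    rewrite -(pair_bigA _ (fun b d => k0 (rix a s, c) (b, d) * Y (rix b (s^-1)%g) d)) /=.
    by rewrite [RHS](sum_rix s); apply: eq_bigr => b _; rewrite rixK.
  by case=> b d _; rewrite ffunE.
(* Every permuted identity is a permutation kernel, so the projection fixes it. *)
have P1 a c : \sum_b \sum_d k a c b d * (d == b)%:R = (c == a)%:R.
  rewrite (kE (fun b d => (d == b)%:R)) (eq_bigr (fun=> (c == a)%:R)).
    by rewrite sumr_const card_Sn -(mulr_natl (_ == _)%:R) mulrA mulVf ?mul1r.
  move=> s _; rewrite projv_id ?ffunE /= ?rixK //.
  suff -> : sh (fun b d => (d == b)%:R) s = R (s^-1)%g by exact: memR.
  by apply/ffunP => x; rewrite !ffunE.
(* At fixed c and d the symmetric kernel k commutes with X; moving X to the left leaves the image of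
   the identity, known from [P1]. *)
have PX a c : \sum_b \sum_d k a c b d * X b d = X a c.
  rewrite exchange_big /=.
  under eq_bigr => d _ do
    rewrite -(@intertwines_symmetric m X (fun a b => k a c b d)) //.
  rewrite exchange_big /= -[RHS]sum_eqr; apply: eq_bigr => b _.
  rewrite -mulr_sumr; congr (_ * _); rewrite eq_sym -P1.
  rewrite [RHS]exchange_big /=; apply: eq_bigr => d _.
  by under [RHS]eq_bigr do rewrite eq_sym; rewrite sum_eqr.
pose u j : K := m`!%:R^-1 * coord [tuple R (enum_val i) | i < #|{perm 'I_m}|]
  (enum_rank j.2) (projv RR (sh X j.1)).
exists u => a b.
rewrite -PX kE mulr_sumr.
rewrite -(pair_bigA _ (fun s t => u (s, t) * (b == rix a (t * s)%g)%:R)) /=.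
apply: eq_bigr => s _.
rewrite [in LHS](coord_span (memv_proj RR (sh X s))) sum_ffunE mulr_sumr.
rewrite (reindex (@enum_rank _)) /=; last exact: onW_bij (enum_rank_bij _).
apply: eq_bigr => t _; rewrite /u /= -mulrA; congr (_ * _).
rewrite (nth_map (enum_rank t)) ?size_enum_ord //.
by rewrite nth_ord_enum enum_rankK !ffunE /= rixM.
Qed.

End FirstFundamentalTheorem.

Section FirstFundamentalTheoremRect.
Variables (K : fieldType) (n : nat).
Hypothesis char0 : forall m, m.+1%:R != 0 :> K.
Local Notation idx d := (d.-tuple 'I_n).

(** Bijections between the two index sets, instead of permutations, need no cast from m' to m; for
    unequal lengths the family is empty. *)
Lemma fft m m' (X : idx m -> idx m' -> K) : intertwines X ->
  exists (J : finType) (c : J -> K) (f : J -> 'I_m' -> 'I_m),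
    (forall j, bijective (f j)) /\
    forall a b, X a b = \sum_j c j * (b == rix a (f j))%:R.
Proof.
move=> HX; have [Em|ne] := eqVneq m' m.
  subst m'; have [c Hc] := fft_square char0 HX.
  exists ('S_m * 'S_m)%type, c, (fun (j : 'S_m * 'S_m) i => (j.2 * j.1)%g i); split=> // j.
  by exists ((j.2 * j.1)^-1)%g => i; [exact: permK | exact: permKV].
exists void, (fun=> 0), (fun j : void => match j with end); split; first by case.
move=> a b; rewrite [RHS]big1 => [|[]].
(* The homothety 2 acts by 2^m on one side and by 2^m' on the other. *)
have U2 : 2%:R%:M \in @unitmx K n by rewrite unitmxE det_scalar unitfE expf_neq0.
have := HX _ U2 a b.
rewrite -[2%:R%:M]mulmx1 mul_scalar_mx.
under eq_bigr do rewrite gpowZ gpow1 mulrCA.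
under [RHS]eq_bigr do rewrite gpowZ gpow1 -mulrA eq_sym.
rewrite -mulr_sumr sum_eqr -mulr_sumr sum_eql => /eqP.
rewrite -subr_eq0 -mulrBl mulf_eq0 => /orP[|/eqP //].
by rewrite subr_eq0 -!natrX => /eqP /(natr_inj0 char0) /eqP; rewrite eqn_exp2l // (negbTE ne).
Qed.

End FirstFundamentalTheoremRect.

(** * Equivariant maps are tensor operations *)

Section CatTuples.
Variable T : Type.

Definition tfst p q (a : (p + q).-tuple T) : p.-tuple T := rix a (@lshift p q).
Definition tsnd p q (a : (p + q).-tuple T) : q.-tuple T := rix a (@rshift p q).
Definition tcat p q (a : p.-tuple T) (b : q.-tuple T) : (p + q).-tuple T :=
  [tuple of a ++ b].

Lemma tfst_cat p q (a : p.-tuple T) (b : q.-tuple T) : tfst (tcat a b) = a.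
Proof. by apply: eq_from_tnth => i; rewrite tnth_rix tnth_lshift. Qed.

Lemma tsnd_cat p q (a : p.-tuple T) (b : q.-tuple T) : tsnd (tcat a b) = b.
Proof. by apply: eq_from_tnth => i; rewrite tnth_rix tnth_rshift. Qed.

Lemma tcat_split p q (a : (p + q).-tuple T) : tcat (tfst a) (tsnd a) = a.
Proof.
apply: eq_from_tnth => i; rewrite -(splitK i).
by case: (split i) => j /=; rewrite ?tnth_lshift ?tnth_rshift tnth_rix.
Qed.

End CatTuples.

Lemma eq_tcat (T : eqType) p q (a : p.-tuple T) (b : q.-tuple T) c :
  (tcat a b == c) = (a == tfst c) && (b == tsnd c).
Proof.
apply/eqP/andP => [<-|[/eqP-> /eqP->]]; last exact: tcat_split.
by rewrite tfst_cat tsnd_cat.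
Qed.

Lemma sum_tcat (T : finType) (R : nmodType) p q (F : (p + q).-tuple T -> R) :
  \sum_c F c = \sum_a \sum_b F (tcat a b).
Proof.
rewrite pair_bigA /= (reindex (fun x : p.-tuple T * q.-tuple T => tcat x.1 x.2)) //.
exists (fun c => (tfst c, tsnd c)) => [[a b]|c] _ /=.
  by rewrite tfst_cat tsnd_cat.
by rewrite tcat_split.
Qed.

Lemma sum_tcons (T : finType) (R : nmodType) p (F : p.+1.-tuple T -> R) :
  \sum_c F c = \sum_(k : T) \sum_(b : p.-tuple T) F [tuple of k :: b].
Proof.
rewrite pair_bigA /= (reindex (fun x : T * p.-tuple T => [tuple of x.1 :: x.2])) //.
exists (fun c => (thead c, [tuple of behead c])) => [[a b]|c] _ /=.
  by rewrite theadE; congr (_, _); apply: val_inj.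
by rewrite -tuple_eta.
Qed.

Lemma sum_tuple0 (T : finType) (R : nmodType) (F : 0.-tuple T -> R) :
  \sum_c F c = F [tuple].
Proof.
rewrite (bigD1 [tuple]) //= big1 ?addr0 // => c /eqP[].
exact: tuple0.
Qed.

Lemma gpow_cat n (R : comNzRingType) p q (g : 'M[R]_n) (a c : p.-tuple 'I_n)
    (b d : q.-tuple 'I_n) :
  gpow g (tcat a b) (tcat c d) = gpow g a c * gpow g b d.
Proof.
rewrite /gpow big_split_ord /=.
by congr (_ * _); apply: eq_bigr => i _; rewrite ?tnth_lshift ?tnth_rshift.
Qed.

Section TensorOps.
Variables (K : fieldType) (n : nat).
Hypothesis char0 : forall m, m.+1%:R != 0 :> K.
Local Notation idx d := (d.-tuple 'I_n).
Local Notation tfield := (tensor n {mpoly K[n]}).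

(** The inductive predicates are indexed by functions; closing them under pointwise equality takes
    the place of functional extensionality. The same is done in [is_obtained]. *)
Definition is_op p q p' q' (f : tfield p q -> tfield p' q') :=
  exists2 A, tensor_op A & A =1 f.

Definition is_obtained p q p' q' (f : tfield p q -> tfield p' q') :=
  exists2 D, obtained_from_d D & D =1 f.

Lemma is_op_comp p q p' q' p'' q'' (f : tfield p' q' -> tfield p'' q'')
    (g : tfield p q -> tfield p' q') :
  is_op f -> is_op g -> is_op (f \o g).
Proof.
case=> A opA EA [B opB EB]; exists (A \o B); first exact: tensor_op_comp.
by move=> t /=; rewrite EA EB.
Qed.

Lemma is_op_permutation p q (s : 'S_p) (s' : 'S_q) : is_op (@permutation K n p q s s').
Proof. by exists (permutation s s') => //; apply: tensor_op_permutation. Qed.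

Lemma is_op_id p q : is_op (@id (tfield p q)).
Proof.
exists (permutation 1%g 1%g); first exact: tensor_op_permutation.
move=> t; apply/ffunP => -[x y]; rewrite ffunE /=; congr (t (_, _));
  by apply: eq_from_tnth => i; rewrite tnth_mktuple perm1.
Qed.

Lemma eq_is_op p q p' q' (f g : tfield p q -> tfield p' q') :
  f =1 g -> is_op f -> is_op g.
Proof. by move=> E [A opA EA]; exists A => // t; rewrite EA E. Qed.

Lemma is_op_reindex p q p' q' (f : 'I_p -> 'I_p') (h : 'I_q -> 'I_q') :
  bijective f -> bijective h ->
  is_op (fun t : tfield p q =>
    [ffun x : idx p' * idx q' => t (rix x.1 f, rix x.2 h)]).
Proof.
move=> bf bh; have Ep : p = p' by have := bij_eq_card bf; rewrite !card_ord.
have Eq : q = q' by have := bij_eq_card bh; rewrite !card_ord.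
subst p' q'; apply: (eq_is_op _ (is_op_permutation (perm (bij_inj bf)) (perm (bij_inj bh)))).
move=> t; apply/ffunP => x; rewrite !ffunE; congr (t (_, _));
  by apply: eq_from_tnth => i; rewrite !tnth_mktuple permE.
Qed.

Lemma is_op_contractions c p q :
  is_op (fun t : tfield (c + p) (c + q) =>
    [ffun x => \sum_(w : idx c) t (tcat w x.1, tcat w x.2)]).
Proof.
elim: c => [|c IH].
  apply: eq_is_op (is_op_id p q) => t; apply/ffunP => -[x y].
  by rewrite ffunE sum_tuple0 /=; congr (t (_, _)); apply: val_inj.
have opc : is_op (@contraction K n (c + p) (c + q)).
  by exists (@contraction K n (c + p) (c + q)) => //; apply: tensor_op_contraction.
apply: eq_is_op (is_op_comp IH opc) => t; apply/ffunP => x.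
rewrite !ffunE sum_tcons exchange_big /=; apply: eq_bigr => w _.
rewrite ffunE; apply: eq_bigr => k _.
by congr (t (_, _)); apply: val_inj.
Qed.

Lemma is_op_tensor_ids c p q :
  is_op (fun t : tfield p q =>
    [ffun x : idx (c + p) * idx (c + q) =>
      (tfst x.1 == tfst x.2)%:R * t (tsnd x.1, tsnd x.2)]).
Proof.
elim: c => [|c IH].
  apply: eq_is_op (is_op_id p q) => t; apply/ffunP => -[x y].
  have E (u v : idx 0) : u == v by apply/eqP/(etrans (tuple0 u) (esym (tuple0 v))).
  rewrite ffunE E mul1r.
  by congr (t (_, _)); apply: eq_from_tnth => i; rewrite tnth_rix; congr tnth; apply: val_inj.
have opc : is_op (@tensor_id K n (c + p) (c + q)).
  by exists (@tensor_id K n (c + p) (c + q)) => //; apply: tensor_op_id.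
apply: eq_is_op (is_op_comp opc IH) => t; apply/ffunP => -[x y].
rewrite -(@tcat_split _ c.+1 p x) -(@tcat_split _ c.+1 q y) !ffunE.
move: (@tfst _ c.+1 p x) (@tfst _ c.+1 q y) (@tsnd _ c.+1 p x) (@tsnd _ c.+1 q y).
move=> /tupleP[k x'] /tupleP[l y'] u v; rewrite !tfst_cat !tsnd_cat /=.
have beheadE j (z : idx c) r (w : idx r) :
    [tuple of behead (tcat [tuple of j :: z] w)] = tcat z w by exact: val_inj.
rewrite !beheadE !tfst_cat !tsnd_cat mulrA -natrM mulnb.
by congr (_%:R * _).
Qed.

Definition kapp p q p' q' (X : idx p' -> idx q' -> idx p -> idx q -> K)
    (t : tfield p q) : tfield p' q' :=
  [ffun x => \sum_a \sum_b X x.1 x.2 a b *: t (a, b)].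

(* Equivariance, with the lower indices moved to the other side so that no
   inverse matrix occurs. *)
Definition equivariant p q p' q' (X : idx p' -> idx q' -> idx p -> idx q -> K) :=
  forall g : 'M[K]_n, g \in unitmx -> forall a' b' c d,
    \sum_d' \sum_a gpow g d' b' * gpow g a c * X a' d' a d =
    \sum_c' \sum_b gpow g a' c' * gpow g d b * X c' b' c b.

Lemma is_obtained_op p q p' q' (f : tfield p q -> tfield p' q') :
  is_op f -> is_obtained f.
Proof. by case=> A opA EA; exists A => //; apply: obtained_tensor_op. Qed.

Lemma eq_is_obtained p q p' q' (f g : tfield p q -> tfield p' q') :
  f =1 g -> is_obtained f -> is_obtained g.
Proof. by move=> E [A opA EA]; exists A => // t; rewrite EA E. Qed.

Lemma is_obtained_postcomp p q p' q' p'' q'' (f : tfield p' q' -> tfield p'' q'')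
    (g : tfield p q -> tfield p' q') :
  is_op f -> is_obtained g -> is_obtained (f \o g).
Proof.
case=> A opA EA [B opB EB]; exists (A \o B); first exact: obtained_postcomp.
by move=> t /=; rewrite EA EB.
Qed.

Lemma is_obtained_precomp p q p' q' p'' q'' (f : tfield p' q' -> tfield p'' q'')
    (g : tfield p q -> tfield p' q') :
  is_obtained f -> is_op g -> is_obtained (f \o g).
Proof.
case=> A opA EA [B opB EB]; exists (A \o B); first exact: obtained_precomp.
by move=> t /=; rewrite EA EB.
Qed.

Lemma is_obtained_lin p q p' q' (c : K) (f g : tfield p q -> tfield p' q') :
  is_obtained f -> is_obtained g -> is_obtained (fun t => c *: f t + g t).
Proof.
case=> A opA EA [B opB EB]; exists (fun t => c *: A t + B t).
  exact: obtained_lin.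
by move=> t /=; rewrite EA EB.
Qed.

Lemma is_obtained0 p q p' q' : is_obtained (fun _ : tfield p q => 0 : tfield p' q').
Proof. by exists (fun=> 0) => //; apply: obtained_zero. Qed.

Lemma is_obtained_sum p q p' q' (I : finType) (c : I -> K)
    (f : I -> tfield p q -> tfield p' q') :
  (forall i, is_obtained (f i)) -> is_obtained (fun t => \sum_i c i *: f i t).
Proof.
move=> Hf; elim: (index_enum I) => [|i r IH].
  by apply: eq_is_obtained (is_obtained0 p q p' q') => t; rewrite big_nil.
apply: eq_is_obtained (is_obtained_lin (c i) (Hf i) IH) => t.
by rewrite big_cons.
Qed.

(** One term of the first fundamental theorem: a product of Kronecker deltas in which f joins each
    output lower or input upper slot to an input lower or output upper slot. *)
Definition wiring p q p' q' (f : 'I_(q' + p) -> 'I_(q + p'))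
    (t : tfield p q) : tfield p' q' :=
  [ffun x : idx p' * idx q' => \sum_a \sum_b
     (tcat x.2 a == rix (tcat b x.1) f)%:R *: t (a, b)].

(** Insert q' identities, whose lower ends become the output lower indices; permute by f the upper
    indices now present; contract q of them with the input lower indices. The map h swaps the two
    blocks of lower slots so that those to be contracted come first. *)
Lemma is_op_wiring p q p' q' (f : 'I_(q' + p) -> 'I_(q + p')) :
  bijective f -> is_op (@wiring p q p' q' f).
Proof.
move=> bf; pose h (i : 'I_(q' + q)) : 'I_(q + q') :=
  match split i with inl j => rshift q j | inr j => lshift q' j end.
pose h' (i : 'I_(q + q')) : 'I_(q' + q) :=
  match split i with inl j => rshift q' j | inr j => lshift q j end.
have hl j : h (lshift q j) = rshift q j.
  by rewrite /h -[lshift _ _]/(unsplit (inl j)) unsplitK.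
have hr j : h (rshift q' j) = lshift q' j.
  by rewrite /h -[rshift _ _]/(unsplit (inr j)) unsplitK.
have bh : bijective h.
  exists h' => i; rewrite -(splitK i) /h' /h; case: (split i) => j.
  - by rewrite unsplitK -[rshift _ _]/(unsplit (inr j)) unsplitK.
  - by rewrite unsplitK -[lshift _ _]/(unsplit (inl j)) unsplitK.
  - by rewrite unsplitK -[rshift _ _]/(unsplit (inr j)) unsplitK.
  - by rewrite unsplitK -[lshift _ _]/(unsplit (inl j)) unsplitK.
have := is_op_comp (is_op_contractions q p' q')
  (is_op_comp (is_op_reindex bf bh) (is_op_tensor_ids q' p q)).
apply: eq_is_op => t; apply/ffunP => -[x y].
rewrite !ffunE /= exchange_big /=; apply: eq_bigr => w _.
rewrite !ffunE /=.
have -> : tfst (rix (tcat w y) h) = y.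
  by apply: eq_from_tnth => i; rewrite !tnth_rix hl tnth_rshift.
have -> : tsnd (rix (tcat w y) h) = w.
  by apply: eq_from_tnth => i; rewrite !tnth_rix hr tnth_lshift.
set r := rix _ f; rewrite (bigD1 (tsnd r)) //= big1 ?addr0 => [|a ne].
  by rewrite eq_tcat eqxx andbT eq_sym scaler_nat mulr_natl.
by rewrite eq_tcat (negbTE ne) andbF scale0r.
Qed.

(** Grouping input lower with output upper indices, and output lower with input upper ones, turns
    equivariance into an intertwining relation between pure tensor powers, to which [fft]
    applies. *)
Lemma equivariant_wirings p q p' q' (X : idx p' -> idx q' -> idx p -> idx q -> K) :
  equivariant X -> exists (J : finType) (c : J -> K) (f : J -> 'I_(q' + p) -> 'I_(q + p')),
    (forall j, bijective (f j)) /\ kapp X =1 fun t => \sum_j c j *: wiring (f j) t.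
Proof.
move=> HX; pose Y (a : idx (q + p')) (b : idx (q' + p)) : K :=
  X (tsnd a) (tfst b) (tsnd b) (tfst a).
have [|J [c [f [bf Ef]]]] := @fft _ _ char0 _ _ Y.
  move=> g Ug a b; rewrite !sum_tcat.
  have E1 a0 b0 : Y a (tcat a0 b0) * gpow g (tcat a0 b0) b =
      gpow g a0 (tfst b) * gpow g b0 (tsnd b) * X (tsnd a) a0 b0 (tfst a).
    by rewrite /Y tfst_cat tsnd_cat -[in LHS](tcat_split b) gpow_cat mulrC.
  have E2 a0 b0 : gpow g a (tcat a0 b0) * Y (tcat a0 b0) b =
      gpow g (tsnd a) b0 * gpow g (tfst a) a0 * X b0 (tfst b) (tsnd b) a0.
    rewrite /Y tfst_cat tsnd_cat -[in LHS](tcat_split a) gpow_cat.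
    by rewrite [_ * gpow _ _ b0]mulrC.
  under eq_bigr do under eq_bigr do rewrite E1.
  under [RHS]eq_bigr do under eq_bigr do rewrite E2.
  by rewrite HX // [RHS]exchange_big.
exists J, c, f; split=> // t; apply/ffunP => -[x y].
rewrite sum_ffunE ffunE /=.
have XE a b : X x y a b = \sum_j c j * (tcat y a == rix (tcat b x) (f j))%:R.
  by rewrite -Ef /Y !tfst_cat !tsnd_cat.
under eq_bigr do under eq_bigr do rewrite XE scaler_suml.
under eq_bigr do rewrite exchange_big.
rewrite exchange_big /=; apply: eq_bigr => j _.
rewrite !ffunE /= scaler_sumr; apply: eq_bigr => a _.
by rewrite scaler_sumr; apply: eq_bigr => b _; rewrite scalerA.
Qed.

Lemma equivariant_obtained p q p' q' p'' q''
    (X : idx p'' -> idx q'' -> idx p' -> idx q' -> K) (f : tfield p q -> tfield p' q') :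
  equivariant X -> is_obtained f -> is_obtained (kapp X \o f).
Proof.
case/equivariant_wirings=> J [c [w [bw Ew]]] obf.
have := is_obtained_sum c (fun j => is_obtained_postcomp (is_op_wiring (bw j)) obf).
by apply: eq_is_obtained => t /=; rewrite Ew.
Qed.

End TensorOps.

(** * Natural first-order symbols *)

Section Update.
Variable T : Type.

Definition upd p (a : p.-tuple T) (s : 'I_p) (k : T) : p.-tuple T :=
  [tuple if i == s then k else tnth a i | i < p].

Lemma tnth_upd p (a : p.-tuple T) s k i :
  tnth (upd a s k) i = if i == s then k else tnth a i.
Proof. by rewrite tnth_mktuple. Qed.

Lemma upd_id p (a : p.-tuple T) s k : tnth a s = k -> upd a s k = a.
Proof.
by move=> <-; apply: eq_from_tnth => i; rewrite tnth_upd; case: eqP => // ->.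
Qed.

Lemma upd_upd p (a : p.-tuple T) s k l : upd (upd a s k) s l = upd a s l.
Proof. by apply: eq_from_tnth => i; rewrite !tnth_upd; case: eqP. Qed.

End Update.

Section FirstOrder.
Variables (K : fieldType) (n : nat).
Hypothesis char0 : forall m, m.+1%:R != 0 :> K.
Local Notation idx d := (d.-tuple 'I_n).
Local Notation tfield := (tensor n {mpoly K[n]}).
Local Notation symbol p' q' p q := (idx p' -> idx q' -> idx p -> 'I_n -> idx q -> K).

Definition dapp p q p' q' (D : symbol p' q' p q) (t : tfield p q) : tfield p' q' :=
  [ffun x => \sum_a \sum_i \sum_b D x.1 x.2 a i b *: (t (a, b))^`M(i)].

Definition equivariant1 p q p' q' (D : symbol p' q' p q) :=
  forall g : 'M[K]_n, g \in unitmx -> forall a' b' c i d,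
    \sum_d' \sum_a gpow g d' b' * gpow g a c * D a' d' a i d =
    \sum_c' \sum_j \sum_b gpow g a' c' * (g i j * gpow g d b) * D c' b' c j b.

(* D_i E_kj + D_j E_ki = 0, where E_kj acts by derivations on T^(p,q). *)
Definition jet_invariant p q p' q' (D : symbol p' q' p q) :=
  forall a' b' a b i j k,
    \sum_s (tnth a s == j)%:R * D a' b' (upd a s k) i b +
    \sum_s (tnth a s == i)%:R * D a' b' (upd a s k) j b =
    \sum_t (tnth b t == k)%:R * (D a' b' a i (upd b t j) + D a' b' a j (upd b t i)).

Definition natural_symbol p q p' q' (D : symbol p' q' p q) :=
  equivariant1 D /\ jet_invariant D.

(** The derivative index is treated as one more lower index, in front of the others. *)
Definition uncons_symbol p q p' q' (D : symbol p' q' p q) a' b' a (c : idx q.+1) :=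
  D a' b' a (thead c) [tuple of behead c].

Lemma gpow_cons (R : comNzRingType) p (g : 'M[R]_n) (i j : 'I_n) (a b : idx p) :
  gpow g [tuple of i :: a] [tuple of j :: b] = g i j * gpow g a b.
Proof.
rewrite /gpow big_ord_recl; congr (_ * _).
by apply: eq_bigr => k _; rewrite !tnthS.
Qed.

Lemma uncons_symbol_cons p q p' q' (D : symbol p' q' p q) a' b' a (i : 'I_n) (b : idx q) :
  uncons_symbol D a' b' a [tuple of i :: b] = D a' b' a i b.
Proof. by rewrite /uncons_symbol theadE; congr D; apply: val_inj. Qed.

Lemma equivariant_uncons p q p' q' (D : symbol p' q' p q) :
  equivariant1 D -> equivariant (uncons_symbol D).
Proof.
move=> HD g Ug a' b' c /tupleP[i d].
under eq_bigr do under eq_bigr do rewrite uncons_symbol_cons.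
rewrite HD //; apply: eq_bigr => c' _; rewrite sum_tcons.
apply: eq_bigr => j _; apply: eq_bigr => b _.
by rewrite uncons_symbol_cons gpow_cons.
Qed.

(** * Symbols without upper indices are skew and factor through d *)

Section Covariant.
Variables (q p' q' : nat) (D : symbol p' q' 0 q).
Hypothesis HD : jet_invariant D.

(** For i = j = k the relation reads 2 N D_i(b) = 0, where N counts the occurrences of i in b. *)
Lemma symbol_mem0 a' b' a i b t : tnth b t = i -> D a' b' a i b = 0.
Proof.
move=> bt; have := HD a' b' a b i i i; rewrite !big_ord0 addr0 => /esym.
under eq_bigr => u _.
  rewrite (_ : _ * _ = (tnth b u == i)%:R * (D a' b' a i b + D a' b' a i b)).
    over.
  by have [E|] := eqVneq (tnth b u) i; rewrite ?mul0r // upd_id.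
rewrite -mulr_suml -natr_sum (bigD1 t) //= bt eqxx add1n => /eqP.
rewrite mulf_eq0 (negbTE (char0 _)) /= -mulr2n -mulr_natl mulf_eq0.
by rewrite (negbTE (char0 1)) => /eqP.
Qed.

(** The relation for k acts on all occurrences of k in b. It isolates slot t if b_t occurs nowhere
    else, or, read at [upd b t i], if i occurs nowhere else. In the remaining case both sides vanish
    by [symbol_mem0]. *)
Lemma symbol_swap a' b' a i b t :
  D a' b' a i b = - D a' b' a (tnth b t) (upd b t i).
Proof.
set j := tnth b t; apply/eqP; rewrite -addr_eq0; apply/eqP.
have [/existsP[u /andP[ut /eqP bu]]|no_j] :=
    boolP [exists u, (u != t) && (tnth b u == j)]; last first.
  have := HD a' b' a b i j j; rewrite !big_ord0 addr0 => /esym.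
  rewrite (bigD1 t) //= eqxx mul1r upd_id // big1 ?addr0 // => u ut.
  move: no_j; rewrite negb_exists => /forallP/(_ u).
  by rewrite ut /= => /negbTE->; rewrite mul0r.
have [/existsP[v /andP[vt /eqP bv]]|no_i] :=
    boolP [exists u, (u != t) && (tnth b u == i)].
  rewrite (symbol_mem0 _ _ _ bv) (@symbol_mem0 _ _ _ _ _ u) ?addr0 //.
  by rewrite tnth_upd (negbTE ut).
have := HD a' b' a (upd b t i) i j i; rewrite !big_ord0 addr0 => /esym.
rewrite (bigD1 t) //= tnth_upd !eqxx mul1r !upd_upd (upd_id (k := j)) //.
rewrite big1 ?addr0 // => u0 ut0; rewrite tnth_upd (negbTE ut0).
move: no_i; rewrite negb_exists => /forallP/(_ u0).
by rewrite ut0 /= => /negbTE->; rewrite mul0r.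
Qed.

Let U := uncons_symbol D.

(** [symbol_swap] is the case of a transposition of position 0 with another one; every other
    transposition is conjugate to such a one by a third of the same kind. *)
Lemma uncons_perm a' b' a (c : idx q.+1) (s : 'S_q.+1) :
  U a' b' a (rix c s) = (-1) ^+ s * U a' b' a c.
Proof.
have U0 (t : 'I_q) c0 : U a' b' a (rix c0 (tperm ord0 (lift ord0 t))) = - U a' b' a c0.
  case/tupleP: c0 => i b; rewrite {2}/U uncons_symbol_cons (symbol_swap _ _ _ _ _ t) opprK.
  rewrite -[RHS]uncons_symbol_cons; congr uncons_symbol; apply: eq_from_tnth => j.
  rewrite tnth_rix; have [k ->|->] := unliftP ord0 j.
    rewrite tnthS tnth_upd; case: tpermP => [/eqP|/lift_inj->|/eqP _ ne].
    - by rewrite -[_ == _]negbK eq_sym neq_lift.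
    - by rewrite eqxx.
    - by rewrite tnthS ifN //; apply: contra_not_neq ne => ->.
  by rewrite tpermL !tnthS.
have U1 (x y : 'I_q.+1) c0 : x != y -> U a' b' a (rix c0 (tperm x y)) = - U a' b' a c0.
  wlog y0 : x y / y != ord0 => [W|].
    have [->|//] := eqVneq y ord0; last exact: W.
    by rewrite tpermC => ne; apply: W; rewrite // eq_sym.
  have [k ->|E] := unliftP ord0 y; last by rewrite E eqxx in y0.
  have [l ->|->] := unliftP ord0 x; last by rewrite U0.
  move=> ne; have -> : tperm (lift ord0 l) (lift ord0 k) =
     (tperm ord0 (lift ord0 k) * tperm ord0 (lift ord0 l) * tperm ord0 (lift ord0 k))%g.
    rewrite -{1}(tpermV ord0 (lift ord0 k)) -mulgA -[RHS]/(_ ^ _)%g tpermJ tpermL.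
    by rewrite tpermD ?neq_lift // 1?eq_sym // tpermC.
  by rewrite !rixM !U0 opprK.
have [ts -> Hts] := prod_tpermP s.
elim: ts c Hts => [|x ts IH] c /=.
  rewrite big_nil odd_perm1 expr0 mul1r (eq_rix _ (u := id)) ?rix_id // => i.
  by rewrite perm1.
case/andP => Hx Hts; rewrite big_cons rixM U1 //.
by rewrite IH // odd_mul_tperm Hx signr_addb expr1 mulN1r mulNr.
Qed.

Lemma dapp_ext_diff (t : tfield 0 q) :
  dapp D t = (q.+1%:R^-1 : K) *: kapp U (ext_diff (alternation t)).
Proof.
pose h (z : tfield 0 q) (a : idx 0) (c : idx q.+1) : {mpoly K[n]} :=
  (z (a, [tuple of behead c]))^`M(thead c).
have hcons z a (i : 'I_n) (b : idx q) : h z a [tuple of i :: b] = (z (a, b))^`M(i).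
  by rewrite /h theadE; congr ((z (_, _))^`M(_)); apply: val_inj.
(* The cycle bringing position j to the front has sign (-1)^j, so the q + 1 terms of [ext_diff]
   contribute equally; hence the constant 1 / (q + 1). *)
have cycle a' b' a z : \sum_c U a' b' a c *: ext_diff z (a, c) =
    q.+1%:R *: \sum_c U a' b' a c *: h z a c.
  under eq_bigr do rewrite ffunE scaler_sumr.
  rewrite exchange_big /= (eq_bigr (fun=> \sum_c U a' b' a c *: h z a c)).
    by rewrite sumr_const card_ord scaler_nat.
  move=> j _; rewrite [RHS](sum_rix (lift_perm ord0 j 1%g)).
  apply: eq_bigr => c _; rewrite uncons_perm odd_lift_perm odd_perm1 addbF /=.
  have -> : rix c (lift_perm ord0 j 1%g) =
      [tuple of tnth c j :: [tuple tnth c (lift j i) | i < q]].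
    apply: eq_from_tnth => i; rewrite tnth_rix.
    have [k ->|->] := unliftP ord0 i; last by rewrite lift_perm_id tnth0.
    by rewrite lift_perm_lift perm1 tnthS tnth_mktuple.
  rewrite hcons -[(-1) ^+ j]signr_odd.
  by case: (odd j); rewrite ?expr1 ?expr0 ?mulN1r ?mul1r ?scalerN ?scaleNr.
(* Skewness of U absorbs the alternation: its q! terms contribute equally. *)
have alt a' b' a : \sum_c U a' b' a c *: h (alternation t) a c =
    \sum_c U a' b' a c *: h t a c.
  have hE c : h (alternation t) a c = (q`!%:R^-1 : K) *:
      \sum_(s : 'S_q) ((-1) ^+ s : K) *: h t a (rix c (lift_perm ord0 ord0 s)).
    case/tupleP: c => i b; rewrite hcons /alternation ffunE mderivZ sum_ffunE.
    congr (_ *: _); rewrite (raddf_sum (mderiv i)).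
    apply: eq_bigr => s _; rewrite ffunE /= mderivZ ffunE /=.
    have -> : rix [tuple of i :: b] (lift_perm ord0 ord0 s) = [tuple of i :: rix b s].
      apply: eq_from_tnth => j; rewrite tnth_rix.
      have [k ->|->] := unliftP ord0 j; last by rewrite lift_perm_id !tnth0.
      by rewrite lift_perm_lift !tnthS tnth_rix.
    rewrite hcons; congr (_ *: (t (_, _))^`M(_)); apply: eq_from_tnth => j.
    by rewrite tnth_mktuple perm1.
  under eq_bigr do rewrite hE scaler_sumr scaler_sumr.
  rewrite exchange_big /= (eq_bigr (fun=> (q`!%:R^-1 : K) *: \sum_c U a' b' a c *: h t a c)).
    rewrite sumr_const card_Sn -[_ *+ _]scaler_nat scalerA mulfV ?scale1r //.
    by rewrite -[q`!]prednK ?fact_gt0.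
  move=> s _; rewrite [in RHS](sum_rix (lift_perm ord0 ord0 s)) scaler_sumr.
  apply: eq_bigr => c _; rewrite uncons_perm odd_lift_perm /= !scalerA.
  by congr (_ *: _); rewrite [LHS]mulrC mulrA [LHS]mulrC.
apply/ffunP => x; rewrite [RHS]ffunE !ffunE scaler_sumr; apply: eq_bigr => a _.
rewrite cycle alt -[_%:R]/(_%:R : K) scalerA mulVf // scale1r sum_tcons.
by apply: eq_bigr => i _; apply: eq_bigr => b _; rewrite hcons /U uncons_symbol_cons.
Qed.

Lemma covariant_obtained : equivariant1 D -> is_obtained (dapp D).
Proof.
move=> /equivariant_uncons eqU.
have obd : is_obtained (@ext_diff K n q \o @alternation K n q).
  by exists (@ext_diff K n q \o @alternation K n q) => //; apply: obtained_d.
have := is_obtained_lin (q.+1%:R^-1) (equivariant_obtained char0 eqU obd)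
  (is_obtained0 _ _ _ _ _ _).
by apply: eq_is_obtained => t; rewrite addr0 dapp_ext_diff.
Qed.

End Covariant.
End FirstOrder.

Lemma sum_upd (T : finType) (R : nmodType) p (t : 'I_p) (i : T) (F : p.-tuple T -> R) :
  \sum_b F b = \sum_(b | tnth b t == i) \sum_k F (upd b t k).
Proof.
rewrite pair_big_dep /=.
rewrite (reindex_onto (fun x : p.-tuple T * T => upd x.1 t x.2)
  (fun b => (upd b t i, tnth b t))) /= => [|b _]; last by rewrite upd_upd upd_id.
apply: eq_bigl => -[b k]; rewrite /= andbT tnth_upd eqxx upd_upd xpair_eqE eqxx andbT.
apply/eqP/eqP => [<-|E]; last exact: upd_id.
by rewrite tnth_upd eqxx.
Qed.

(** * Symbols with upper indices: traces and positivity *)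

Section Positivity.
Variables (K : fieldType) (n : nat) (conj : {rmorphism K -> K}).
Hypothesis char0 : forall m, m.+1%:R != 0 :> K.
Hypothesis conj_pos : forall (I : finType) (f : I -> K),
  \sum_i f i * conj (f i) = 0 -> forall i, f i = 0.
Local Notation idx d := (d.-tuple 'I_n).
Local Notation tfield := (tensor n {mpoly K[n]}).
Local Notation symbol p' q' p q := (idx p' -> idx q' -> idx p -> 'I_n -> idx q -> K).

Lemma jet_invariant_diag p q p' q' (D : symbol p' q' p q) a' b' i :
  jet_invariant D -> forall k a b,
  \sum_s (tnth a s == i)%:R * D a' b' (upd a s k) i b =
  \sum_t (tnth b t == k)%:R * D a' b' a i (upd b t i).
Proof.
move=> HD k a b; have := HD a' b' a b i i k.
under [RHS]eq_bigr do rewrite mulrDr.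
have dbl x : x + x = 2%:R * x :> K by rewrite mulr_natl.
by rewrite big_split /= !dbl => /(mulfI (char0 1)).
Qed.

(** With i fixed, X_k replaces an entry i of a by k and Y_k an entry k of b by i; the relation says
    X_k = Y_k. In the sum over k <> i of X_k conj(Y_k), the vanishing trace at slots (s, t) replaces
    the terms k <> i by minus the term k = i. So a sum of squares equals minus another one, and both
    are zero; f lists all the entries squared. *)
Lemma traceless_symbol0 p q p' q' (D : symbol p' q' p.+1 q) :
  jet_invariant D ->
  (forall a' b' a i b s t, \sum_k D a' b' (upd a s k) i (upd b t k) = 0) ->
  forall a' b' a i b, D a' b' a i b = 0.
Proof.
move=> HD tr0 a' b' a0 i b0; pose d a b := D a' b' a i b.
pose X k a b := \sum_s (tnth a s == i)%:R * d (upd a s k) b.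
pose Y k a b := \sum_t (tnth b t == k)%:R * d a (upd b t i).
have XY k a b : X k a b = Y k a b by apply: jet_invariant_diag.
pose f (x : 'I_n * idx p.+1 * idx q + 'I_p.+1 * 'I_q * idx p.+1 * idx q) : K :=
  match x with
  | inl (k, a, b) => (k != i)%:R * X k a b
  | inr (s, t, a, b) => ((tnth a s == i) && (tnth b t == i))%:R * d a b
  end.
have /conj_pos f0 : \sum_x f x * conj (f x) = 0.
  have -> : \sum_x f x * conj (f x) =
      \sum_k \sum_a \sum_b (k != i)%:R * (X k a b * conj (X k a b)) +
      \sum_s \sum_t \sum_a \sum_b
        ((tnth a s == i) && (tnth b t == i))%:R * (d a b * conj (d a b)).
    rewrite big_sumType !pair_bigA /=; congr (_ + _); apply: eq_bigr.
      move=> [[k a] b] _ /=; case: (k != i); first by rewrite !mul1r.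
      by rewrite !mul0r.
    move=> [[[s t] a] b] _ /=; case: (_ && _); first by rewrite !mul1r.
    by rewrite !mul0r.
  have XX k a b : X k a b * conj (X k a b) = \sum_s \sum_t
      (tnth a s == i)%:R * (tnth b t == k)%:R * (d (upd a s k) b * conj (d a (upd b t i))).
    rewrite {2}XY /X /Y rmorph_sum mulr_suml; apply: eq_bigr => s _.
    rewrite mulr_sumr; apply: eq_bigr => t _.
    by rewrite rmorphM rmorph_nat mulrACA.
  under eq_bigr do under eq_bigr do under eq_bigr do rewrite XX mulr_sumr.
  have swap3 (I J L M : finType) (G : I -> J -> L -> M -> K) :
      \sum_k \sum_a \sum_b \sum_s G k a b s = \sum_s \sum_a \sum_k \sum_b G k a b s.
    rewrite [RHS]exchange_big [LHS]exchange_big /=; apply: eq_bigr => a _.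
    rewrite [RHS]exchange_big /=; apply: eq_bigr => k _.
    by rewrite exchange_big.
  rewrite swap3 -big_split big1 //= => s _.
  under eq_bigr do under eq_bigr do under eq_bigr do rewrite mulr_sumr.
  have swap3' (I J L M : finType) (G : I -> J -> L -> M -> K) :
      \sum_a \sum_k \sum_b \sum_t G a k b t = \sum_t \sum_a \sum_k \sum_b G a k b t.
    rewrite [RHS]exchange_big; apply: eq_bigr => a _.
    rewrite [RHS]exchange_big; apply: eq_bigr => k _.
    by rewrite exchange_big.
  rewrite swap3' -big_split big1 //= => t _.
  rewrite -big_split big1 //= => a _.
  have [Ea|] := eqVneq (tnth a s) i; last first.
    by move=> _; rewrite !big1 ?addr0 // => *; rewrite ?big1 // => *; rewrite !mul0r ?mulr0.
  rewrite [X in _ + X](bigID (fun b => tnth b t == i)) /= [X in _ + (_ + X)]big1; last first.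
    by move=> b /negbTE->; rewrite mul0r.
  rewrite addr0; apply/eqP; rewrite addr_eq0 -sumrN; apply/eqP.
  under eq_bigr do rewrite (sum_upd t i).
  rewrite exchange_big /=; apply: eq_bigr => b /eqP Eb.
  rewrite Eb eqxx mul1r -mulNr.
  have -> : - d a b = \sum_(k | k != i) d (upd a s k) (upd b t k).
    have := tr0 a' b' a i b s t; rewrite (bigD1 i) //= !upd_id // => /eqP.
    by rewrite addrC addr_eq0 => /eqP ->.
  rewrite mulr_suml [RHS]big_mkcond /=.
  apply: eq_bigr => k _; rewrite (bigD1 k) //= big1 => [|l lk].
    rewrite tnth_upd !eqxx addr0 !mul1r upd_upd (upd_id Eb).
    by case: (k != i); rewrite ?mul1r ?mul0r.
  by rewrite tnth_upd eqxx (negbTE lk) mulr0 mul0r mulr0.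
have X0 k a b : k != i -> X k a b = 0.
  by move=> ki; have := f0 (inl (k, a, b)); rewrite /= ki mul1r.
have d0 a b s t : tnth a s = i -> tnth b t = i -> d a b = 0.
  by move=> Ea Eb; have := f0 (inr (s, t, a, b)); rewrite /= Ea Eb eqxx mul1r.
(* If i occurs in a0 but not in b0, then Y_i is zero and X_i is a positive multiple of d. If i is
   not in a0, it is put into slot 0 and X_k = 0 is read there with k the old entry; this is where an
   upper slot is required. *)
have [/existsP[s /eqP Es]|no_a] := boolP [exists s, tnth a0 s == i].
  have [/existsP[t /eqP Et]|no_b] := boolP [exists t, tnth b0 t == i].
    exact: d0 Es Et.
  have := XY i a0 b0; rewrite /Y big1 => [|t _]; last first.
    by move: no_b; rewrite negb_exists => /forallP/(_ t)/negbTE->; rewrite mul0r.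
  rewrite /X (eq_bigr (fun s => (tnth a0 s == i)%:R * d a0 b0)) => [|s' _]; last first.
    by have [E|] := eqVneq (tnth a0 s') i; rewrite ?mul0r // upd_id.
  rewrite -mulr_suml -natr_sum (bigD1 s) //= Es eqxx add1n => /eqP.
  by rewrite mulf_eq0 (negbTE (char0 _)) => /eqP.
have neqi s : tnth a0 s != i.
  by move: no_a; rewrite negb_exists => /forallP/(_ s).
have := X0 (tnth a0 ord0) (upd a0 ord0 i) b0 (neqi _).
rewrite /X (bigD1 ord0) //= tnth_upd !eqxx mul1r upd_upd upd_id // big1 ?addr0 //.
move=> s ne; rewrite tnth_upd (negbTE ne) (negbTE (neqi s)) mul0r; done.
Qed.

Section Closure.
Variables (p' q' : nat).

Definition symbol_perm p q (s : 'S_p) (t : 'S_q) (D : symbol p' q' p q) : symbol p' q' p q :=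
  fun a' b' a i b => D a' b' (rix a s) i (rix b t).

(** Symbol of D precomposed with [tensor_id]; dually, [symbol_contr] is the symbol of D precomposed
    with [contraction]. *)
Definition symbol_trace p q (D : symbol p' q' p.+1 q.+1) : symbol p' q' p q :=
  fun a' b' a i b => \sum_k D a' b' [tuple of k :: a] i [tuple of k :: b].

Definition symbol_contr p q (D : symbol p' q' p q) : symbol p' q' p.+1 q.+1 :=
  fun a' b' a i b => (thead a == thead b)%:R *
    D a' b' [tuple of behead a] i [tuple of behead b].

Lemma symbol_contr_cons p q (D : symbol p' q' p q) a' b' k (a : idx p) i l (b : idx q) :
  symbol_contr D a' b' [tuple of k :: a] i [tuple of l :: b] =
  (k == l)%:R * D a' b' a i b.
Proof.
by rewrite /symbol_contr !theadE; congr (_ * D _ _ _ _ _); apply: val_inj.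
Qed.

Lemma natural_symbol_perm p q (s : 'S_p) (t : 'S_q) (D : symbol p' q' p q) :
  natural_symbol D -> natural_symbol (symbol_perm s t D).
Proof.
case=> eqD jD; split=> [g Ug a' b' c i d|a' b' a b i j k]; rewrite /symbol_perm.
  have := eqD g Ug a' b' (rix c s) i (rix d t).
  under eq_bigr do rewrite (sum_rix s).
  under [in RHS]eq_bigr do under eq_bigr do rewrite (sum_rix t).
  under eq_bigr do under eq_bigr do rewrite gpow_rix.
  by under [in RHS]eq_bigr do under eq_bigr do under eq_bigr do rewrite gpow_rix.
have updE T r (u : 'S_r) (x : r.-tuple T) v l : rix (upd x (u v) l) u = upd (rix x u) v l.
  apply: eq_from_tnth => w; rewrite tnth_rix !tnth_upd tnth_rix.
  by rewrite (inj_eq perm_inj).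
rewrite [RHS](reindex_inj (@perm_inj _ t)) /=.
under [RHS]eq_bigr do rewrite !updE -tnth_rix.
rewrite -jD; congr (_ + _); rewrite (reindex_inj (@perm_inj _ s)) /=;
  by apply: eq_bigr => r _; rewrite updE tnth_rix.
Qed.

Lemma upd_cons0 T p (k l : T) (a : p.-tuple T) :
  upd [tuple of k :: a] ord0 l = [tuple of l :: a].
Proof.
apply: eq_from_tnth => i; rewrite tnth_upd.
by have [j ->|->] := unliftP ord0 i; rewrite ?eqxx // !tnthS.
Qed.

Lemma upd_consS T p (k l : T) (a : p.-tuple T) t :
  upd [tuple of k :: a] (lift ord0 t) l = [tuple of k :: upd a t l].
Proof.
apply: eq_from_tnth => i; rewrite tnth_upd.
have [j ->|->] := unliftP ord0 i; last by rewrite !tnth0.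
by rewrite !tnthS tnth_upd (inj_eq lift_inj).
Qed.

Lemma swap_sum22 (I J L M : finType) (G : I -> J -> L -> M -> K) :
  \sum_k \sum_a \sum_b \sum_s G k a b s = \sum_b \sum_s \sum_k \sum_a G k a b s.
Proof.
under eq_bigr do rewrite exchange_big; rewrite exchange_big /=; apply: eq_bigr => b _.
by under eq_bigr do rewrite exchange_big; rewrite exchange_big.
Qed.

(** Writes a trace as a pairing of g^-1 with an array on which g acts in one slot; this is what
    connects traces with the inverse-free form of equivariance. [sum_invr] does it for the other
    slot. *)
Lemma sum_invl (g : 'M[K]_n) (G : 'I_n -> 'I_n -> K) : g \in unitmx ->
  \sum_l \sum_m invmx g l m * (\sum_r g r l * G r m) = \sum_k G k k.
Proof.
move=> Ug; rewrite exchange_big /=; apply: eq_bigr => m _.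
under eq_bigr do rewrite mulr_sumr; rewrite exchange_big /=.
rewrite -[RHS](sum_eqr (fun r => G r m)); apply: eq_bigr => r _.
have := congr1 (fun M : 'M_n => M r m) (mulmxV Ug); rewrite !mxE => <-.
by rewrite mulr_sumr; apply: eq_bigr => l _; rewrite mulrA mulrC [invmx _ _ _ * _]mulrC.
Qed.

Lemma sum_invr (g : 'M[K]_n) (G : 'I_n -> 'I_n -> K) : g \in unitmx ->
  \sum_l \sum_m invmx g l m * (\sum_r g m r * G l r) = \sum_k G k k.
Proof.
move=> Ug; apply: eq_bigr => l _.
under eq_bigr do rewrite mulr_sumr; rewrite exchange_big /=.
rewrite -[RHS](sum_eqr (fun r => G l r)); apply: eq_bigr => r _.
have := congr1 (fun M : 'M_n => M l r) (mulVmx Ug); rewrite !mxE eq_sym => <-.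
by rewrite mulr_sumr; apply: eq_bigr => m _; rewrite mulrA mulrC.
Qed.

Lemma natural_symbol_trace p q (D : symbol p' q' p.+1 q.+1) :
  natural_symbol D -> natural_symbol (symbol_trace D).
Proof.
case=> eqD jD; split=> [g Ug a' b' c i d|a' b' a b i j k]; rewrite /symbol_trace.
  (* Equivariance of D itself applies to the enlarged index words l :: c and m :: d inside the
     pairing with g^-1. *)
  transitivity (\sum_l \sum_m invmx g l m * (\sum_d' \sum_a gpow g d' b' *
      gpow g a [tuple of l :: c] * D a' d' a i [tuple of m :: d])).
    under [RHS]eq_bigr do under eq_bigr do rewrite mulr_sumr.
    under [RHS]eq_bigr do under eq_bigr do under eq_bigr do
      rewrite sum_tcons exchange_big mulr_sumr.
    rewrite [RHS]swap_sum22; apply: eq_bigr => d' _; apply: eq_bigr => a _ /=.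
    rewrite mulr_sumr -(sum_invl (fun r m => _ * D a' d' [tuple of r :: a] i [tuple of m :: d]) Ug).
    apply: eq_bigr => l _; apply: eq_bigr => m _; congr (_ * _); apply: eq_bigr => r _.
    by rewrite gpow_cons [_ * (g r l * _)]mulrCA -!mulrA.
  under eq_bigr do under eq_bigr do rewrite eqD // mulr_sumr.
  under eq_bigr do under eq_bigr do under eq_bigr do rewrite mulr_sumr.
  rewrite swap_sum22; apply: eq_bigr => c' _; apply: eq_bigr => j _.
  under eq_bigr do under eq_bigr do rewrite sum_tcons exchange_big mulr_sumr.
  under eq_bigr do rewrite exchange_big; rewrite exchange_big; apply: eq_bigr => b _ /=.
  rewrite mulr_sumr -(sum_invr (fun l r => _ * D c' b' [tuple of l :: c] j [tuple of r :: b]) Ug).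
  apply: eq_bigr => l _; apply: eq_bigr => m _; congr (_ * _); apply: eq_bigr => r _.
  by rewrite gpow_cons 2![_ * (g m r * _)]mulrCA -!mulrA.
have E r := jD a' b' [tuple of r :: a] [tuple of r :: b] i j k.
have {}E : \sum_r _ = \sum_r _ := eq_bigr _ (fun r _ => E r).
have {E} : \sum_(r : 'I_n) (((r == j)%:R * D a' b' [tuple of k :: a] i [tuple of r :: b] +
      \sum_s (tnth a s == j)%:R * D a' b' [tuple of r :: upd a s k] i
    [tuple of r :: b]) +
    ((r == i)%:R * D a' b' [tuple of k :: a] j [tuple of r :: b] +
      \sum_s (tnth a s == i)%:R * D a' b' [tuple of r :: upd a s k] j [tuple of r :: b])) =
  \sum_(r : 'I_n) ((r == k)%:R * (D a' b' [tuple of r :: a] i [tuple of j :: b] +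
                       D a' b' [tuple of r :: a] j [tuple of i :: b]) +
    \sum_t (tnth b t == k)%:R * (D a' b' [tuple of r :: a] i [tuple of r :: upd b t j] +
      D a' b' [tuple of r :: a] j [tuple of r :: upd b t i])).
  etransitivity; last (etransitivity; first exact: E); apply: eq_bigr => r _.
    rewrite !big_ord_recl !upd_cons0; congr (_ + _ + (_ + _));
      by apply: eq_bigr => s _; rewrite upd_consS tnthS.
  rewrite !big_ord_recl !upd_cons0; congr (_ + _).
  by apply: eq_bigr => t _; rewrite !upd_consS tnthS.
(* The terms in which the derivation hits the inserted identity are the same on both sides and
   cancel. *)
rewrite !big_split /= !sum_eql addrACA => /addrI E.
transitivity (\sum_r \sum_s (tnth a s == j)%:R * D a' b' [tuple of r :: upd a s k] i [tuple of r :: b]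
  + \sum_r \sum_s (tnth a s == i)%:R * D a' b' [tuple of r :: upd a s k] j [tuple of r :: b]).
  congr (_ + _); rewrite exchange_big; apply: eq_bigr => s _; by rewrite mulr_sumr.
rewrite E exchange_big; apply: eq_bigr => t _.
by rewrite -mulr_sumr big_split.
Qed.

Lemma natural_symbol_contr p q (D : symbol p' q' p q) :
  natural_symbol D -> natural_symbol (symbol_contr D).
Proof.
case=> eqD jD; split.
  move=> g Ug a' b' /tupleP[l c] i /tupleP[m d].
  have -> : \sum_d' \sum_a gpow g d' b' * gpow g a [tuple of l :: c] *
      symbol_contr D a' d' a i [tuple of m :: d] =
    g m l * \sum_d' \sum_a gpow g d' b' * gpow g a c * D a' d' a i d.
    rewrite mulr_sumr; apply: eq_bigr => d' _; rewrite sum_tcons exchange_big mulr_sumr.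
    apply: eq_bigr => a _ /=.
    under eq_bigr do rewrite gpow_cons symbol_contr_cons mulrCA.
    by rewrite sum_eql mulrCA !mulrA.
  rewrite eqD // mulr_sumr; apply: eq_bigr => c' _; rewrite mulr_sumr; apply: eq_bigr => j _.
  rewrite sum_tcons exchange_big mulr_sumr; apply: eq_bigr => b _ /=.
  under eq_bigr do rewrite gpow_cons symbol_contr_cons mulrCA eq_sym.
  by rewrite sum_eql 2![_ * (g m l * _)]mulrCA -!mulrA.
move=> a' b' /tupleP[x a] /tupleP[y b] i j k.
rewrite !big_ord_recl !upd_cons0 !symbol_contr_cons !tnth0.
have sumE z l : \sum_s (tnth [tuple of x :: a] (lift ord0 s) == l)%:R *
      symbol_contr D a' b' (upd [tuple of x :: a] (lift ord0 s) k) z [tuple of y :: b] =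
    (x == y)%:R * \sum_s (tnth a s == l)%:R * D a' b' (upd a s k) z b.
  rewrite mulr_sumr; apply: eq_bigr => s _.
  by rewrite upd_consS symbol_contr_cons tnthS mulrCA.
rewrite !sumE addrACA -mulrDr jD; congr (_ + _).
  by rewrite mulrDr [k == y]eq_sym; congr (_ + _); rewrite mulrCA.
rewrite mulr_sumr; apply: eq_bigr => t _.
by rewrite !upd_consS !symbol_contr_cons tnthS -mulrDr mulrCA.
Qed.

Lemma natural_symbol_sum p q (I : finType) (c : I -> K) (D : I -> symbol p' q' p q) :
  (forall r, natural_symbol (D r)) ->
  natural_symbol (fun a' b' a i b => \sum_r c r * D r a' b' a i b).
Proof.
move=> HD; split=> [g Ug a' b' e i d|a' b' a b i j k].
  under eq_bigr do under eq_bigr do rewrite mulr_sumr.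
  transitivity (\sum_r c r * \sum_d' \sum_a gpow g d' b' * gpow g a e * D r a' d' a i d).
    under eq_bigr do rewrite exchange_big; rewrite exchange_big; apply: eq_bigr => r _.
    rewrite mulr_sumr; apply: eq_bigr => d' _; rewrite mulr_sumr; apply: eq_bigr => a _.
    by rewrite mulrCA.
  under eq_bigr => r _ do rewrite (HD r).1 //.
  under eq_bigr do rewrite mulr_sumr; rewrite exchange_big; apply: eq_bigr => c' _.
  under eq_bigr do rewrite mulr_sumr; rewrite exchange_big; apply: eq_bigr => j _.
  under eq_bigr do rewrite mulr_sumr; rewrite exchange_big; apply: eq_bigr => b _.
  by rewrite mulr_sumr; apply: eq_bigr => r _; rewrite mulrCA.
have L l z : \sum_s (tnth a s == l)%:R * \sum_r c r * D r a' b' (upd a s k) z b =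
    \sum_r c r * \sum_s (tnth a s == l)%:R * D r a' b' (upd a s k) z b.
  under eq_bigr do rewrite mulr_sumr; rewrite exchange_big; apply: eq_bigr => r _.
  by rewrite mulr_sumr; apply: eq_bigr => s _; rewrite mulrCA.
rewrite !L -big_split /=; under eq_bigr => r _ do rewrite -mulrDr (HD r).2 mulr_sumr.
rewrite exchange_big; apply: eq_bigr => t _; rewrite -big_split mulr_sumr.
by apply: eq_bigr => r _; rewrite mulrCA mulrDr.
Qed.

Definition trace_op p q (D : symbol p' q' p.+1 q.+1) (s : 'I_p.+1) (t : 'I_q.+1) :=
  symbol_trace (symbol_perm (tperm ord0 s) (tperm ord0 t) D).

(** The symbol written D S in the overview: the x-th term contracts upper slot x.1 with lower slot
    x.2 and puts the identity back there. The scalar 1 gives the sum the shape expected by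
    [natural_symbol_sum] and [dapp_sum]. *)
Definition insertion_trace p q (D : symbol p' q' p.+1 q.+1) : symbol p' q' p.+1 q.+1 :=
  fun a' b' a i b => \sum_(x : 'I_p.+1 * 'I_q.+1) 1 * symbol_perm (tperm ord0 x.1) (tperm ord0 x.2)
    (symbol_contr (trace_op D x.1 x.2)) a' b' a i b.

Lemma natural_insertion_trace p q (D : symbol p' q' p.+1 q.+1) :
  natural_symbol D -> natural_symbol (insertion_trace D).
Proof.
move=> HD; apply: natural_symbol_sum => x.
do 2!(apply/natural_symbol_perm || apply/natural_symbol_contr).
by apply/natural_symbol_trace/natural_symbol_perm.
Qed.

Lemma rix_tpermK T p (x y : 'I_p) (a : p.-tuple T) : rix (rix a (tperm x y)) (tperm x y) = a.
Proof. by rewrite -rixM tperm2 -[RHS]rix_id; apply: eq_rix => i; rewrite perm1. Qed.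

Lemma rix_cons_upd T r (u : 'I_r.+1) (x : r.+1.-tuple T) k :
  rix [tuple of k :: behead (rix x (tperm ord0 u))] (tperm ord0 u) = upd x u k.
Proof.
have -> : [tuple of k :: behead (rix x (tperm ord0 u))] = upd (rix x (tperm ord0 u)) ord0 k.
  by case/tupleP: (rix x _) => h y; rewrite upd_cons0; apply: val_inj.
apply: eq_from_tnth => v; rewrite tnth_rix !tnth_upd tnth_rix tpermK.
by rewrite (canF_eq (tpermK ord0 u)) tpermL.
Qed.

Lemma insertion_traceE p q (D : symbol p' q' p.+1 q.+1) a' b' a i b :
  insertion_trace D a' b' a i b = \sum_(x : 'I_p.+1 * 'I_q.+1)
    (tnth a x.1 == tnth b x.2)%:R * \sum_k D a' b' (upd a x.1 k) i (upd b x.2 k).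
Proof.
apply: eq_bigr => -[s t] _; rewrite mul1r /symbol_perm /symbol_contr /trace_op.
rewrite /symbol_trace /symbol_perm /thead !tnth_rix !tpermL; congr (_ * _).
by apply: eq_bigr => k _; rewrite !rix_cons_upd.
Qed.

(** Inserting the identity is adjoint to contracting, so the pairing of the new symbol with conj(D)
    is the sum of the squares of all traces of D; these therefore vanish, and [traceless_symbol0]
    applies. *)
Lemma insertion_trace_inj p q (D : symbol p' q' p.+1 q.+1) :
  natural_symbol D -> (forall a' b' a i b, insertion_trace D a' b' a i b = 0) ->
  forall a' b' a i b, D a' b' a i b = 0.
Proof.
move=> [_ jD] S0; apply: (traceless_symbol0 jD) => a' b' a i b s t.
pose f (x : 'I_p.+1 * 'I_q.+1 * idx p * idx q) : K :=
  trace_op D x.1.1.1 x.1.1.2 a' b' x.1.2 i x.2.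
have /conj_pos f0 : \sum_x f x * conj (f x) = 0.
  transitivity (\sum_a \sum_b insertion_trace D a' b' a i b * conj (D a' b' a i b)); last first.
    by apply: big1 => a0 _; apply: big1 => b0 _; rewrite S0 mul0r.
  rewrite -(pair_bigA _ (fun y c => f (y, c) * conj (f (y, c)))) /=.
  rewrite -(pair_bigA _ (fun y d => \sum_c f (y, d, c) * conj (f (y, d, c)))) /=.
  under [RHS]eq_bigr do under eq_bigr do rewrite mulr_suml.
  under [RHS]eq_bigr do rewrite exchange_big; rewrite [RHS]exchange_big /=.
  apply: eq_bigr => -[u v] _; rewrite [RHS](sum_rix (tperm ord0 u)) sum_tcons.
  under [RHS]eq_bigr do under eq_bigr do rewrite (sum_rix (tperm ord0 v)) sum_tcons.
  rewrite [RHS]exchange_big; apply: eq_bigr => a0 _ /=.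
  under [RHS]eq_bigr do rewrite exchange_big.
  rewrite [RHS]exchange_big; apply: eq_bigr => b0 _ /=.
  rewrite {2}/f /trace_op /symbol_trace /= rmorph_sum mulr_sumr; apply: eq_bigr => k _.
  under [RHS]eq_bigr do
    rewrite mul1r /symbol_perm !rix_tpermK symbol_contr_cons eq_sym -mulrA.
  by rewrite sum_eql.
have := f0 (s, t, [tuple of behead (rix a (tperm ord0 s))],
                  [tuple of behead (rix b (tperm ord0 t))]).
rewrite /f /trace_op /symbol_trace /symbol_perm /=.
by move=> E; rewrite -[RHS]E; apply: eq_bigr => k _; rewrite !rix_cons_upd.
Qed.

End Closure.

(* Powers of a kernel are linearly dependent, with a nonzero lowest coefficient
   once a power of the kernel is split off. *)
Lemma kernel_dependence (I : finType) (m : I -> I -> K) :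
  exists e N (c : 'I_N.+1 -> K), c ord0 != 0 /\ forall f : I -> K, forall y,
    \sum_j c j * iter (e + j) (fun h z => \sum_x h x * m x z) f y = 0.
Proof.
(* Cayley-Hamilton is applied to matrices of positive size, so the empty index set is set apart. *)
have [I0|] := posnP #|I|.
  exists 0%N, 0%N, (fun=> 1); split; first exact: oner_neq0.
  by move=> f y; have := fintype0 y I0.
case EI : #|I| => [//|M] _.
pose ix (i : 'I_M.+1) : I := enum_val (cast_ord (esym EI) i).
pose rk x : 'I_M.+1 := cast_ord EI (enum_rank x).
have rkK : cancel rk ix by move=> x; rewrite /rk /ix cast_ordK enum_rankK.
have ixK : cancel ix rk by move=> x; rewrite /rk /ix enum_valK cast_ordKV.
pose A : 'M[K]_M.+1 := \matrix_(i, j) m (ix i) (ix j).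
pose S (h : I -> K) z := \sum_x h x * m x z.
pose row h : 'rV[K]_M.+1 := \row_i h (ix i).
have rowS h : row (S h) = row h *m A.
  apply/rowP => j; rewrite !mxE /S (reindex ix) /=; last by exists rk => ? _.
  by apply: eq_bigr => i _; rewrite !mxE.
have rowi k h : row (iter k S h) = row h *m A ^+ k.
  elim: k => [|k IH]; first by rewrite mulmx1.
  by rewrite exprSr mulmxA -IH -rowS.
have [e [q q0 Eq]] := multiplicity_XsubC (char_poly A) 0.
rewrite subr0 in Eq; move: q0; rewrite monic_neq0 ?char_poly_monic //= => q0.
exists e, (size q), (fun j => q`_j); split.
  by move: q0; rewrite /root horner_coef0.
move=> f y; have := Cayley_Hamilton A.
have -> : horner_mx A (char_poly A) = \sum_(j < (size q).+1) q`_j *: (A ^+ (e + j)).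
  have qE : q = \sum_(j < (size q).+1) q`_j *: 'X^j.
    rewrite -poly_def; apply/polyP => j; rewrite coef_poly.
    by case: ltnP => // /ltnW; exact: nth_default.
  rewrite Eq mulrC rmorphM rmorphXn /= horner_mx_X {1}qE raddf_sum mulr_sumr.
  by apply: eq_bigr => j _; rewrite /= horner_mxZ rmorphXn /= horner_mx_X -scalerAr exprD.
move=> A0; have Si k : iter k S f y = (row f *m A ^+ k) 0 (rk y).
  by rewrite -rowi mxE rkK.
under eq_bigr do rewrite Si.
have := congr1 (fun B : 'M_M.+1 => (row f *m B) 0 (rk y)) A0.
rewrite mulmx0 mulmx_sumr summxE !mxE => E; rewrite -[RHS]E.
by apply: eq_bigr => j _; rewrite -scalemxAr [RHS]mxE.
Qed.

Lemma dapp_sum p q p' q' (I : finType) (c : I -> K) (D : I -> symbol p' q' p q) t :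
  dapp (fun a' b' a i b => \sum_r c r * D r a' b' a i b) t = \sum_r c r *: dapp (D r) t.
Proof.
apply/ffunP => x; rewrite sum_ffunE ffunE.
under [RHS]eq_bigr do rewrite !ffunE scaler_sumr.
rewrite [RHS]exchange_big; apply: eq_bigr => a _ /=.
under [RHS]eq_bigr do rewrite scaler_sumr.
rewrite [RHS]exchange_big; apply: eq_bigr => i _ /=.
under [RHS]eq_bigr do rewrite scaler_sumr.
rewrite [RHS]exchange_big; apply: eq_bigr => b _ /=.
by rewrite scaler_suml; apply: eq_bigr => r _; rewrite scalerA.
Qed.

(** Each term contracts its argument first, so that only symbols on T^(p,q) remain, as the induction
    on p requires. *)
Lemma dapp_insertion_trace p q p' q' (D : symbol p' q' p.+1 q.+1) t :
  dapp (insertion_trace D) t = \sum_(x : 'I_p.+1 * 'I_q.+1)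
    1 *: dapp (trace_op D x.1 x.2)
      (contraction (permutation (tperm ord0 x.1) (tperm ord0 x.2) t)).
Proof.
rewrite dapp_sum; apply: eq_bigr => -[s u] _ /=; congr (_ *: _).
apply/ffunP => y; rewrite !ffunE (sum_rix (tperm ord0 s)) sum_tcons exchange_big /=.
apply: eq_bigr => a _; rewrite exchange_big /=; apply: eq_bigr => i _.
under eq_bigr do rewrite (sum_rix (tperm ord0 u)) sum_tcons exchange_big /=.
rewrite exchange_big /=; apply: eq_bigr => b _.
rewrite ffunE (raddf_sum (mderiv i)) scaler_sumr; apply: eq_bigr => k _.
rewrite (bigD1 k) //= big1 ?addr0 => [|l lk].
  rewrite /symbol_perm !rix_tpermK symbol_contr_cons eqxx mul1r ffunE /=.
  by congr (_ *: (t (_, _))^`M(_)).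
by rewrite /symbol_perm !rix_tpermK symbol_contr_cons eq_sym (negbTE lk) mul0r scale0r.
Qed.

Lemma natural_symbol_obtained p q p' q' (D : symbol p' q' p q) :
  natural_symbol D -> is_obtained (dapp D).
Proof.
elim: p q D => [|p IH] q D HD; first by apply: covariant_obtained; case: HD.
(* Without lower indices there are no traces, so D is zero. *)
case: q D HD => [|q] D HD.
  apply: eq_is_obtained (is_obtained0 _ _ _ _ _ _) => t; apply/ffunP => x; rewrite !ffunE.
  rewrite big1 // => a _; rewrite big1 // => i _; rewrite big1 // => b _.
  by rewrite (traceless_symbol0 HD.2) ?scale0r // => ? ? ? ? ? ? [].
pose S k : symbol p' q' p.+1 q.+1 := iter k (@insertion_trace p' q' p q) D.
have natS k : natural_symbol (S k).
  by elim: k => [|k IHk] //; apply: natural_insertion_trace.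
have obS k : is_obtained (dapp (S k.+1)).
  have opc : is_op (@contraction K n p q).
    by exists (@contraction K n p q) => //; apply: tensor_op_contraction.
  have := is_obtained_sum (fun=> 1) (fun x : 'I_p.+1 * 'I_q.+1 =>
    is_obtained_precomp (IH _ _ (natural_symbol_trace (natural_symbol_perm
      (tperm ord0 x.1) (tperm ord0 x.2) (natS k))))
    (is_op_comp opc (is_op_permutation K n (tperm ord0 x.1) (tperm ord0 x.2)))).
  by apply: eq_is_obtained => t; rewrite dapp_insertion_trace.
(* Kernel of S on arrays in (a, b); the indices a', b' and i are parameters, so one relation between
   its powers serves all of them. *)
pose m (x y : idx p.+1 * idx q.+1) : K := \sum_(z : 'I_p.+1 * 'I_q.+1)
  \sum_k (tnth y.1 z.1 == tnth y.2 z.2)%:R * (x == (upd y.1 z.1 k, upd y.2 z.2 k))%:R.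
have [e [N [c [c0 Hc]]]] := kernel_dependence m.
pose it k f := iter k (fun h z => \sum_x h x * m x z) f.
have SE k a' b' a i b : S k a' b' a i b = it k (fun x => D a' b' x.1 i x.2) (a, b).
  elim: k a b => [|k IHk] a b //; rewrite /= insertion_traceE.
  under [RHS]eq_bigr do rewrite /m mulr_sumr.
  rewrite exchange_big /=; apply: eq_bigr => z _.
  rewrite mulr_sumr; under [RHS]eq_bigr do rewrite mulr_sumr.
  rewrite exchange_big /=; apply: eq_bigr => k' _.
  under [RHS]eq_bigr do rewrite mulrCA.
  by rewrite -mulr_sumr sum_eqr; congr (_ * _); apply: IHk.
pose D1 : symbol p' q' p.+1 q.+1 := fun a' b' a i b => \sum_j c j * S j a' b' a i b.
have natD1 : natural_symbol D1 by apply: natural_symbol_sum.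
have itD1 k a' b' a i b : iter k (@insertion_trace p' q' p q) D1 a' b' a i b =
    \sum_j c j * S (k + j)%N a' b' a i b.
  elim: k a b => [|k IHk] a b //; rewrite /= insertion_traceE.
  under [RHS]eq_bigr do rewrite insertion_traceE mulr_sumr.
  rewrite exchange_big; apply: eq_bigr => x _ /=.
  under eq_bigr do rewrite IHk; rewrite exchange_big mulr_sumr.
  by apply: eq_bigr => j _; rewrite -mulr_sumr mulrCA.
(* The choice of c gives S^e D1 = 0; the e factors S are removed one by one, since every power of S
   applied to D1 is again natural. *)
have D1_0 a' b' a i b : D1 a' b' a i b = 0.
  have : forall k, (k <= e)%N -> forall a' b' a i b,
      iter (e - k) (@insertion_trace p' q' p q) D1 a' b' a i b = 0.
    elim=> [_ {}a' {}b' {}a {}i {}b|k IHk lt_ke].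
      by rewrite subn0 itD1; under eq_bigr do rewrite SE; apply: Hc.
    apply: insertion_trace_inj => [|{}a' {}b' {}a {}i {}b].
      by elim: (e - k.+1)%N => [|r IHr] //; apply: natural_insertion_trace.
    by have := IHk (ltnW lt_ke) a' b' a i b; rewrite -(subnSK lt_ke).
  by move/(_ e (leqnn e)); rewrite subnn.
have DE a' b' a i b :
    D a' b' a i b = \sum_(j < N) (- (c ord0)^-1 * c (lift ord0 j)) * S j.+1 a' b' a i b.
  have := D1_0 a' b' a i b; rewrite /D1 big_ord_recl /= => /eqP.
  rewrite addr_eq0 => /eqP E; apply: (mulfI c0); rewrite E mulr_sumr -sumrN.
  by apply: eq_bigr => j _; rewrite !mulrA mulrN mulfV // !mulN1r mulNr.
have := is_obtained_sum (fun j => - (c ord0)^-1 * c (lift ord0 j)) (fun j : 'I_N => obS j).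
apply: eq_is_obtained => t; rewrite -dapp_sum; apply/ffunP => x; rewrite !ffunE.
by apply: eq_bigr => a _; apply: eq_bigr => i _; apply: eq_bigr => b _; rewrite DE.
Qed.

End Positivity.

(** * Tensor bundles as summands of tensors *)

Lemma kernel_inverse (K : fieldType) (I : finType) (f : I -> I -> K) :
  (forall u, (forall y, \sum_x u x * f x y = 0) -> forall x, u x = 0) ->
  exists f', (forall x z, \sum_y f x y * f' y z = (x == z)%:R) /\
             (forall x z, \sum_y f' x y * f y z = (x == z)%:R).
Proof.
move=> finj; pose A : 'M[K]_#|I| := \matrix_(i, j) f (enum_val i) (enum_val j).
have reE (F : I -> K) : \sum_x F x = \sum_(i < #|I|) F (enum_val i).
  rewrite [RHS](reindex (@enum_rank I)); last exact: onW_bij (enum_rank_bij I).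
  by apply: eq_bigr => x _; rewrite enum_rankK.
have UA : A \in unitmx.
  rewrite -row_free_unit -kermx_eq0; apply/eqP/row_matrixP => i; rewrite row0.
  set v := row i _; have vA : v *m A = 0 by rewrite /v -row_mul mulmx_ker row0.
  apply/rowP => j; rewrite [RHS]mxE -(enum_valK j).
  apply: (finj (fun x => v 0 (enum_rank x))) => y.
  have := congr1 (fun w : 'rV_ _ => w 0 (enum_rank y)) vA; rewrite !mxE => E.
  rewrite -[RHS]E reE; apply: eq_bigr => k _.
  by rewrite enum_valK [A _ _]mxE enum_rankK.
exists (fun x y => invmx A (enum_rank x) (enum_rank y)); split=> x z.
  have := congr1 (fun B : 'M_ _ => B (enum_rank x) (enum_rank z)) (mulmxV UA).
  rewrite !mxE (inj_eq enum_rank_inj) => <-; rewrite reE.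
  by apply: eq_bigr => k _; rewrite [A _ _]mxE enum_rankK enum_valK.
have := congr1 (fun B : 'M_ _ => B (enum_rank x) (enum_rank z)) (mulVmx UA).
rewrite !mxE (inj_eq enum_rank_inj) => <-; rewrite reE.
by apply: eq_bigr => k _; rewrite [A _ _]mxE enum_rankK enum_valK.
Qed.

(** * Powers of the determinant as lines of tensors *)

Section LeviCivita.
Variables (K : fieldType) (n : nat) (conj : {rmorphism K -> K}).
Hypothesis conj_pos : forall (I : finType) (f : I -> K),
  \sum_i f i * conj (f i) = 0 -> forall i, f i = 0.
Local Notation idx d := (d.-tuple 'I_n).

(** The sign of b if b is a permutation of the indices, and 0 otherwise. *)
Definition levi_civita (b : idx n) : K := \det (\matrix_(t, s) (tnth b t == s)%:R).

Lemma gpow_tr p (h : 'M[K]_n) (a b : idx p) : gpow h^T a b = gpow h b a.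
Proof. by apply: eq_bigr => i _; rewrite mxE. Qed.

Lemma levi_civita_gpow (h : 'M[K]_n) b :
  \sum_d gpow h d b * levi_civita d = \det h * levi_civita b.
Proof.
transitivity (\det (\matrix_(t, s) h s (tnth b t))).
  under eq_bigr do rewrite /levi_civita /determinant mulr_sumr.
  rewrite exchange_big; apply: eq_bigr => s _ /=.
  under eq_bigr do rewrite mulrCA; rewrite -mulr_sumr; congr (_ * _).
  under [RHS]eq_bigr do rewrite mxE -(sum_eqr (fun k => h k _)).
  rewrite prod_sum_tuple; apply: eq_bigr => d _; rewrite -big_split /=.
  by apply: eq_bigr => i _; rewrite mxE.
rewrite mulrC -[\det h]det_tr -det_mulmx; congr (\det _); apply/matrixP => t s.
rewrite !mxE; under eq_bigr do rewrite !mxE eq_sym.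
by rewrite sum_eql.
Qed.

(* det^-e is the character of GL_n on the line spanned by eps. *)
Lemma det_power_tensor e : exists q (eps eps' : idx q -> K),
  [/\ forall h b, \sum_d gpow h d b * eps d = \det h ^+ e * eps b,
      forall h d, \sum_b gpow h d b * eps' b = \det h ^+ e * eps' d
    & \sum_b eps b * eps' b = 1].
Proof.
elim: e => [|e [q [eps [eps' [Heps Heps' norm]]]]].
  exists 0%N, (fun=> 1), (fun=> 1).
  by split=> [h b|h d|]; rewrite sum_tuple0 ?/gpow ?big_ord0 ?expr0 mul1r.
pose c := \sum_b levi_civita b * levi_civita b.
(* Positivity suffices here: the Levi-Civita symbol is fixed by conj and takes the value 1 at the
   increasing word. *)
have c0 : c != 0.
  apply/eqP => c0; have conjL b : conj (levi_civita b) = levi_civita b.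
    rewrite /levi_civita -det_map_mx; congr (\det _); apply/matrixP => i j.
    by rewrite !mxE rmorph_nat.
  have /conj_pos/(_ [tuple i | i < n]) : \sum_b levi_civita b * conj (levi_civita b) = 0.
    by rewrite -[RHS]c0; apply: eq_bigr => b _; rewrite conjL.
  rewrite /levi_civita (_ : \matrix_(_, _) _ = 1%:M) ?det1.
    by move/eqP; rewrite oner_eq0.
  by apply/matrixP => i j; rewrite !mxE tnth_mktuple.
exists (n + q)%N, (fun b => levi_civita (tfst b) * eps (tsnd b)).
exists (fun b => c^-1 * levi_civita (tfst b) * eps' (tsnd b)); split.
- move=> h b; rewrite sum_tcat -{1}(tcat_split b).
  transitivity (\sum_d gpow h d (tfst b) * levi_civita d * \sum_d' gpow h d' (tsnd b) * eps d').
    apply: eq_bigr => d _; rewrite mulr_sumr; apply: eq_bigr => d' _.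
    by rewrite gpow_cat tfst_cat tsnd_cat mulrACA.
  by rewrite -mulr_suml Heps levi_civita_gpow exprS mulrACA.
- move=> h b; rewrite sum_tcat -{1}(tcat_split b).
  transitivity (\sum_d c^-1 * (gpow h (tfst b) d * levi_civita d) *
    \sum_d' gpow h (tsnd b) d' * eps' d').
    apply: eq_bigr => d _; rewrite mulr_sumr; apply: eq_bigr => d' _.
    by rewrite gpow_cat tfst_cat tsnd_cat mulrACA [_ * (_ * levi_civita _)]mulrCA.
  rewrite -mulr_suml Heps' -mulr_sumr; under eq_bigr do rewrite -gpow_tr.
  rewrite levi_civita_gpow det_tr exprS -!mulrA mulrCA; congr (_ * _).
  by rewrite [RHS]mulrCA; congr (_ * _); rewrite mulrCA.
rewrite sum_tcat; under eq_bigr do under eq_bigr do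
  rewrite tfst_cat tsnd_cat mulrACA.
under eq_bigr do rewrite -mulr_sumr norm mulr1 mulrCA.
by rewrite -mulr_sumr mulVf.
Qed.

End LeviCivita.

(** * Symmetric coefficients of polynomials in the matrix entries *)

Section Coefficients.
Variables (K : fieldType) (n : nat).
Hypothesis char0 : forall m, m.+1%:R != 0 :> K.
Local Notation idx d := (d.-tuple 'I_n).

Lemma pair_word_surj d (w : d.-tuple 'I_(n * n)) :
  exists a b : idx d, pair_word a b = w.
Proof.
have [f _ fK] := curry_mxvec_bij n n.
exists [tuple (f (tnth w i)).1 | i < d], [tuple (f (tnth w i)).2 | i < d].
apply: eq_from_tnth => i; rewrite !tnth_mktuple.
by have := fK (tnth w i) isT; case: (f _).
Qed.

(** Number of index pairs that spell the same monomial; dividing by it spreads a coefficient evenly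
    over them. *)
Definition pair_class d (a b : idx d) : nat :=
  #|[set x : idx d * idx d | wmon (pair_word x.1 x.2) == wmon (pair_word a b)]|.

(* p = sum over d, a, b of tensor_coef p a b times the monomial
   \prod_t g_(a_t, b_t), the coefficients being symmetric. *)
Definition tensor_coef (p : {mpoly K[n * n]}) d (a b : idx d) : K :=
  p@_(wmon (pair_word a b)) / (pair_class a b)%:R.

Lemma wmon_pair_rix d (a b : idx d) (s : 'S_d) :
  wmon (pair_word (rix a s) (rix b s)) = wmon (pair_word a b).
Proof.
rewrite -[RHS](wmon_rix _ s); congr wmon; apply: eq_from_tnth => i.
by rewrite tnth_rix !tnth_mktuple.
Qed.

Lemma tensor_coef_sym p d (a b : idx d) (s : 'S_d) :
  tensor_coef p (rix a s) (rix b s) = tensor_coef p a b.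
Proof. by rewrite /tensor_coef /pair_class !wmon_pair_rix. Qed.

Lemma meval_tensor_coef p D (g : 'M[K]_n) : (msize p <= D)%N ->
  p.@[mxvec g 0] = \sum_(d < D) \sum_(a : idx d) \sum_(b : idx d)
    tensor_coef p a b * gpow g a b.
Proof.
move=> pD; pose q : {mpoly K[n * n]} := \sum_(d < D) \sum_(a : idx d) \sum_(b : idx d)
    tensor_coef p a b *: 'X_[wmon (pair_word a b)].
have pq : p = q.
  apply/mpolyP => m; rewrite /q raddf_sum /=.
  have coefE d : (\sum_(a : idx d) \sum_(b : idx d)
      tensor_coef p a b *: 'X_[wmon (pair_word a b)] : {mpoly K[n * n]})@_m =
      (d == mdeg m)%:R * p@_m.
    rewrite pair_bigA raddf_sum /=.
    have [Ed|ne] := eqVneq d (mdeg m); last first.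
      rewrite mul0r big1 // => x _; rewrite mcoeffZ mcoeffX.
      case: eqP => [E|]; last by rewrite mulr0.
      by move: ne; rewrite -E mdeg_wmon eqxx.
    have [w Ew] := wmon_surj (esym Ed); have [a0 [b0 Eab]] := pair_word_surj w.
    have N0 : (pair_class a0 b0)%:R != 0 :> K.
      by rewrite -[pair_class _ _]prednK //; apply/card_gt0P; exists (a0, b0); rewrite inE.
    rewrite (bigID (fun x : idx d * idx d => wmon (pair_word x.1 x.2) == m)) /=.
    rewrite [X in _ + X]big1 ?addr0 => [|x /negbTE ne]; last first.
      by rewrite mcoeffZ mcoeffX ne mulr0.
    rewrite (eq_bigr (fun=> p@_m / (pair_class a0 b0)%:R)) => [|x /eqP Ex]; last first.
      by rewrite mcoeffZ mcoeffX Ex eqxx mulr1 /tensor_coef /pair_class Ex Eab Ew.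
    rewrite sumr_const (_ : #|_| = pair_class a0 b0).
      by rewrite -(mulr_natr (_ / _)) divfK // mul1r.
    by apply: eq_card => x; rewrite !inE Eab Ew.
  under eq_bigr do rewrite coefE.
  have [lt_mD|le_Dm] := ltnP (mdeg m) D.
    rewrite (bigD1 (Ordinal lt_mD)) //= eqxx mul1r big1 ?addr0 // => d.
    by rewrite -val_eqE /= => /negbTE->; rewrite mul0r.
  rewrite memN_msupp_eq0 ?big1 // => *; rewrite ?mulr0 //.
  by apply: msize_mdeg_ge; apply: leq_trans le_Dm.
rewrite [in LHS]pq raddf_sum; apply: eq_bigr => d _; rewrite raddf_sum; apply: eq_bigr => a _.
by rewrite raddf_sum; apply: eq_bigr => b _; rewrite /= mevalZ meval_gpow.
Qed.

End Coefficients.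

(** * Splitting a rational representation off tensors *)

Section CompleteReducibility.
Variables (K : fieldType) (n : nat) (conj : {rmorphism K -> K}).
Hypothesis char0 : forall m, m.+1%:R != 0 :> K.
Hypothesis conj_pos : forall (I : finType) (f : I -> K),
  \sum_i f i * conj (f i) = 0 -> forall i, f i = 0.
Local Notation idx d := (d.-tuple 'I_n).
Variable V : tensor_bundle K n.
Local Notation r := (rank V).

Let P (g : 'M[K]_n) : 'M[K]_r := map_mx (meval (mxvec g 0)) (numer V).
Let cf d (a b : idx d) : 'M[K]_r := \matrix_(i, j) tensor_coef (numer V i j) a b.
Let D := \max_i \max_j msize (numer V i j).

(** The degree d part of the numerators is linear in the d-th tensor power of g ([numerE]); this is
    its extension to all kernels. *)
Definition Lc d (Z : idx d -> idx d -> K) : 'M[K]_r := \sum_a \sum_b Z a b *: cf a b.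

Lemma numerE g : P g = \sum_(d < D) Lc (@gpow n K d g).
Proof.
apply/matrixP => i j; rewrite mxE summxE.
rewrite (@meval_tensor_coef _ _ char0 _ D); last first.
  by apply: leq_trans (leq_bigmax i); apply: (leq_bigmax (F := fun j => msize (numer V i j))).
apply: eq_bigr => d _; rewrite summxE; apply: eq_bigr => a _.
by rewrite summxE; apply: eq_bigr => b _; rewrite !mxE mulrC.
Qed.

Lemma rhoE g : rho V g = (\det g) ^- denom_exp V *: P g. Proof. by []. Qed.

Lemma detX_neq0 (g : 'M[K]_n) e : g \in unitmx -> \det g ^+ e != 0.
Proof. by rewrite unitmxE unitfE => ?; rewrite expf_neq0. Qed.

Lemma numerM g h : g \in unitmx -> h \in unitmx -> P (g *m h) = P g *m P h.
Proof.
move=> Ug Uh; have := @rational_actionM K n V g h Ug Uh.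
rewrite /rational_action -/(P g) -/(P h) -/(P (g *m h)) det_mulmx exprMn invfM.
rewrite -scalemxAl -scalemxAr scalerA => /(scalerI _); apply.
by rewrite mulf_neq0 ?invr_neq0 ?detX_neq0.
Qed.

Lemma numer1 : P 1%:M = 1%:M.
Proof.
by have := rational_action1 V; rewrite /rational_action det1 expr1n invr1 scale1r.
Qed.

Lemma cf_sym d (a b : idx d) (s : 'S_d) : cf (rix a s) (rix b s) = cf a b.
Proof. by apply/matrixP => i j; rewrite !mxE tensor_coef_sym. Qed.

Lemma mx_homothety_split (f : nat -> 'M[K]_n -> 'M[K]_r) :
  (forall g, g \in unitmx -> \sum_(d < D) f d g = 0) ->
  (forall d s g, f d (s *: g) = s ^+ d *: f d g) ->
  forall (d : 'I_D) g, g \in unitmx -> f d g = 0.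
Proof.
move=> f0 fZ d g Ug; apply/matrixP => i j; rewrite mxE.
apply: (@homothety_split _ _ char0 D (fun d g => f d g i j)) => //.
  by move=> h Uh; rewrite -summxE f0 // mxE.
by move=> d' s h; rewrite fZ mxE.
Qed.

Lemma Lc_gpowZ d s g : Lc (@gpow n K d (s *: g)) = s ^+ d *: Lc (@gpow n K d g).
Proof.
rewrite /Lc scaler_sumr; apply: eq_bigr => a _; rewrite scaler_sumr.
by apply: eq_bigr => b _; rewrite gpowZ scalerA.
Qed.

Lemma mx_polarization d (F : idx d -> idx d -> 'M[K]_r) (Z : idx d -> idx d -> K) :
  (forall g, g \in unitmx -> \sum_a \sum_b gpow g a b *: F a b = 0) ->
  (forall (s : 'S_d) a b, Z (rix a s) (rix b s) = Z a b) ->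
  \sum_a \sum_b Z a b *: F a b = 0.
Proof.
move=> F0 symZ; apply/matrixP => i j; rewrite mxE summxE.
rewrite -[RHS](polarization char0 (F := fun a b => F a b i j) (Z := Z)) //.
  apply: eq_bigr => a _; rewrite summxE; apply: eq_bigr => b _; by rewrite mxE mulrC.
move=> g Ug; have := congr1 (fun A : 'M_r => A i j) (F0 g Ug); rewrite mxE => E.
rewrite -[RHS]E summxE; apply: eq_bigr => a _; rewrite summxE; apply: eq_bigr => b _.
by rewrite mxE mulrC.
Qed.

Lemma mx_polarization_sym d (F : idx d -> idx d -> 'M[K]_r) :
  (forall g, g \in unitmx -> \sum_a \sum_b gpow g a b *: F a b = 0) ->
  (forall (s : 'S_d) a b, F (rix a s) (rix b s) = F a b) ->
  forall a b, F a b = 0.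
Proof.
move=> F0 symF a b; apply/matrixP => i j; rewrite mxE.
apply: (polarization_sym char0 (F := fun a b => F a b i j)) => [g Ug|s c e]; last by rewrite symF.
have := congr1 (fun A : 'M_r => A i j) (F0 g Ug); rewrite mxE => E.
rewrite -[RHS]E summxE; apply: eq_bigr => c _; rewrite summxE; apply: eq_bigr => e _.
by rewrite mxE mulrC.
Qed.

Section FixedDegree.
Variable d : 'I_D.
Implicit Types a b c : idx d.

(** Compare the two sides of P(g h) = P(g) P(h) in degree d of g, then polarize in g. The
    coefficients thus transform under h like tensors. *)
Lemma cf_numer h a b : h \in unitmx ->
  cf b a *m P h = \sum_c gpow h a c *: cf b c.
Proof.
move=> Uh; apply/eqP; rewrite -subr_eq0; apply/eqP.
pose F e (x y : idx e) : 'M[K]_r := cf x y *m P h - \sum_z gpow h y z *: cf x z.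
apply: (mx_polarization_sym (F := @F d)) => [|s x y]; last first.
  rewrite /F cf_sym; congr (_ - _); rewrite (sum_rix s).
  by apply: eq_bigr => z _; rewrite gpow_rix cf_sym.
apply: (mx_homothety_split (f := fun e g => \sum_x \sum_y gpow g x y *: F e x y)).
  move=> g Ug; have := numerM Ug Uh; rewrite (numerE (g *m h)) (numerE g) mulmx_suml => /eqP.
  rewrite eq_sym -subr_eq0 -sumrB => /eqP E; rewrite -[RHS]E; apply: eq_bigr => e _.
  rewrite /Lc mulmx_suml -sumrB; apply: eq_bigr => x _.
  rewrite mulmx_suml; under eq_bigr do rewrite scalerBr.
  rewrite sumrB; congr (_ - _); first by apply: eq_bigr => y _; rewrite -scalemxAl.
  under eq_bigr do rewrite scaler_sumr; rewrite exchange_big; apply: eq_bigr => z _ /=.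
  by rewrite gpowM scaler_suml; apply: eq_bigr => y _; rewrite scalerA.
move=> e s g; rewrite scaler_sumr; apply: eq_bigr => x _; rewrite scaler_sumr.
by apply: eq_bigr => y _; rewrite gpowZ scalerA.
Qed.

Lemma numer_cf h c b : h \in unitmx ->
  P h *m cf c b = \sum_a gpow h a c *: cf a b.
Proof.
move=> Uh; apply/eqP; rewrite -subr_eq0; apply/eqP.
pose F e (x y : idx e) : 'M[K]_r := P h *m cf x y - \sum_z gpow h z x *: cf z y.
apply: (mx_polarization_sym (F := @F d)) => [|s x y]; last first.
  rewrite /F cf_sym; congr (_ - _); rewrite (sum_rix s).
  by apply: eq_bigr => z _; rewrite gpow_rix cf_sym.
apply: (mx_homothety_split (f := fun e g => \sum_x \sum_y gpow g x y *: F e x y)).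
  move=> g Ug; have := numerM Uh Ug; rewrite (numerE (h *m g)) (numerE g) mulmx_sumr => /eqP.
  rewrite eq_sym -subr_eq0 -sumrB => /eqP E; rewrite -[RHS]E; apply: eq_bigr => e _.
  rewrite /Lc mulmx_sumr.
  transitivity (\sum_(x : idx e) \sum_(y : idx e) gpow g x y *: (P h *m cf x y) -
      \sum_(x : idx e) \sum_(y : idx e) gpow g x y *: \sum_(z : idx e) gpow h z x *: cf z y).
    rewrite -sumrB; apply: eq_bigr => x _; rewrite -sumrB; apply: eq_bigr => y _.
    by rewrite -scalerBr.
  congr (_ - _).
    apply: eq_bigr => x _; rewrite mulmx_sumr; apply: eq_bigr => y _.
    by rewrite -scalemxAr.
  under eq_bigr do under eq_bigr do rewrite scaler_sumr.
  under eq_bigr do rewrite exchange_big; rewrite exchange_big; apply: eq_bigr => z _ /=.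
  rewrite exchange_big; apply: eq_bigr => y _ /=.
  by rewrite gpowM scaler_suml; apply: eq_bigr => x _; rewrite scalerA mulrC.
move=> e s g; rewrite scaler_sumr; apply: eq_bigr => x _; rewrite scaler_sumr.
by apply: eq_bigr => y _; rewrite gpowZ scalerA.
Qed.

Implicit Types Z : idx d -> idx d -> K.

Definition symmetric_kernel Z := forall (s : 'S_d) a b, Z (rix a s) (rix b s) = Z a b.

Definition kmul Z Z' a b : K := \sum_c Z a c * Z' c b.

Definition kone a b : K := (a == b)%:R.

(** [cf_numer] is split by degree in h, where only degree d of P h contributes; polarization in h
    then passes from tensor powers to symmetric kernels. *)
Lemma cf_Lc Z a b : symmetric_kernel Z ->
  cf b a *m Lc Z = \sum_c Z a c *: cf b c.
Proof.
move=> symZ; apply/eqP; rewrite eq_sym -subr_eq0; apply/eqP.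
pose F x y : 'M[K]_r := (x == a)%:R *: cf b y - cf b a *m cf x y.
have FE (Y : idx d -> idx d -> K) : \sum_x \sum_y Y x y *: F x y =
    \sum_c Y a c *: cf b c - cf b a *m Lc Y.
  transitivity (\sum_x \sum_y (x == a)%:R *: (Y x y *: cf b y) -
      \sum_x \sum_y Y x y *: (cf b a *m cf x y)).
    rewrite -sumrB; apply: eq_bigr => x _; rewrite -sumrB; apply: eq_bigr => y _.
    by rewrite scalerBr !scalerA mulrC.
  congr (_ - _).
    rewrite (bigD1 a) //= [X in _ + X]big1 => [|x /negbTE ne].
      by rewrite addr0 eqxx; apply: eq_bigr => y _; rewrite scale1r.
    by rewrite big1 // => y _; rewrite ne scale0r.
  rewrite /Lc mulmx_sumr; apply: eq_bigr => x _; rewrite mulmx_sumr.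
  by apply: eq_bigr => y _; rewrite -scalemxAr.
rewrite -FE; apply: mx_polarization => // h Uh; rewrite FE.
pose f e g : 'M[K]_r := (e == d :> nat)%:R *: (\sum_c gpow g a c *: cf b c) -
  cf b a *m Lc (@gpow n K e g).
suff -> : \sum_c gpow h a c *: cf b c - cf b a *m Lc (@gpow n K d h) = f d h.
  apply: (mx_homothety_split (f := f)) => // [g Ug|e s g].
    rewrite /f sumrB -mulmx_sumr -numerE (cf_numer _ _ Ug) (bigD1 d) //= eqxx scale1r.
    rewrite [X in _ + X - _]big1 ?addr0 ?subrr // => e ne.
    by rewrite val_eqE (negbTE ne) scale0r.
  rewrite /f Lc_gpowZ -scalemxAr scalerBr; congr (_ - _).
  case: eqP => [->|_]; last by rewrite !scale0r scaler0.
  by rewrite !scale1r scaler_sumr; apply: eq_bigr => c _; rewrite gpowZ scalerA.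
by rewrite /f eqxx scale1r.
Qed.

(** Makes V a module over the algebra of symmetric kernels, in which the unit [kone] acts by the
    idempotent onto the part of V of degree d. *)
Lemma LcM Z Z' : symmetric_kernel Z' -> Lc Z *m Lc Z' = Lc (kmul Z Z').
Proof.
move=> symZ'; rewrite {1}/Lc mulmx_suml; apply: eq_bigr => a _.
rewrite mulmx_suml; under eq_bigr do rewrite -scalemxAl (cf_Lc _ _ symZ') scaler_sumr.
rewrite exchange_big; apply: eq_bigr => b _ /=.
by rewrite /kmul scaler_suml; apply: eq_bigr => c _; rewrite scalerA.
Qed.

Lemma eq_Lc Z Z' : Z =2 Z' -> Lc Z = Lc Z'.
Proof. by move=> E; apply: eq_bigr => a _; apply: eq_bigr => b _; rewrite E. Qed.

Lemma Lc_sum (I : finType) (Z : I -> idx d -> idx d -> K) :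
  Lc (fun a b => \sum_i Z i a b) = \sum_i Lc (Z i).
Proof.
rewrite exchange_big; apply: eq_bigr => a _ /=.
rewrite exchange_big; apply: eq_bigr => b _ /=; exact: scaler_suml.
Qed.

Lemma sym_kone : symmetric_kernel kone.
Proof. by move=> s a b; rewrite /kone eq_rix_perm. Qed.

(* The averages over S_d of the elementary matrices E_ab. *)
Definition avg a b c e : K :=
  d`!%:R^-1 * \sum_(s : 'S_d) (c == rix a s)%:R * (e == rix b s)%:R.

Lemma sym_avg a b : symmetric_kernel (avg a b).
Proof.
move=> s c e; rewrite /avg (reindex_inj (mulgI s)) /=; congr (_ * _).
by apply: eq_bigr => t _; rewrite !rixM !eq_rix_perm.
Qed.

Lemma avgC a b c e : avg a b c e = avg b a e c.
Proof. by congr (_ * _); apply: eq_bigr => s _; rewrite mulrC. Qed.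

Lemma fact_neq0 : d`!%:R != 0 :> K.
Proof. by rewrite -[d`!]prednK ?fact_gt0. Qed.

Lemma Lc_avg a b : Lc (avg a b) = cf a b.
Proof.
transitivity (d`!%:R^-1 *: \sum_(s : 'S_d) cf (rix a s) (rix b s)).
  rewrite /Lc /avg; under eq_bigr do under eq_bigr do rewrite -scalerA scaler_suml.
  under eq_bigr do rewrite -scaler_sumr exchange_big.
  rewrite -scaler_sumr exchange_big; congr (_ *: _); apply: eq_bigr => s _ /=.
  rewrite (bigD1 (rix a s)) //= (bigD1 (rix b s)) //= !eqxx mulr1 scale1r.
  rewrite !big1 ?addr0 // => [c /negbTE ne|c /negbTE ne].
    by rewrite big1 // => e _; rewrite ne mul0r scale0r.
  by rewrite ne mulr0 scale0r.
under eq_bigr do rewrite cf_sym.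
by rewrite sumr_const card_Sn -(scaler_nat _ (cf a b)) scalerA mulVf ?scale1r ?fact_neq0.
Qed.

Lemma sum_avg c e : \sum_a avg a a c e = (c == e)%:R.
Proof.
rewrite -mulr_sumr exchange_big /= (eq_bigr (fun=> (c == e)%:R)).
  by rewrite sumr_const card_Sn -(mulr_natl (_ == _)%:R) mulrA mulVf ?mul1r ?fact_neq0.
move=> s _; rewrite (bigD1 (rix c s^-1%g)) //= rixVK eqxx mul1r [e == c]eq_sym big1 ?addr0 //.
move=> a ne; case: eqP => [E|]; last by rewrite mul0r.
by move: ne; rewrite E rixK eqxx.
Qed.

Definition casimir c e : K := \sum_a \sum_b kmul (avg a b) (avg b a) c e.

Lemma sym_kmul Z Z' : symmetric_kernel Z -> symmetric_kernel Z' -> symmetric_kernel (kmul Z Z').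
Proof.
move=> sZ sZ' s a b; rewrite /kmul (sum_rix s).
by apply: eq_bigr => c _; rewrite sZ sZ'.
Qed.

Lemma sym_casimir : symmetric_kernel casimir.
Proof.
move=> s c e; apply: eq_bigr => a _; apply: eq_bigr => b _.
by rewrite sym_kmul //; apply: sym_avg.
Qed.

Lemma Lc_casimir : Lc casimir = \sum_(a : idx d) \sum_(b : idx d) cf a b *m cf b a.
Proof.
rewrite Lc_sum; apply: eq_bigr => a _; rewrite Lc_sum; apply: eq_bigr => b _.
by rewrite -LcM ?Lc_avg //; apply: sym_avg.
Qed.

(** Since [avg b a] is the transpose of [avg a b] and both are fixed by conj, pairing u [casimir]
    with conj(u) gives the sum of the squares of the entries of all u [avg a b]. These vanish, and
    the [avg a a] add up to the identity. *)
Lemma casimir_inj u : (forall e, \sum_c u c * casimir c e = 0) -> forall c, u c = 0.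
Proof.
move=> u0; pose f (x : idx d * idx d * idx d) : K := \sum_c u c * avg x.1.1 x.1.2 c x.2.
have conj_avg a b c e : conj (avg a b c e) = avg a b c e.
  rewrite /avg rmorphM fmorphV rmorph_nat; congr (_ * _); rewrite rmorph_sum.
  by apply: eq_bigr => s _; rewrite rmorphM !rmorph_nat.
have /conj_pos f0 : \sum_x f x * conj (f x) = 0.
  transitivity (\sum_e (\sum_c u c * casimir c e) * conj (u e)); last first.
    by apply: big1 => e _; rewrite u0 mul0r.
  have casimirE c e : casimir c e = \sum_(x : idx d * idx d * idx d)
      avg x.1.1 x.1.2 c x.2 * avg x.1.2 x.1.1 x.2 e.
    by rewrite /casimir /kmul !pair_bigA.
  under [RHS]eq_bigr do under eq_bigr do rewrite casimirE mulr_sumr.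
  under [RHS]eq_bigr do rewrite exchange_big mulr_suml.
  rewrite [RHS]exchange_big; apply: eq_bigr => x _ /=.
  rewrite {2}/f rmorph_sum mulr_sumr; apply: eq_bigr => e _.
  under [X in _ = X * _]eq_bigr do rewrite mulrA.
  by rewrite -mulr_suml rmorphM conj_avg -/(f x) -avgC -mulrA [conj _ * _]mulrC.
move=> e; rewrite -(sum_eqr u e).
under eq_bigr do rewrite -sum_avg mulr_sumr.
rewrite exchange_big big1 //= => a _; exact: (f0 (a, a, e)).
Qed.

(** G is the image of the inverse of [casimir]. It turns the sum of the products cf a b cf b a into
    the projection onto the degree d part, and its equivariance lets it enter the projection of a
    summand. *)
Lemma exists_inverse : exists G : 'M[K]_r,
  [/\ forall h, h \in unitmx -> G *m P h = P h *m G
    & G *m (\sum_(a : idx d) \sum_(b : idx d) cf a b *m cf b a) = Lc kone].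
Proof.
have [Z' [ZZ' Z'Z]] := kernel_inverse casimir_inj.
(* The inverse of a symmetric kernel is symmetric by uniqueness, so [LcM] covers it. *)
have symZ' : symmetric_kernel Z'.
  move=> s a b; rewrite -[RHS](sum_eqr (fun c => Z' a c) b).
  transitivity (\sum_c (\sum_e Z' a e * casimir e c) * Z' (rix c s) (rix b s)).
    under eq_bigr do rewrite Z'Z eq_sym.
    by rewrite sum_eql.
  under eq_bigr do rewrite mulr_suml.
  rewrite exchange_big; apply: eq_bigr => e _ /=.
  under eq_bigr do rewrite -mulrA; rewrite -mulr_sumr; congr (_ * _).
  rewrite -(eq_rix_perm s) -ZZ' [RHS](sum_rix s).
  by apply: eq_bigr => c _; rewrite sym_casimir.
have e1 : Lc kone *m Lc Z' = Lc Z'.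
  rewrite LcM //; apply: eq_Lc => a b; rewrite /kmul /kone.
  by under eq_bigr do rewrite eq_sym; rewrite sum_eql.
have e2 : Lc Z' *m Lc kone = Lc Z'.
  by rewrite LcM ?sym_kone //; [apply: eq_Lc => a b; rewrite /kmul /kone sum_eqr | exact: sym_kone].
have GZ : Lc casimir *m Lc Z' = Lc kone by rewrite LcM //; apply: eq_Lc.
have ZG : Lc Z' *m Lc casimir = Lc kone.
  by rewrite LcM //; [exact: eq_Lc | exact: sym_casimir].
have LkoneE : Lc kone = \sum_(a : idx d) cf a a.
  apply: eq_bigr => a _; rewrite (bigD1 a) //= /kone eqxx scale1r big1 ?addr0 //.
  by move=> b; rewrite eq_sym => /negbTE->; rewrite scale0r.
have eP h : h \in unitmx -> Lc kone *m P h = P h *m Lc kone.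
  move=> Uh; rewrite LkoneE mulmx_suml mulmx_sumr.
  under eq_bigr do rewrite (cf_numer _ _ Uh).
  under [RHS]eq_bigr do rewrite (numer_cf _ _ Uh).
  by rewrite [RHS]exchange_big.
have GP h : h \in unitmx -> Lc casimir *m P h = P h *m Lc casimir.
  move=> Uh; rewrite Lc_casimir mulmx_suml mulmx_sumr.
  under eq_bigr do rewrite mulmx_suml.
  under eq_bigr do under eq_bigr do rewrite -mulmxA (cf_numer _ _ Uh) mulmx_sumr.
  under [RHS]eq_bigr do rewrite mulmx_sumr.
  under [RHS]eq_bigr do under eq_bigr do rewrite mulmxA (numer_cf _ _ Uh) mulmx_suml.
  under [RHS]eq_bigr do rewrite exchange_big.
  rewrite [RHS]exchange_big; apply: eq_bigr => a _ /=.
  rewrite [RHS]exchange_big; apply: eq_bigr => b _ /=.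
  by apply: eq_bigr => c _; rewrite -scalemxAl -scalemxAr.
exists (Lc Z'); split; last by rewrite -Lc_casimir.
move=> h Uh.
have -> : Lc Z' *m P h = Lc Z' *m P h *m (Lc casimir *m Lc Z').
  by rewrite GZ -mulmxA -eP // mulmxA e2.
rewrite -!mulmxA [P h *m _]mulmxA -GP // !mulmxA ZG.
by rewrite eP // -mulmxA e1.
Qed.

End FixedDegree.

Lemma tensor_actE p q (g : 'M[K]_n) (t : tensor n K^o p q) a b :
  tensor_act g t (a, b) = \sum_c \sum_d gpow g a c * gpow (invmx g) d b * t (c, d).
Proof. by rewrite ffunE pair_bigA; apply: eq_bigr => -[]. Qed.

(** One factor T^(d,q) for every degree d, word b and coordinate i: there v becomes the array with
    upper indices a formed by the i-th coordinates of cf b a v, times eps, whose lower indices carry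
    the power of \det in the denominator. *)
Definition coef_index := {d : 'I_D & (idx d * 'I_r)%type}.

Theorem summand_exists : inhabited (summand V).
Proof.
have [q [eps [eps' [Heps Heps' norm]]]] := det_power_tensor n conj_pos (denom_exp V).
have [G HG] : exists G : 'I_D -> 'M[K]_r, forall d : 'I_D,
    (forall h, h \in unitmx -> G d *m P h = P h *m G d) /\
    G d *m (\sum_(a : idx d) \sum_(b : idx d) cf a b *m cf b a) = Lc (@kone d).
  have /fin_all_exists[G HG] d := exists_inverse d.
  by exists G => d; have [] := HG d.
pose up (x : coef_index) : nat := tag x.
pose inj0 (x : coef_index) (v : fibre V) : tensor n K^o (up x) q :=
  [ffun y => (cf (tagged x).1 y.1 *m v) (tagged x).2 0 * eps y.2].
(* Applied after [inj0] and summed over b and i, the columns of cf a b produce the sum of the cf a b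
   cf b a, which G turns into [Lc kone]. *)
pose proj0 (x : coef_index) (t : tensor n K^o (up x) q) : fibre V :=
  G (tag x) *m (\sum_a (\sum_B t (a, B) * eps' B) *: col (tagged x).2 (cf a (tagged x).1)).
have lin_inj x : linear (inj0 x).
  move=> c u v; apply/ffunP => y; rewrite !ffunE mulmxDr -scalemxAr !mxE mulrDl.
  by congr (_ + _); rewrite -mulrA.
have lin_proj x : linear (proj0 x).
  move=> c u v; rewrite /proj0 scalemxAr -mulmxDr; congr (_ *m _).
  rewrite scaler_sumr -big_split; apply: eq_bigr => a _ /=.
  rewrite scalerA -scalerDl; congr (_ *: _); rewrite mulr_sumr -big_split.
  by apply: eq_bigr => B _; rewrite !ffunE mulrDl mulrA.
pose injl (x : coef_index) : {linear fibre V -> tensor n K^o (up x) q} :=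
  HB.pack (inj0 x) (GRing.isLinear.Build _ _ _ _ _ (lin_inj x)).
pose projl (x : coef_index) : {linear tensor n K^o (up x) q -> fibre V} :=
  HB.pack (proj0 x) (GRing.isLinear.Build _ _ _ _ _ (lin_proj x)).
have inj_eq' x g v : g \in unitmx -> inj0 x (rho V g *m v) = tensor_act g (inj0 x v).
  case: x => d [b i] Ug; apply/ffunP => -[a B]; rewrite tensor_actE ffunE /=.
  rewrite rhoE -scalemxAl -scalemxAr mulmxA (cf_numer _ _ Ug) mulmx_suml mxE summxE.
  transitivity (\sum_c gpow g a c * (cf b c *m v) i 0 *
      \sum_D gpow (invmx g) D B * eps D).
    rewrite Heps det_inv exprVn -mulr_suml mulrCA mulrA; congr (_ * _ * _).
    by apply: eq_bigr => c _; rewrite -scalemxAl mxE.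
  apply: eq_bigr => c _; rewrite mulr_sumr; apply: eq_bigr => D' _.
  by rewrite ffunE /= mulrACA.
have proj_eq' x g t : g \in unitmx -> proj0 x (tensor_act g t) = rho V g *m proj0 x t.
  case: x t => d [b i] t Ug; rewrite /proj0 /= rhoE -scalemxAl mulmxA -(HG d).1 //.
  rewrite -mulmxA scalemxAr; congr (_ *m _); rewrite mulmx_sumr scaler_sumr.
  under [RHS]eq_bigr do
    rewrite -scalemxAr colE mulmxA (numer_cf _ _ Ug) mulmx_suml !scaler_sumr.
  rewrite [RHS]exchange_big; apply: eq_bigr => a _ /=.
  under [RHS]eq_bigr do rewrite -scalemxAl -colE !scalerA.
  rewrite -scaler_suml; congr (_ *: _).
  transitivity (\sum_c gpow g a c * \sum_D t (c, D) * \sum_B gpow (invmx g) D B * eps' B).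
    under eq_bigr do rewrite tensor_actE mulr_suml.
    rewrite exchange_big; apply: eq_bigr => c _ /=.
    under eq_bigr do rewrite mulr_suml.
    rewrite mulr_sumr exchange_big; apply: eq_bigr => D' _ /=.
    rewrite mulrA mulr_sumr; apply: eq_bigr => B _.
    by rewrite -!mulrA; congr (_ * _); rewrite mulrCA.
  apply: eq_bigr => c _; rewrite [LHS]mulrC; congr (_ * _); rewrite mulr_sumr.
  by apply: eq_bigr => D' _; rewrite Heps' det_inv exprVn mulrCA.
have sumK v : \sum_x projl x (injl x v) = v.
  (* The parts of all degrees add up to P(1) = 1. *)
  transitivity (\sum_(d < D) Lc (@kone d) *m v); last first.
    rewrite -mulmx_suml -[RHS]mul1mx -numer1 numerE; congr (_ *m _).
    by apply: eq_bigr => d _; apply: eq_Lc => a b; rewrite gpow1.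
  transitivity (\sum_(d < D) \sum_(y : idx d * 'I_r)
      projl (Tagged (fun d : 'I_D => (idx d * 'I_r)%type) y)
        (injl (Tagged (fun d : 'I_D => (idx d * 'I_r)%type) y) v)).
    rewrite (sig_big_dep xpredT (fun=> xpredT) (fun d y =>
      projl (Tagged (fun d : 'I_D => (idx d * 'I_r)%type) y)
        (injl (Tagged (fun d : 'I_D => (idx d * 'I_r)%type) y) v))).
    by apply: eq_bigr => -[].
  apply: eq_bigr => d _; rewrite -(HG d).2 -mulmxA mulmx_suml.
  under [in RHS]eq_bigr do rewrite mulmx_suml.
  rewrite exchange_big mulmx_sumr /=.
  transitivity (\sum_(b : idx d) \sum_(i < r) G d *m
      \sum_(a : idx d) (cf b a *m v) i 0 *: col i (cf a b)).
    rewrite pair_bigA; apply: eq_bigr => -[b i] _ /=; rewrite /proj0; congr (_ *m _).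
    apply: eq_bigr => a _; congr (_ *: _); under eq_bigr do rewrite ffunE /= -mulrA.
    by rewrite -mulr_sumr norm mulr1.
  apply: eq_bigr => b _; rewrite -mulmx_sumr exchange_big; congr (_ *m _).
  apply: eq_bigr => a _ /=; rewrite -mulmxA; apply/matrixP => k l; rewrite ord1 mxE summxE.
  by apply: eq_bigr => i _; rewrite !mxE mulrC.
constructor.
pose ix (i : 'I_#|{: coef_index}|) : coef_index := enum_val i.
apply: (@Summand K n V #|{: coef_index}| (fun i => up (ix i)) (fun=> q)
  (fun i => injl (ix i)) (fun i => projl (ix i))) => [i g v|i g t|v].
- exact: inj_eq'.
- exact: proj_eq'.
- rewrite -[RHS]sumK [RHS](reindex ix) //; exact: onW_bij (enum_val_bij _).
Qed.

End CompleteReducibility.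

(** * Shears and the order of a natural operation *)

Section Filtration.
Variables (K : fieldType) (n : nat).
Implicit Types p q w : {mpoly K[n]}.

(* The d-th power of the maximal ideal at the origin. *)
Definition vanishes d p := forall m, (mdeg m < d)%N -> p@_m = 0.

Lemma vanishes0 p : vanishes 0 p. Proof. by []. Qed.

Lemma vanishesW d e p : (e <= d)%N -> vanishes d p -> vanishes e p.
Proof. by move=> le_ed Hp m Hm; apply/Hp/(leq_trans Hm). Qed.

Lemma vanishesD d p q : vanishes d p -> vanishes d q -> vanishes d (p + q).
Proof. by move=> Hp Hq m Hm; rewrite mcoeffD Hp ?Hq ?addr0. Qed.

Lemma vanishesN d p : vanishes d p -> vanishes d (- p).
Proof. by move=> Hp m Hm; rewrite mcoeffN Hp ?oppr0. Qed.

Lemma vanishesB d p q : vanishes d p -> vanishes d q -> vanishes d (p - q).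
Proof. by move=> Hp Hq; apply/vanishesD/vanishesN. Qed.

Lemma vanishes_zero d : vanishes d 0.
Proof. by move=> m _; rewrite mcoeff0. Qed.

Lemma vanishes_sum d (I : Type) (r : seq I) (P : pred I) (F : I -> {mpoly K[n]}) :
  (forall i, P i -> vanishes d (F i)) -> vanishes d (\sum_(i <- r | P i) F i).
Proof.
move=> HF; apply: big_ind => //; first exact: vanishes_zero.
exact: vanishesD.
Qed.

Lemma vanishesM d e p q : vanishes d p -> vanishes e q -> vanishes (d + e) (p * q).
Proof.
move=> Hp Hq m Hm; rewrite mcoeffM big1 // => -[u v] /= /eqP/(congr1 (@mdeg n)).
rewrite mdegD => Em; rewrite Em in Hm; move: Hm {Em}; case: (ltnP (mdeg u) d) => [/Hp-> _|le_d H].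
  by rewrite mul0r.
rewrite Hq ?mulr0 //; rewrite -(ltn_add2l d); apply: leq_ltn_trans H.
by rewrite leq_add2r.
Qed.

Lemma vanishesMr d p q : vanishes d p -> vanishes d (p * q).
Proof. by move=> Hp; rewrite -[d]addn0; apply: vanishesM. Qed.

Lemma vanishesMl d p q : vanishes d q -> vanishes d (p * q).
Proof. by rewrite mulrC; apply: vanishesMr. Qed.

Lemma vanishesZ d c p : vanishes d p -> vanishes d (c *: p).
Proof. by move=> Hp m Hm; rewrite mcoeffZ Hp ?mulr0. Qed.

Lemma vanishesX d e p : vanishes d p -> vanishes (d * e) (p ^+ e).
Proof.
move=> Hp; elim: e => [|e IH]; first by rewrite muln0.
by rewrite exprS mulnS; apply: vanishesM.
Qed.

Lemma vanishesXU i : vanishes 1 'X_i.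
Proof.
by move=> m; rewrite ltnS leqn0 mdeg_eq0 => /eqP->; rewrite mcoeffX mnm1_eq0.
Qed.

Let leading d (a b : {mpoly K[n]}) := vanishes d b /\ vanishes d.+1 (a - b).

Let leadingM d e a b a' b' : leading d a b -> leading e a' b' ->
  leading (d + e) (a * a') (b * b').
Proof.
move=> [Hb Hab] [Hb' Hab']; split; first exact: vanishesM.
have -> : a * a' - b * b' = (a - b) * b' + a * (a' - b') by ring.
apply: vanishesD; first by rewrite -addSn; apply: vanishesM.
rewrite -addnS; apply: vanishesM => //.
by rewrite -[a](subrK b); apply: vanishesD => //; apply: vanishesW Hab.
Qed.

Lemma vanishes_comp d w (phi : n.-tuple {mpoly K[n]}) :
  (forall i, vanishes 1 (tnth phi i)) -> vanishes d w -> vanishes d (w \mPo phi).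
Proof.
move=> Hphi Hw; rewrite comp_mpolyEX; apply: vanishes_sum => m _.
have [lt_md|le_dm] := ltnP (mdeg m) d.
  by rewrite Hw // scale0r; apply: vanishes_zero.
apply: vanishesZ; apply: vanishesW le_dm _; rewrite comp_mpolyX mdegE.
elim/big_rec2: _ => [|i x y _ Hy] //.
by apply: vanishesM => //; rewrite -[X in vanishes X _]mul1n; apply: vanishesX.
Qed.

(** Each phi_i has the same leading form as X_i, and having the same leading form is stable under
    products. *)
Lemma comp_leading d w (phi : n.-tuple {mpoly K[n]}) :
  (forall i, vanishes 2 (tnth phi i - 'X_i)) -> vanishes d w ->
  vanishes d.+1 (w \mPo phi - w).
Proof.
move=> Hphi Hw; rewrite comp_mpolyEX [X in _ - X]mpolyE -sumrB; apply: vanishes_sum => m _.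
have [lt_md|le_dm] := ltnP (mdeg m) d.
  by rewrite Hw // !scale0r subrr; apply: vanishes_zero.
rewrite -scalerBr; apply: vanishesZ; apply: (@vanishesW (mdeg m).+1) => //.
rewrite comp_mpolyX [X in _ - X]mpolyXE_id mdegE.
suff [] : leading (\sum_i m i) (\prod_i tnth phi i ^+ m i) (\prod_i 'X_i ^+ m i) by [].
elim/big_rec3: _ => [|i x y z _ IH].
  by split=> //; rewrite subrr; apply: vanishes_zero.
apply: leadingM => //; elim: (m i) => [|e IHe].
  by split=> //; rewrite subrr; apply: vanishes_zero.
rewrite !exprS -add1n; apply: leadingM => //; split=> //.
exact: vanishesXU.
Qed.

End Filtration.

(** * Directional derivatives and first-order Taylor expansion *)

Section Directional.
Variables (K : fieldType) (N : nat) (c e : 'I_N -> K).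
Implicit Types p q : {mpoly K[N]}.

Definition dir p : K := \sum_a e a * (p^`M(a)).@[c].

Lemma dirD p q : dir (p + q) = dir p + dir q.
Proof.
by rewrite -big_split; apply: eq_bigr => a _; rewrite mderivD mevalD mulrDr.
Qed.

Lemma dirB p q : dir (p - q) = dir p - dir q.
Proof.
by rewrite -sumrB; apply: eq_bigr => a _; rewrite mderivB mevalB mulrBr.
Qed.

Lemma dir0 : dir 0 = 0.
Proof. by apply: big1 => a _; rewrite mderiv0 meval0 mulr0. Qed.

Lemma dirZ x p : dir (x *: p) = x * dir p.
Proof. by rewrite mulr_sumr; apply: eq_bigr => a _; rewrite mderivZ mevalZ mulrCA. Qed.

Lemma dir_sum (I : Type) (r : seq I) (P : pred I) (F : I -> {mpoly K[N]}) :
  dir (\sum_(i <- r | P i) F i) = \sum_(i <- r | P i) dir (F i).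
Proof. exact: (big_morph dir dirD dir0). Qed.

Lemma dirM p q : dir (p * q) = dir p * q.@[c] + p.@[c] * dir q.
Proof.
rewrite mulr_suml mulr_sumr -big_split; apply: eq_bigr => a _ /=.
by rewrite mderivM mevalD !mevalM mulrDr mulrA [p.@[c] * (_ * _)]mulrCA.
Qed.

Lemma dirC x : dir x%:MP = 0.
Proof. by apply: big1 => a _; rewrite mderivC meval0 mulr0. Qed.

Lemma dirXU a : dir 'X_a = e a.
Proof.
rewrite /dir (bigD1 a) //= big1 ?addr0 => [|b ne].
  rewrite mderivX mnm1E eqxx scale1r.
  have -> : (U_(a) - U_(a) = 0)%MM by apply/mnmP => i; rewrite mnmBE subnn mnm0E.
  by rewrite mpolyX0 meval1 mulr1.
by rewrite mderivX mnm1E eq_sym (negbTE ne) scale0r meval0 mulr0.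
Qed.

(** In use t is a multiple of the d-th power of a linear form, and the terms with t^2 fall beyond
    the degree considered. *)
Lemma mmap_taylor (A : comNzRingType) (f : {rmorphism K -> A}) (t : A) p :
  exists r, mmap f (fun a => f (c a) + t * f (e a)) p =
    f p.@[c] + t * f (dir p) + t ^+ 2 * r.
Proof.
pose h a := f (c a) + t * f (e a).
pose Q q := exists r, mmap f h q = f q.@[c] + t * f (dir q) + t ^+ 2 * r.
have QM p1 p2 : Q p1 -> Q p2 -> Q (p1 * p2).
  move=> [r1 E1] [r2 E2]; rewrite /Q rmorphM /= E1 E2 mevalM dirM !rmorphD !rmorphM /=.
  move: (f p1.@[c]) (f (dir p1)) (f p2.@[c]) (f (dir p2)) => x y z u.
  by exists (y * u + x * r2 + t * y * r2 + r1 * (z + t * u + t ^+ 2 * r2)); ring.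
have QC x : Q x%:MP.
  by exists 0; rewrite mmapC mevalC dirC rmorph0 !mulr0 !addr0.
have QX m : Q 'X_[m].
  rewrite mpolyXE_id; apply: big_ind => //; first by have := QC 1; rewrite mpolyC1.
  move=> a _; elim: (m a) => [|k IH]; first by have := QC 1; rewrite mpolyC1.
  rewrite exprS; apply: QM => //; exists 0.
  by rewrite mmapX mmap1U mevalXU dirXU mulr0 addr0.
elim/mpolyind: p => [|x m q _ _ [r Hr]]; first by have := QC 0; rewrite mpolyC0.
have [r' Hr'] := QM _ _ (QC x) (QX m).
exists (r' + r); rewrite -mul_mpolyC mmapD Hr Hr' mevalD dirD !rmorphD /=.
by ring.
Qed.

End Directional.

Lemma eq_mmap (R S : comNzRingType) N (f : R -> S) (h1 h2 : 'I_N -> S) (p : {mpoly R[N]}) :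
  h1 =1 h2 -> mmap f h1 p = mmap f h2 p.
Proof.
move=> E; apply: eq_bigr => m _; congr (_ * _).
by apply: eq_bigr => i _; rewrite E.
Qed.

Section Jets.
Variables (K : fieldType) (n k : nat) (V : tensor_bundle K n).
Local Notation r := (rank V).
Implicit Types u v : psection V.

Lemma jet0P u v :
  jet0 k u = jet0 k v <-> forall i, vanishes k.+1 (u i 0 - v i 0).
Proof.
split=> [E i m Hm|E].
  have := congr1 (fun a : jet k V => a (BMultinom Hm) i 0) E.
  by rewrite !ffunE !mxE /= mcoeffB => ->; rewrite subrr.
apply/ffunP => m; apply/colP => i; rewrite !ffunE !mxE.
by apply/eqP; rewrite -subr_eq0 -mcoeffB E // bmdeg.
Qed.

Lemma taylor_jet0 u i : vanishes k.+1 (taylor (jet0 k u) i 0 - u i 0).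
Proof.
move=> m Hm; rewrite mcoeffB mxE raddf_sum (bigD1 (BMultinom Hm)) //= !ffunE !mxE.
rewrite mcoeffZ mcoeffX eqxx mulr1 big1 ?addr0 ?subrr // => m' ne.
rewrite mcoeffZ mcoeffX; case: eqP => [E|]; last by rewrite mulr0.
by case/eqP: ne; apply: val_inj.
Qed.

Lemma jet0D u v : jet0 k (u + v : psection V) = jet0 k u + jet0 k v.
Proof.
by apply/ffunP => m; apply/colP => i; rewrite !ffunE !mxE mcoeffD.
Qed.

Lemma jet0Z c u : jet0 k (c%:MP *: u : psection V) = c *: jet0 k u.
Proof.
by apply/ffunP => m; apply/colP => i; rewrite !ffunE !mxE mul_mpolyC mcoeffZ.
Qed.

Lemma jet0_sum (I : finType) (u : I -> psection V) :
  jet0 k (\sum_i u i : psection V) = \sum_i jet0 k (u i).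
Proof.
apply/ffunP => m; apply/colP => i; rewrite sum_ffunE !ffunE !mxE !summxE raddf_sum.
by apply: eq_bigr => x _; rewrite ffunE mxE.
Qed.

End Jets.

(** * The action of shears on jets *)

Section Transformations.
Variables (K : fieldType) (n : nat) (V : tensor_bundle K n).
Hypothesis char0 : forall m, m.+1%:R != 0 :> K.
Local Notation r := (rank V).
Local Notation e := (denom_exp V).
Local Notation mpolyR := {mpoly K[n]}.
Local Notation polyC := (mpolyC n (R := K)).

Definition det_power : {mpoly K[n * n]} := (\det (mxvars K n)) ^+ e.

Lemma mmap_det_power (J : 'M[mpolyR]_n) :
  mmap polyC (mxvec J 0) det_power = (\det J) ^+ e.
Proof. by rewrite rmorphXn /= -det_map_mx mmap_mxvars. Qed.

(** Any polynomial sections may stand for the Taylor polynomials of their jets: phi fixes the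
    origin, so composing with it keeps the error in degree > k. *)
Lemma jet_act_intro k (phi : n.-tuple mpolyR) (va vb : psection V) :
  (forall i, vanishes 1 (tnth phi i)) ->
  (forall i, vanishes k.+1 (mmap polyC (mxvec (jacobian phi) 0) det_power *
       (vb i 0 \mPo phi) -
     \sum_j mmap polyC (mxvec (jacobian phi) 0) (numer V i j) * va j 0)) ->
  jet_act phi (jet0 k va) (jet0 k vb).
Proof.
move=> phi0 H; apply/jet0P => i; rewrite -mmap_det_power.
set Q := mmap _ _ det_power; set J := jacobian phi.
set ta := taylor (jet0 k va); set tb := taylor (jet0 k vb).
rewrite mxE [X in _ * X]mxE [X in _ - X]mxE [X in vanishes _ X](_ : _ =
  (Q * (vb i 0 \mPo phi) - \sum_j mmap polyC (mxvec J 0) (numer V i j) * va j 0) +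
  (Q * ((tb i 0 - vb i 0) \mPo phi) -
   \sum_j mmap polyC (mxvec J 0) (numer V i j) * (ta j 0 - va j 0))); last first.
  rewrite comp_mpolyB mulrBr; under [X in _ = _ + (_ - X)]eq_bigr do rewrite mulrBr.
  rewrite sumrB (eq_bigr (fun j => mmap polyC (mxvec J 0) (numer V i j) * ta j 0)).
    by ring.
  by move=> j _; rewrite mxE.
apply: vanishesD => //; apply: vanishesB.
  by apply/vanishesMl/vanishes_comp => //; exact: taylor_jet0.
by apply: vanishes_sum => j _; apply/vanishesMl/taylor_jet0.
Qed.

Section LinearForms.
Variable c : 'I_n -> K.

Definition linform : mpolyR := \sum_i c i *: 'X_i.

Lemma vanishes_linform : vanishes 1 linform.
Proof. by apply: vanishes_sum => i _; apply/vanishesZ/vanishesXU. Qed.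

Lemma vanishes_linformX d : vanishes d (linform ^+ d).
Proof. by rewrite -{1}[d]mul1n; apply/vanishesX/vanishes_linform. Qed.

Lemma mderiv_linform j : linform^`M(j) = (c j)%:MP.
Proof.
rewrite (raddf_sum (mderiv j)) (bigD1 j) //= big1 ?addr0 => [|i ne].
  rewrite mderivZ mderivX mnm1E eqxx scale1r.
  have -> : (U_(j) - U_(j) = 0)%MM by apply/mnmP => i; rewrite mnmBE subnn mnm0E.
  by rewrite mpolyX0 -mul_mpolyC mulr1.
by rewrite mderivZ mderivX mnm1E (negbTE ne) scale0r scaler0.
Qed.

Lemma mderivXn (p : mpolyR) d j : (p ^+ d.+1)^`M(j) = d.+1%:R * p ^+ d * p^`M(j).
Proof.
elim: d => [|d IH]; first by rewrite expr1 expr0 !mul1r.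
by rewrite exprS mderivM IH -[d.+2]addn1 natrD exprS; ring.
Qed.

Variable y : 'I_n -> K.

Definition shear d : n.-tuple mpolyR := [tuple 'X_i + y i *: linform ^+ d | i < n].

Definition rank1_mx : 'M[K]_n := \matrix_(i, j) (y i * c j).

Lemma jacobian_shear d : jacobian (shear d.+1) =
  1%:M + (d.+1%:R * linform ^+ d) *: map_mx polyC rank1_mx.
Proof.
apply/matrixP => i j; rewrite !mxE tnth_mktuple mderivD mderivZ mderivXn mderiv_linform.
congr (_ + _); last by rewrite -mul_mpolyC mpolyCM; ring.
rewrite mderivX mnm1E; have [->|ne] := eqVneq i j; last by rewrite scale0r.
rewrite scale1r; have -> : (U_(j) - U_(j) = 0)%MM by apply/mnmP => l; rewrite mnmBE subnn mnm0E.
exact: mpolyX0.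
Qed.

Lemma vanishes_shear d i : (1 < d)%N -> vanishes 1 (tnth (shear d) i).
Proof.
move=> d1; rewrite tnth_mktuple; apply: vanishesD; first exact: vanishesXU.
by apply/vanishesZ/(vanishesW (ltnW d1))/vanishes_linformX.
Qed.

Lemma shear_leading d i : (1 < d)%N -> vanishes 2 (tnth (shear d) i - 'X_i).
Proof.
move=> d1; rewrite tnth_mktuple addrC addKr.
by apply/vanishesZ/(vanishesW d1)/vanishes_linformX.
Qed.

Lemma jacobian0_shear d : (0 < d)%N -> jacobian0 (shear d.+1) = 1%:M.
Proof.
move=> d0; apply/matrixP => i j; rewrite mxE jacobian_shear !mxE mcoeffD.
have v1 q : vanishes 1 (d.+1%:R * linform ^+ d * q).
  by apply/vanishesMr/vanishesMl/(vanishesW d0)/vanishes_linformX.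
rewrite v1 ?mdeg0 // addr0; by case: eqP => _; rewrite ?mcoeff1 ?mcoeff0 // eqxx.
Qed.

Lemma msize_linform : (msize linform <= 2)%N.
Proof.
apply: leq_trans (mmeasure_sum _ _ _ _) _; apply/bigmax_leqP => i _.
by apply: leq_trans (msizeZ_le _ _) _; rewrite msizeX mdeg1.
Qed.

Lemma msize_linformX d : (msize (linform ^+ d) <= d.+1)%N.
Proof.
elim: d => [|d IH]; first by rewrite expr0 msize1.
rewrite exprS; have [->|p0] := eqVneq linform 0; first by rewrite mul0r mmeasure0.
rewrite msizeM ?expf_neq0 //.
by move: (leq_add msize_linform IH); case: (_ + _)%N.
Qed.

Lemma diffeo_jet_shear k d : (0 < d)%N -> (d <= k)%N -> diffeo_jet k.+1 (shear d.+1).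
Proof.
move=> d0 dk; split=> [i|]; last by rewrite jacobian0_shear // unitmx1.
split; first by apply: (vanishes_shear (d := d.+1)); rewrite ?mdeg0.
rewrite tnth_mktuple; apply: leq_trans (msizeD_le _ _) _; rewrite geq_max.
rewrite msizeX mdeg1 ltnS /=; apply: leq_trans (msizeZ_le _ _) _.
by apply: leq_trans (msize_linformX _) _; rewrite !ltnS.
Qed.

Lemma shear_linform d :
  linform \mPo (shear d) = linform + (\sum_i c i * y i) *: linform ^+ d.
Proof.
rewrite {1}/linform raddf_sum /= (eq_bigr (fun i => c i *: 'X_i + (c i * y i) *: linform ^+ d)).
  by rewrite big_split -scaler_suml.
by move=> i _; rewrite comp_mpolyZ comp_mpolyXU -tnth_nth tnth_mktuple scalerDr scalerA.
Qed.

Local Notation pt := (fun a => mxvec (1%:M : 'M[K]_n) 0 a).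
Local Notation dr E := (dir pt (fun a => mxvec (E : 'M[K]_n) 0 a)).

Lemma mmap_jacobian_shear d p : exists q,
  mmap polyC (mxvec (jacobian (shear d.+1)) 0) p =
  (p.@[pt])%:MP + (d.+1%:R * linform ^+ d) * (dr rank1_mx p)%:MP +
  (d.+1%:R * linform ^+ d) ^+ 2 * q.
Proof.
rewrite jacobian_shear; set t := _ * _.
have [q Eq] := mmap_taylor pt (fun a => mxvec rank1_mx 0 a) polyC t p.
exists q; rewrite -Eq; apply: eq_mmap => a.
case/mxvec_indexP: a => i j; rewrite !mxvecE !mxE.
by congr (_ + _); case: eqP; rewrite ?mpolyC1 ?mpolyC0.
Qed.

Lemma mmap_jacobian_det d : exists q,
  mmap polyC (mxvec (jacobian (shear d.+1)) 0) det_power =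
  1 + (d.+1%:R * linform ^+ d) * (dr rank1_mx det_power)%:MP +
  (d.+1%:R * linform ^+ d) ^+ 2 * q.
Proof.
have [q ->] := mmap_jacobian_shear d det_power; exists q.
by rewrite rmorphXn /= meval_det_mxvars det1 expr1n mpolyC1.
Qed.

(** The terms of second order in eta have degree at least s + 2 d, which exceeds s + d. *)
Lemma linform_perturb_power s d eta : (0 < d)%N ->
  vanishes (s + d).+1 ((linform + eta *: linform ^+ d.+1) ^+ s -
    (linform ^+ s + (s%:R * eta) *: linform ^+ (s + d))).
Proof.
move=> d0; elim: s => [|s IH].
  by rewrite !expr0 mul0r scale0r addr0 subrr; apply: vanishes_zero.
set x := linform; set z := x + _; set A := z ^+ s - _ in IH.
have -> : z ^+ s.+1 - (x ^+ s.+1 + (s.+1%:R * eta) *: x ^+ (s.+1 + d)) =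
    z * A + (s%:R * eta ^+ 2) *: (x ^+ d * x ^+ (s.+1 + d)).
  rewrite /A /z -!mul_mpolyC !mpolyCM -[s.+1]addn1 natrD !rmorphD /= mpolyC1.
  by rewrite addn1 !(exprD, exprS); ring.
apply: vanishesD.
  rewrite addSn -add1n; apply: vanishesM => //; apply: vanishesD.
    exact: vanishes_linform.
  by apply/vanishesZ/(vanishesW (ltn0Sn d))/vanishes_linformX.
apply/vanishesZ/(@vanishesM _ _ 1); last exact: vanishes_linformX.
exact/(vanishesW d0)/vanishes_linformX.
Qed.

(** Differential of [rho V] at 1 in the direction E, by the quotient rule: at 1 the numerators form
    the identity matrix and the denominator is 1. *)
Definition drho (E : 'M[K]_n) : 'M[K]_r :=
  \matrix_(i, j) (dr E (numer V i j) - (i == j)%:R * dr E det_power).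

Definition psec (p : mpolyR) (v : fibre V) : psection V := \col_i (v i 0 *: p).

Lemma numer_pt i j : (numer V i j).@[pt] = (i == j)%:R.
Proof.
have := congr1 (fun A : 'M_r => A i j) (rational_action1 V).
by rewrite /rational_action det1 expr1n invr1 scale1r !mxE.
Qed.

Section Theta.
Variables (d : nat) (d0 : (0 < d)%N).
Let phi := shear d.+1.
Let Q := mmap polyC (mxvec (jacobian phi) 0) det_power.
Let Theta w := Q * (w \mPo phi).

(** Theta is the left-hand side of [jet_act] on one component. As it differs from the identity by a
    map that raises the order, it is bijective modulo each power of the maximal ideal; [theta_surj]
    and [theta_inj] say this. *)
Lemma theta_leading m w : vanishes m w -> vanishes m.+1 (Theta w - w).
Proof.
move=> Hw; rewrite /Theta.
have -> : Q * (w \mPo phi) - w = Q * ((w \mPo phi) - w) + (Q - 1) * w by ring.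
apply: vanishesD.
  by apply/vanishesMl/comp_leading => // i; apply: shear_leading.
rewrite -add1n; apply: vanishesM => //; have [q Eq] := mmap_jacobian_det d.
rewrite /Q /phi Eq -[X in vanishes _ (X - 1)]addrA [1 + _]addrC addrK expr2.
have v1 p : vanishes 1 (d.+1%:R * linform ^+ d * p).
  by apply/vanishesMr/vanishesMl/(vanishesW d0)/vanishes_linformX.
by apply: vanishesD => //; rewrite -mulrA.
Qed.

Lemma thetaD w w' : Theta (w + w') = Theta w + Theta w'.
Proof. by rewrite /Theta comp_mpolyD mulrDr. Qed.

Lemma thetaB w w' : Theta (w - w') = Theta w - Theta w'.
Proof. by rewrite /Theta comp_mpolyB mulrBr. Qed.

Lemma theta_surj f m : exists w, vanishes m (Theta w - f).
Proof.
elim: m => [|m [w Hw]]; first by exists 0; apply: vanishes0.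
exists (w + (f - Theta w)).
have -> : Theta (w + (f - Theta w)) - f = Theta (f - Theta w) - (f - Theta w).
  by rewrite thetaD; ring.
by apply: theta_leading; rewrite -opprB; apply: vanishesN.
Qed.

Lemma theta_inj m w : vanishes m (Theta w) -> vanishes m w.
Proof.
move=> Hm; suff H j : (j <= m)%N -> vanishes j w by apply: (H m).
elim: j => [|j IH] jm; first exact: vanishes0.
have -> : w = Theta w - (Theta w - w) by ring.
apply: vanishesB; first exact: vanishesW Hm.
by apply/theta_leading/IH/ltnW.
Qed.

Variables (W : tensor_bundle K n) (k : nat) (delta : {linear jet k V -> fibre W}).
Hypothesis nat_delta : natural delta.

Lemma rho1 (U : tensor_bundle K n) : rho U 1%:M = 1%:M.
Proof. exact: rational_action1. Qed.

(* The constant-coefficient jet x^s v is moved by the shear to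
   x^s v + x^(s+d) ((d+1) drho(y (x) c) v - s c(y) v) + higher terms. *)
Lemma shear_invariance s (v : fibre V) : (s + d <= k)%N -> order_le delta (s + d) ->
  delta (jet0 k (psec (linform ^+ (s + d))
    (d.+1%:R *: (drho rank1_mx *m v) - (s%:R * \sum_i c i * y i) *: v))) = 0.
Proof.
move=> le_k ord; set eta := \sum_i _; set u := _ - _; set l := (s + d)%N.
set x := linform.
pose va := psec (x ^+ s) v.
pose f i : mpolyR := \sum_j mmap polyC (mxvec (jacobian phi) 0) (numer V i j) * va j 0.
(* The transformed section vb is only known to exist; b' below is its expected expansion up to
   degree l. *)
have /fin_all_exists[wb Hwb] i := theta_surj (f i) k.+1.
pose vb : psection V := \col_i wb i.
pose b' : psection V := va + psec (x ^+ l) u.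
have act : jet_act phi (jet0 k va) (jet0 k vb).
  apply: jet_act_intro => i; first by apply: vanishes_shear.
  by rewrite mxE; apply: Hwb.
have := nat_delta (diffeo_jet_shear d0 (leq_trans (leq_addl s d) le_k)) act.
rewrite jacobian0_shear // rho1 mul1mx => E1.
have claim i : vanishes l.+1 (Theta (b' i 0) - f i).
  have [q EQ] := mmap_jacobian_det d; have [q' EP] := fin_all_exists (fun j =>
    mmap_jacobian_shear d (numer V i j)).
  set t := d.+1%:R * linform ^+ d in EQ EP; set a := dr rank1_mx det_power in EQ.
  pose S := \sum_j dr rank1_mx (numer V i j) * v j 0; pose T := \sum_j q' j * (v j 0)%:MP.
  have uE : u i 0 = d.+1%:R * (S - a * v i 0) - s%:R * eta * v i 0.
    rewrite !mxE; congr (_ * _ - _); under eq_bigr do rewrite mxE mulrBl.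
    rewrite sumrB; congr (_ - _); rewrite (bigD1 i) //= eqxx mul1r big1 ?addr0 // => j.
    by rewrite eq_sym => /negbTE->; rewrite !mul0r.
  have fE : f i = (v i 0)%:MP * x ^+ s + t * x ^+ s * S%:MP + t ^+ 2 * x ^+ s * T.
    rewrite /f /phi; under eq_bigr do rewrite EP numer_pt mxE -mul_mpolyC !mulrDl.
    rewrite !big_split /=; congr (_ + _ + _).
    - rewrite (bigD1 i) //= eqxx mpolyC1 mul1r big1 ?addr0 // => j.
      by rewrite eq_sym => /negbTE->; rewrite mpolyC0 mul0r.
    - have -> : S%:MP = \sum_j (dr rank1_mx (numer V i j))%:MP * (v j 0)%:MP :> mpolyR.
        by rewrite /S raddf_sum; apply: eq_bigr => j _; rewrite /= mpolyCM.
      rewrite mulr_sumr; apply: eq_bigr => j _; ring.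
    - rewrite mulr_sumr; apply: eq_bigr => j _; ring.
  pose Bs := (x ^+ s \mPo phi) - (x ^+ s + (s%:R * eta) *: x ^+ l).
  pose Bl := (x ^+ l \mPo phi) - x ^+ l.
  have vBs : vanishes l.+1 Bs.
    by rewrite /Bs rmorphXn /= shear_linform; apply: linform_perturb_power.
  have vBl : vanishes l.+1 Bl.
    by apply: comp_leading; [move=> j; apply: shear_leading | exact: vanishes_linformX].
  have -> : Theta (b' i 0) - f i =
      Q * ((v i 0)%:MP * Bs + (u i 0)%:MP * Bl) +
      t * x ^+ l * ((a * (v i 0 * (s%:R * eta) + u i 0))%:MP +
        t * q * (v i 0 * (s%:R * eta) + u i 0)%:MP) +
      t ^+ 2 * x ^+ s * (q * (v i 0)%:MP - T).
    rewrite fE /Theta mxE [va i 0]mxE [psec _ u i 0]mxE comp_mpolyD !comp_mpolyZ.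
    have -> : x ^+ s \mPo phi = Bs + (x ^+ s + (s%:R * eta) *: x ^+ l) by rewrite subrK.
    have -> : x ^+ l \mPo phi = Bl + x ^+ l by rewrite subrK.
    have EQ' : Q = 1 + t * a%:MP + t ^+ 2 * q by exact: EQ.
    rewrite EQ' -!mul_mpolyC uE /t /l exprD; move: Bs Bl vBs vBl => Bs Bl _ _.
    move: (x ^+ s) => X; rewrite -/x; move: (x ^+ d) => Y.
    rewrite !(mpolyCM, mpolyCD, mpolyCN, mpolyCB, mpolyC_nat).
    by ring.
  have vt : vanishes d t by apply/vanishesMl/vanishes_linformX.
  have vx m : vanishes m (x ^+ m) by apply: vanishes_linformX.
  apply: vanishesD; last first.
    (* The terms with t^2 have order at least 2 d + s, which exceeds l because d > 0. *)
    apply/vanishesMr; rewrite expr2 -mulrA; apply: (@vanishesW _ _ (d + (d + s))).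
      by rewrite /l [(d + s)%N]addnC -add1n leq_add2r.
    by apply: vanishesM => //; apply: vanishesM.
  apply: vanishesD.
    by apply/vanishesMl/vanishesD; apply/vanishesMl.
  by apply/vanishesMr; rewrite -add1n; apply: vanishesM => //; apply: vanishesW vt.
(* By the bound on its order, delta does not see beyond degree l, up to which vb and b' agree. *)
have E2 : delta (jet0 k vb) = delta (jet0 k b').
  apply: ord => m Hm; apply/colP => i; rewrite !ffunE [LHS]mxE [RHS]mxE.
  apply/eqP; rewrite -subr_eq0 -mcoeffB; apply/eqP.
  suff H : vanishes l.+1 (vb i 0 - b' i 0) by apply: H; rewrite ltnS.
  apply: theta_inj; rewrite thetaB mxE.
  have -> : Theta (wb i) - Theta (b' i 0) = (Theta (wb i) - f i) - (Theta (b' i 0) - f i) by ring.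
  by apply: vanishesB => //; apply: vanishesW (Hwb i).
move: E1; rewrite E2 jet0D linearD => /eqP; rewrite -subr_eq0 addrAC subrr add0r.
by move/eqP.
Qed.

End Theta.
End LinearForms.
End Transformations.

(** * Positive order is order one *)

Section NaturalOrder.
Variables (K : fieldType) (n k : nat) (V W : tensor_bundle K n).
Hypothesis char0 : forall m, m.+1%:R != 0 :> K.
Variable delta : {linear jet k V -> fibre W}.
Hypothesis nat_delta : natural delta.
Local Notation mpolyR := {mpoly K[n]}.
Local Notation polyC := (mpolyC n (R := K)).

Definition on_germ (p : mpolyR) (v : fibre V) : fibre W := delta (jet0 k (psec p v)).

Lemma on_germ_linear p : linear (on_germ p).
Proof.
move=> c u v; rewrite /on_germ -linearP -jet0Z -jet0D; congr (delta (jet0 k _)).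
by apply/colP => i; rewrite !mxE mul_mpolyC scalerA scalerDl.
Qed.

Lemma on_germZv p c v : on_germ p (c *: v) = c *: on_germ p v.
Proof.
have E0 : on_germ p 0 = 0.
  have := on_germ_linear p 1 0 0; rewrite !scale1r addr0 => /eqP.
  by rewrite -subr_eq0 opprD addNKr oppr_eq0 => /eqP.
by have := on_germ_linear p c v 0; rewrite !addr0 E0 addr0.
Qed.

Lemma on_germDv p u v : on_germ p (u + v) = on_germ p u + on_germ p v.
Proof. by have := on_germ_linear p 1 u v; rewrite !scale1r. Qed.

Lemma on_germ_sumv p (I : finType) (F : I -> fibre V) :
  on_germ p (\sum_i F i) = \sum_i on_germ p (F i).
Proof.
have E0 : on_germ p 0 = 0 by rewrite -(scale0r 0) on_germZv scale0r.
exact: (big_morph _ (on_germDv p) E0).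
Qed.

Lemma on_germ_sump (I : finType) (c : I -> K) (p : I -> mpolyR) v :
  on_germ (\sum_i c i *: p i) v = \sum_i c i *: on_germ (p i) v.
Proof.
have E : psec (\sum_i c i *: p i) v = \sum_i (c i)%:MP *: psec (p i) v :> psection V.
  apply/colP => i; rewrite !mxE summxE scaler_sumr; apply: eq_bigr => j _.
  by rewrite !mxE mul_mpolyC !scalerA mulrC.
rewrite /on_germ E jet0_sum linear_sum; apply: eq_bigr => i _.
by rewrite jet0Z linearZ.
Qed.

Lemma order_le_jet : order_le delta k.
Proof.
by move=> a b E; congr (delta _); apply/ffunP => m; apply: E; rewrite -ltnS bmdeg.
Qed.

Lemma linform_power l (c : 'I_n -> K) : linform c ^+ l =
  \sum_(w : l.-tuple 'I_n) (\prod_i c (tnth w i)) *: 'X_[wmon w].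
Proof.
rewrite -[in LHS](card_ord l) -prodr_const prod_sum_tuple; apply: eq_bigr => w _.
by rewrite mpolyX_wmon scaler_prod.
Qed.

Section HighOrder.
Variable l : nat.
Hypothesis le_lk : (l.+2 <= k)%N.
Hypothesis ord_l : order_le delta l.+2.

(** The shear with s = 0 and d = l + 2 shows that the [drho] term is killed; the one with s = l + 1
    and d = 1 then leaves - (l + 1) x^(l+2) v, for y chosen with c(y) = 1. *)
Lemma on_germ_power (c : 'I_n -> K) v : on_germ (linform c ^+ l.+2) v = 0.
Proof.
have [/existsP[i ci]|c0] := boolP [exists i, c i != 0]; last first.
  have -> : linform c = 0.
    apply: big1 => i _; move: c0; rewrite negb_exists => /forallP/(_ i).
    by rewrite negbK => /eqP->; rewrite scale0r.
  by have := on_germ_sump (fun _ : 'I_0 => 0) (fun=> 0) v; rewrite !big_ord0 expr0n.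
pose y j : K := (j == i)%:R / c i.
have cy : \sum_j c j * y j = 1.
  rewrite (bigD1 i) //= /y eqxx mul1r mulfV // big1 ?addr0 // => j /negbTE->.
  by rewrite mul0r mulr0.
have E1 : on_germ (linform c ^+ l.+2) (drho V (rank1_mx c y) *m v) = 0.
  have := shear_invariance c y (isT : (0 < l.+2)%N) nat_delta (s := 0) v le_lk ord_l.
  rewrite mul0r scale0r subr0 -/(on_germ _ _) add0n on_germZv => /eqP.
  by rewrite scaler_eq0 (negbTE (char0 _)) => /eqP.
have := shear_invariance c y (isT : (0 < 1)%N) nat_delta (s := l.+1) v.
rewrite addn1 cy mulr1 => /(_ le_lk ord_l); rewrite -/(on_germ _ _) -scaleNr on_germDv.
rewrite !on_germZv E1 scaler0 add0r => /eqP.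
by rewrite scaler_eq0 oppr_eq0 (negbTE (char0 _)) => /eqP.
Qed.

(** The value on the power of a linear form c is a polynomial in c whose coefficients are the values
    on monomials, each repeated once for every word spelling the monomial. *)
Lemma on_germ_monomial (m : 'X_{1..n}) v : mdeg m = l.+2 -> on_germ 'X_[m] v = 0.
Proof.
move=> Hm; apply/colP => o; rewrite [RHS]mxE.
pose F (w : l.+2.-tuple 'I_n) := on_germ 'X_[wmon w] v o 0.
have S0 : \sum_w F w *: 'X_[wmon w] = 0 :> mpolyR.
  apply: (mpoly_vanish char0) => c; rewrite raddf_sum /=.
  have := congr1 (fun u : 'cV_ _ => u o 0) (on_germ_power c v).
  rewrite linform_power on_germ_sump summxE [RHS]mxE => E; rewrite -[RHS]E.
  apply: eq_bigr => w _; rewrite mevalZ mxE mulrC; congr (_ * _).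
  by rewrite mpolyX_wmon rmorph_prod; apply: eq_bigr => i _; rewrite /= mevalXU.
have := monomial_sum0 (fun m' => (m' == m)%:R) S0.
rewrite (bigID (fun w => wmon w == m)) /= [X in _ + X]big1 ?addr0; last first.
  by move=> w /negbTE->; rewrite mulr0.
rewrite (eq_bigr (fun=> on_germ 'X_[m] v o 0)) => [|w /eqP Ew]; last first.
  by rewrite /F Ew eqxx mulr1.
have : (0 < #|[pred w : l.+2.-tuple 'I_n | wmon w == m]|)%N.
  by have [w Ew] := wmon_surj Hm; apply/card_gt0P; exists w; rewrite inE Ew.
rewrite sumr_const -(mulr_natr (on_germ _ _ _ _)); set N := #|_| => N0 /eqP.
by rewrite mulf_eq0 -(prednK N0) (negbTE (char0 _)) orbF => /eqP.
Qed.

Lemma order_drop : order_le delta l.+1.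
Proof.
move=> a b Eab; apply/eqP; rewrite -subr_eq0 -linearB; apply/eqP.
pose c := a - b.
have cE (m : 'X_{1..n < k.+1}) : (mdeg m <= l.+1)%N -> c m = 0.
  by move=> Hm; rewrite !ffunE Eab // subrr.
pose c' : jet k V := \sum_(m : 'X_{1..n < k.+1} | mdeg m == l.+2) jet0 k (psec 'X_[m] (c m)).
rewrite (ord_l (b := c')) => [|m Hm].
  rewrite /c' linear_sum big1 // => m /eqP Hm; exact: on_germ_monomial.
rewrite sum_ffunE; apply/colP => i; rewrite summxE.
have termE (m' : 'X_{1..n < k.+1}) : jet0 k (psec 'X_[m'] (c m')) m i 0 = c m' i 0 * (m' == m)%:R.
  by rewrite ffunE !mxE mcoeffZ mcoeffX.
under eq_bigr do rewrite termE.
have [Em|ne] := eqVneq (mdeg m) l.+2.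
  rewrite (bigD1 m) ?Em //= eqxx mulr1 big1 ?addr0 // => m' /andP[_ /negbTE->].
  by rewrite mulr0.
rewrite big1 => [|m' /eqP Hm'].
  by rewrite cE ?mxE // -ltnS ltn_neqAle ne.
by case: eqP => [E|]; [rewrite -Hm' E eqxx in ne | rewrite mulr0].
Qed.

End HighOrder.

Lemma natural_order_one l : has_order delta l -> (0 < l)%N ->
  (0 < k)%N /\ order_le delta 1.
Proof.
move=> [ord_l min_l] l0; have le_lk := min_l _ order_le_jet.
case: l l0 ord_l min_l le_lk => [|[|l]] // _ ord_l min_l le_lk.
by have := min_l _ (order_drop le_lk ord_l); rewrite ltnn.
Qed.

End NaturalOrder.

(** * Taylor coefficients at an arbitrary point *)

Section Translation.
Variables (K : fieldType) (n : nat) (z : 'cV[K]_n).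
Implicit Types p : {mpoly K[n]}.

Let tr : n.-tuple {mpoly K[n]} := [tuple 'X_i + (z i 0)%:MP | i < n].

Lemma mcoeff0_translate p : (p \mPo tr)@_0%MM = p.@[fun i => z i 0].
Proof.
have mcoeff0E q : q@_0%MM = q.@[fun=> 0] :> K.
  rewrite mevalE; have [q0|q0] := boolP (0%MM \in msupp q).
    rewrite (bigD1_seq 0%MM) ?msupp_uniq //= big1 => [|i _]; last by rewrite mnm0E expr0.
    rewrite mulr1 big1 ?addr0 // => m; rewrite -mdeg_eq0 mdegE sum_nat_eq0 negb_forall.
    case/existsP=> i /= mi; rewrite (bigD1 i) //= expr0n.
    by rewrite (negbTE mi) mul0r mulr0.
  rewrite memN_msupp_eq0 // big_seq big1 // => m Hm.
  have : m != 0%MM by apply: contraNneq q0 => <-.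
  rewrite -mdeg_eq0 mdegE sum_nat_eq0 negb_forall.
  case/existsP=> i /= mi; rewrite (bigD1 i) //= expr0n.
  by rewrite (negbTE mi) mul0r mulr0.
rewrite mcoeff0E comp_mpoly_meval; apply: meval_eq => i.
by rewrite tnth_mktuple mevalD mevalXU mevalC add0r.
Qed.

Lemma mderiv_translate p i : (p \mPo tr)^`M(i) = p^`M(i) \mPo tr.
Proof.
pose Q q := (q \mPo tr)^`M(i) = q^`M(i) \mPo tr.
have QM p1 p2 : Q p1 -> Q p2 -> Q (p1 * p2).
  by rewrite /Q => E1 E2; rewrite rmorphM /= !mderivM comp_mpolyD E1 E2 !rmorphM.
have QC x : Q x%:MP by rewrite /Q comp_mpolyC !mderivC comp_mpoly0.
have QX m : Q 'X_[m].
  rewrite mpolyXE_id; apply: big_ind => //; first by have := QC 1; rewrite mpolyC1.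
  move=> a _; elim: (m a) => [|e IH]; first by have := QC 1; rewrite mpolyC1.
  rewrite exprS; apply: QM => //; rewrite /Q comp_mpolyXU -tnth_nth tnth_mktuple.
  rewrite mderivD mderivC addr0 mderivX mnm1E.
  have [<-|_] := eqVneq a i; last by rewrite !scale0r comp_mpoly0.
  have -> : (U_(a) - U_(a) = 0)%MM by apply/mnmP => j; rewrite mnmBE subnn mnm0E.
  by rewrite scale1r mpolyX0 comp_mpoly1.
elim/mpolyind: p => [|x m q _ _ IH]; first by have := QC 0; rewrite mpolyC0.
by rewrite comp_mpolyD !mderivD comp_mpolyD IH -!mul_mpolyC (QM _ _ (QC x) (QX m)).
Qed.

Lemma mcoeff1_translate p i : (p \mPo tr)@_U_(i) = p^`M(i).@[fun j => z j 0].
Proof.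
by rewrite -mcoeff0_translate -mderiv_translate mcoeff_deriv add0m mnm0E.
Qed.

End Translation.

(** * The symbols of orders zero and one *)

Section FirstOrderNatural.
Variables (K : fieldType) (n k : nat) (V W : tensor_bundle K n).
Hypothesis char0 : forall m, m.+1%:R != 0 :> K.
Variable delta : {linear jet k V -> fibre W}.
Hypothesis nat_delta : natural delta.
Local Notation mpolyR := {mpoly K[n]}.
Local Notation polyC := (mpolyC n (R := K)).
Local Notation germ := (on_germ delta).

Definition linear_tuple (g : 'M[K]_n) : n.-tuple mpolyR :=
  [tuple \sum_j g i j *: 'X_j | i < n].

Lemma mmap_mpolyC N (h : 'I_N -> K) p : mmap polyC (fun a => (h a)%:MP) p = (p.@[h])%:MP.
Proof.
rewrite mevalE /mmap raddf_sum; apply: eq_bigr => m _ /=.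
rewrite mpolyCM /mmap1 rmorph_prod; congr (_ * _).
by apply: eq_bigr => i _; rewrite rmorphXn.
Qed.

Lemma jacobian_linear g : jacobian (linear_tuple g) = map_mx polyC g.
Proof.
apply/matrixP => i j; rewrite !mxE tnth_mktuple.
exact: (mderiv_linform (fun j => g i j) j).
Qed.

(** Linear maps are diffeomorphisms with constant Jacobian g. Giving p as a pullback of p' avoids
    composition with g^-1. *)
Lemma germ_equivariant g p p' v : g \in unitmx -> p' \mPo linear_tuple g = p ->
  germ p' (rho V g *m v) = rho W g *m germ p v.
Proof.
move=> Ug Ep.
have J0 : jacobian0 (linear_tuple g) = g.
  by rewrite /jacobian0 jacobian_linear; apply/matrixP => i j; rewrite !mxE mcoeffC eqxx mulr1.
have diffeo : diffeo_jet k.+1 (linear_tuple g).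
  split=> [i|]; last by rewrite J0.
  rewrite tnth_mktuple; split; last by apply: leq_trans (msize_linform (fun j => g i j)) _.
  by apply: (vanishes_linform (fun j => g i j)); rewrite mdeg0.
have E : mxvec (jacobian (linear_tuple g)) 0 =1 fun a => (mxvec g 0 a)%:MP.
  by rewrite jacobian_linear; case/mxvec_indexP => i j; rewrite !mxvecE mxE.
have act : jet_act (linear_tuple g) (jet0 k (psec p v)) (jet0 k (psec p' (rho V g *m v))).
  apply: jet_act_intro => i.
    by rewrite tnth_mktuple; apply: (vanishes_linform (fun j => g i j)).
  rewrite (eq_mmap _ _ E) mmap_mpolyC !mxE comp_mpolyZ Ep.
  under [X in _ - X]eq_bigr do rewrite (eq_mmap _ _ E) mmap_mpolyC mxE -mul_mpolyC mulrA -mpolyCM.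
  rewrite -mul_mpolyC mulrA -mpolyCM -mulr_suml -(raddf_sum (mpolyC n (R := K))) -mulrBl -mpolyCB.
  rewrite rmorphXn /= meval_det_mxvars mulr_sumr.
  rewrite [X in X%:MP](_ : _ = 0) ?mpolyC0 ?mul0r; first exact: vanishes_zero.
  apply/eqP; rewrite subr_eq0; apply/eqP; apply: eq_bigr => j _; rewrite !mxE mulrA mulVKf //.
  by rewrite expf_neq0 // -unitfE -unitmxE.
by rewrite /germ (nat_delta diffeo act) J0.
Qed.

Definition symbol0 : fibre V -> fibre W := germ 1.
Definition symbol1 (i : 'I_n) : fibre V -> fibre W := germ 'X_i.

Lemma symbol0_equivariant g v : g \in unitmx ->
  symbol0 (rho V g *m v) = rho W g *m symbol0 v.
Proof. by move=> Ug; apply: germ_equivariant; rewrite ?comp_mpoly1. Qed.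

Lemma symbol1_equivariant g i v : g \in unitmx ->
  symbol1 i (rho V g *m v) = rho W g *m \sum_j g i j *: symbol1 j v.
Proof.
move=> Ug; rewrite -on_germ_sump; apply: germ_equivariant => //.
by rewrite comp_mpolyXU -tnth_nth tnth_mktuple.
Qed.

Hypothesis k0 : (0 < k)%N.
Hypothesis ord1 : order_le delta 1.

(** The quadratic shear applied to a constant section; this is the source of [jet_invariant]. *)
Lemma symbol1_drho (c y : 'I_n -> K) v :
  \sum_i c i *: symbol1 i (drho V (rank1_mx c y) *m v) = 0.
Proof.
have := shear_invariance c y (isT : (0 < 1)%N) nat_delta (s := 0) v k0 ord1.
rewrite mul0r scale0r subr0 -/(on_germ _ _ _) on_germZv => /eqP.
by rewrite scaler_eq0 (negbTE (char0 _)) expr1 on_germ_sump => /eqP.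
Qed.

Lemma first_order_formula (u : psection V) :
  delta (jet0 k u) = symbol0 (\col_i (u i 0)@_0%MM) +
    \sum_j symbol1 j (\col_i (u i 0)@_U_(j)).
Proof.
rewrite /symbol0 /symbol1 /on_germ -linear_sum -linearD -jet0_sum -jet0D.
apply: ord1 => m Hm; rewrite !ffunE; apply/colP => i; rewrite !mxE summxE mcoeffD.
rewrite raddf_sum mcoeffZ /=; under eq_bigr do rewrite !mxE mcoeffZ mcoeffX.
case: (posnP (mdeg m)) => [/eqP|m0].
  rewrite mdeg_eq0 => /eqP E; rewrite E mcoeff1 eqxx mulr1 big1 ?addr0 // => j _.
  by rewrite mnm1_eq0 mulr0.
have /eqP/mdeg1P[j /eqP Ej] : mdeg m = 1%N by apply/eqP; rewrite eqn_leq Hm.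
rewrite Ej mcoeff1 mnm1_eq0 mulr0 add0r (bigD1 j) //= eqxx mulr1 big1 ?addr0 // => j' ne.
by rewrite eq_mnm1 (negbTE ne) mulr0.
Qed.

Lemma first_order_jet_at (u : psection V) z :
  delta (jet_at k z u) = symbol0 (\col_i (u i 0).@[fun a => z a 0]) +
    \sum_j symbol1 j (\col_i (u i 0)^`M(j).@[fun a => z a 0]).
Proof.
rewrite first_order_formula; congr (symbol0 _ + _).
  by apply/colP => i; rewrite !mxE mcoeff0_translate.
apply: eq_bigr => j _; congr symbol1; apply/colP => i.
by rewrite !mxE mcoeff1_translate.
Qed.

End FirstOrderNatural.

(** * Symbols in components *)

Section Infinitesimal.
Variables (K : fieldType) (n : nat).
Local Notation idx d := (d.-tuple 'I_n).
Local Notation pt := (fun a => mxvec (1%:M : 'M[K]_n) 0 a).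
Local Notation dr E := (dir pt (fun a => mxvec (E : 'M[K]_n) 0 a)).

Lemma meval_gpow_pt p (a c : idx p) : (gpow (mxvars K n) a c).@[pt] = (a == c)%:R.
Proof. by rewrite gpow_mxvars meval_gpow gpow1. Qed.

Lemma dir_gpow_cons E p k l (a c : idx p) :
  dr E (gpow (mxvars K n) [tuple of k :: a] [tuple of l :: c]) =
  E k l * (a == c)%:R + (k == l)%:R * dr E (gpow (mxvars K n) a c).
Proof.
rewrite gpow_cons dirM meval_gpow_pt mxE dirXU mevalXU !mxvecE; congr (_ + _ * _).
by rewrite mxE.
Qed.

(** Leibniz rule: the derivative of a tensor power at 1 acts on one slot at a time. [sum_dir_gpowr]
    is the transposed form, used for lower indices. *)
Lemma sum_dir_gpowl E p (c : idx p) (F : idx p -> K) :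
  \sum_a dr E (gpow (mxvars K n) a c) * F a =
  \sum_t \sum_k E k (tnth c t) * F (upd c t k).
Proof.
elim: p c F => [|p IH] c F.
  by rewrite sum_tuple0 big_ord0 /gpow big_ord0 -mpolyC1 dirC mul0r.
case/tupleP: c => l c; rewrite sum_tcons big_ord_recl.
under eq_bigr do under eq_bigr do rewrite dir_gpow_cons mulrDl -!mulrA.
under eq_bigr do rewrite big_split /= -!mulr_sumr sum_eql.
rewrite big_split /= sum_eql IH; congr (_ + _).
  by apply: eq_bigr => k _; rewrite tnth0 upd_cons0.
by apply: eq_bigr => t _; apply: eq_bigr => k _; rewrite tnthS upd_consS.
Qed.

Lemma sum_dir_gpowr E p (d : idx p) (F : idx p -> K) :
  \sum_b dr E (gpow (mxvars K n) d b) * F b =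
  \sum_t \sum_j E (tnth d t) j * F (upd d t j).
Proof.
elim: p d F => [|p IH] d F.
  by rewrite sum_tuple0 big_ord0 /gpow big_ord0 -mpolyC1 dirC mul0r.
case/tupleP: d => l d; rewrite sum_tcons big_ord_recl.
under eq_bigr do under eq_bigr do
  rewrite dir_gpow_cons mulrDl -!mulrA [l == _]eq_sym [d == _]eq_sym.
under eq_bigr do rewrite big_split /= -!mulr_sumr sum_eql.
rewrite big_split /= sum_eql IH; congr (_ + _).
  by apply: eq_bigr => k _; rewrite tnth0 upd_cons0.
by apply: eq_bigr => t _; apply: eq_bigr => k _; rewrite tnthS upd_consS.
Qed.

Lemma quadratic_form0 (beta : 'I_n -> 'I_n -> K) :
  (forall c : 'I_n -> K, \sum_i \sum_j c i * c j * beta i j = 0) ->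
  forall i j, beta i j + beta j i = 0.
Proof.
move=> H i j; pose B (c c' : 'I_n -> K) := \sum_i \sum_j c i * c' j * beta i j.
pose d (k l : 'I_n) : K := (l == k)%:R.
have Bd k l : B (d k) (d l) = beta k l.
  rewrite /B; under eq_bigr do under eq_bigr do rewrite -mulrA.
  by under eq_bigr do rewrite -mulr_sumr sum_eql; rewrite sum_eql.
have BD c c' : B (fun k => c k + c' k) (fun k => c k + c' k) =
    B c c + B c c' + (B c' c + B c' c').
  rewrite /B -!big_split; apply: eq_bigr => k _; rewrite -!big_split.
  by apply: eq_bigr => l _ /=; ring.
have := H (fun k => d i k + d j k); rewrite -/(B _ _) BD !Bd.
have Bii k : beta k k = 0 by rewrite -Bd; apply: H.
by rewrite !Bii add0r addr0.
Qed.

End Infinitesimal.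

(** * Components with respect to a summand of tensors *)

Section Summands.
Variables (K : fieldType) (n : nat) (V : tensor_bundle K n) (i : summand V).
Hypothesis char0 : forall m, m.+1%:R != 0 :> K.
Variable a : 'I_(nfactors i).
Local Notation p := (@upper K n V i a).
Local Notation q := (@lower K n V i a).
Local Notation inja := (@inj K n V i a).
Local Notation proja := (@proj K n V i a).
Local Notation r := (rank V).
Local Notation idx d := (d.-tuple 'I_n).

Definition basis_tensor (A : idx p) (B : idx q) : tensor n K^o p q :=
  [ffun x => (x == (A, B))%:R].

Definition proj_basis (A : idx p) (B : idx q) : fibre V := proja (basis_tensor A B).

Lemma proj_expand (t : tensor n K^o p q) :
  proja t = \sum_A \sum_B (t (A, B) : K) *: proj_basis A B.
Proof.
have {1}-> : t = \sum_A \sum_B (t (A, B) : K) *: basis_tensor A B.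
  apply/ffunP => -[A0 B0]; rewrite pair_bigA sum_ffunE.
  rewrite (bigD1 (A0, B0)) //= big1 ?addr0 => [|[A B] /negbTE ne].
    by rewrite !ffunE eqxx /GRing.scale /= mulr1.
  by rewrite !ffunE eq_sym ne /GRing.scale /= mulr0.
rewrite linear_sum; apply: eq_bigr => A _; rewrite linear_sum; apply: eq_bigr => B _.
by rewrite linearZ.
Qed.

(** The action on the lower indices is moved to the right-hand side; without inverse matrices, both
    sides become polynomial in g once the power of \det is cleared. *)
Lemma proj_basis_equivariant g C D : g \in unitmx ->
  \sum_A gpow g A C *: proj_basis A D = rho V g *m \sum_B gpow g D B *: proj_basis C B.
Proof.
move=> Ug; pose t : tensor n K^o p q := \sum_B gpow g D B *: basis_tensor C B.
have -> : \sum_B gpow g D B *: proj_basis C B = proja t.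
  by rewrite linear_sum; apply: eq_bigr => B _; rewrite linearZ.
rewrite -proj_equivariant // proj_expand; apply: eq_bigr => A _.
have actE B : tensor_act g t (A, B) = gpow g A C * (D == B)%:R.
  rewrite tensor_actE -(gpow1 _ D B) -(mulmxV Ug) gpowM mulr_sumr.
  rewrite (bigD1 C) //= [X in _ + X]big1 ?addr0 => [|c /negbTE ne].
    apply: eq_bigr => d _; rewrite -mulrA; congr (_ * _); rewrite mulrC; congr (_ * _).
    rewrite sum_ffunE (bigD1 d) //= [X in _ + X]big1 ?addr0 => [|B' /negbTE ne].
      by rewrite !ffunE eqxx /GRing.scale /= mulr1.
    by rewrite !ffunE xpair_eqE eqxx eq_sym ne /GRing.scale /= mulr0.
  apply: big1 => d _; rewrite sum_ffunE big1 ?mulr0 // => B' _.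
  by rewrite !ffunE xpair_eqE ne /GRing.scale /= mulr0.
rewrite (bigD1 D) //= [X in _ + X]big1 ?addr0 => [|B ne]; first by rewrite actE eqxx mulr1.
by rewrite actE eq_sym (negbTE ne) mulr0 scale0r.
Qed.

Lemma inj_equivariant_dual g w A' B' : g \in unitmx ->
  \sum_d gpow g d B' * inja (rho V g *m w) (A', d) =
  \sum_c gpow g A' c * inja w (c, B').
Proof.
move=> Ug; rewrite inj_equivariant //.
under eq_bigr do rewrite tensor_actE mulr_sumr.
rewrite exchange_big; apply: eq_bigr => c _ /=.
transitivity (gpow g A' c * \sum_d gpow (1%:M : 'M[K]_n) d B' * inja w (c, d)).
  rewrite mulr_sumr; under [RHS]eq_bigr do rewrite -(mulVmx Ug) gpowM.
  under eq_bigr do rewrite mulr_sumr; rewrite exchange_big; apply: eq_bigr => d _ /=.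
  rewrite mulr_suml mulr_sumr; apply: eq_bigr => e _.
  by rewrite -!mulrA mulrCA; congr (_ * _); rewrite mulrCA.
by under eq_bigr do rewrite gpow1; rewrite sum_eql.
Qed.

Lemma inj_sum (I : finType) (c : I -> K) (w : I -> fibre V) x :
  inja (\sum_u c u *: w u) x = \sum_u c u * inja (w u) x.
Proof.
rewrite linear_sum sum_ffunE; apply: eq_bigr => u _.
by rewrite linearZ ffunE.
Qed.

Local Notation pt := (fun a => mxvec (1%:M : 'M[K]_n) 0 a).
Local Notation dr E := (dir pt (fun a => mxvec (E : 'M[K]_n) 0 a)).

(** Derivative of [proj_basis_equivariant] at 1. With denominators cleared, the difference w of its
    sides is a polynomial vanishing on GL_n, hence zero, so its formal derivative in direction E
    vanishes too. *)
Lemma drho_proj_basis E C D : drho V E *m proj_basis C D =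
  \sum_t \sum_k E k (tnth C t) *: proj_basis (upd C t k) D -
  \sum_t \sum_j E (tnth D t) j *: proj_basis C (upd D t j).
Proof.
apply/colP => o; pose e := denom_exp V.
pose w : {mpoly K[n * n]} :=
  det_power V * (\sum_A (proj_basis A D o 0) *: gpow (mxvars K n) A C) -
  \sum_j numer V o j * (\sum_B (proj_basis C B j 0) *: gpow (mxvars K n) D B).
have w0 : w = 0.
  apply: (mpoly_vanish_gl char0) => g Ug.
  have E1 : (\det g) ^+ e *: (\sum_A gpow g A C *: proj_basis A D) =
      map_mx (meval (mxvec g 0)) (numer V) *m \sum_B gpow g D B *: proj_basis C B.
    rewrite proj_basis_equivariant // /rho /rational_action -scalemxAl scalerA mulfV ?scale1r //.
    by rewrite expf_neq0 // -unitfE -unitmxE.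
  have {}E1 := congr1 (fun u : 'cV_ _ => u o 0) E1.
  rewrite [LHS]mxE [RHS]mxE summxE in E1.
  move: E1; under eq_bigr do rewrite mxE; move=> E1.
  rewrite /w mevalB mevalM rmorphXn /= meval_det_mxvars; apply/eqP; rewrite subr_eq0; apply/eqP.
  have evalE u (F : idx u -> K) (G : idx u -> {mpoly K[n * n]}) H :
      (forall x, (G x).@[mxvec g 0] = H x) ->
      (\sum_x F x *: G x).@[mxvec g 0] = \sum_x H x * F x.
    by move=> GH; rewrite raddf_sum; apply: eq_bigr => x _; rewrite /= mevalZ GH mulrC.
  rewrite (evalE _ _ _ (fun A => gpow g A C)) => [|A]; last by rewrite gpow_mxvars meval_gpow.
  rewrite E1 raddf_sum; apply: eq_bigr => j _; rewrite /= mevalM mxE; congr (_ * _).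
  rewrite (evalE _ _ _ (fun B => gpow g D B)) => [|B]; last by rewrite gpow_mxvars meval_gpow.
  by rewrite summxE; apply: eq_bigr => B _; rewrite mxE.
have := congr1 (dr E) w0; rewrite dir0 /w.
have drE u (F : idx u -> K) (G : idx u -> {mpoly K[n * n]}) :
    dr E (\sum_x F x *: G x) = \sum_x dr E (G x) * F x.
  by rewrite dir_sum; apply: eq_bigr => x _; rewrite dirZ mulrC.
rewrite dirB dirM drE sum_dir_gpowl rmorphXn /= meval_det_mxvars det1 expr1n mul1r.
rewrite raddf_sum dir_sum.
under [X in _ - X]eq_bigr do rewrite dirM drE sum_dir_gpowr numer_pt.
rewrite big_split /= (eq_bigr (fun A => proj_basis A D o 0 * (A == C)%:R)) => [|A _]; last first.
  by rewrite mevalZ meval_gpow_pt.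
rewrite sum_eqr => /eqP; rewrite subr_eq0 => /eqP H.
have {}H : dr E (det_power V) * proj_basis C D o 0 +
   (\sum_t \sum_k E k (tnth C t) *: proj_basis (upd C t k) D) o 0 =
   \sum_j dr E (numer V o j) * proj_basis C D j 0 +
   (\sum_t \sum_j E (tnth D t) j *: proj_basis C (upd D t j)) o 0.
  rewrite !summxE -[RHS]/(_ + _).
  transitivity (dr E (det_power V) * proj_basis C D o 0 +
     \sum_t \sum_k E k (tnth C t) * proj_basis (upd C t k) D o 0).
    congr (_ + _); apply: eq_bigr => t _; rewrite summxE.
    by apply: eq_bigr => k _; rewrite mxE.
  rewrite H; congr (_ + _).
    apply: eq_bigr => j _; congr (_ * _); rewrite raddf_sum /=.
    under eq_bigr do rewrite mevalZ meval_gpow_pt eq_sym.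
    by rewrite sum_eqr.
  under eq_bigr do rewrite eq_sym.
  rewrite sum_eql; apply: eq_bigr => t _; rewrite summxE.
  by apply: eq_bigr => k _; rewrite mxE.
transitivity (\sum_j dr E (numer V o j) * proj_basis C D j 0 -
    dr E (det_power V) * proj_basis C D o 0).
  rewrite mxE; under eq_bigr do rewrite mxE mulrBl.
  by rewrite sumrB; congr (_ - _); under eq_bigr do rewrite -mulrA eq_sym; rewrite sum_eql.
rewrite mxE [X in _ = _ + X]mxE; apply/eqP; rewrite subr_eq -addrA eq_sym.
by rewrite [- _ + _]addrC addrA subr_eq addrC H addrC.
Qed.

End Summands.

Section Symbols.
Variables (K : fieldType) (n k : nat) (V W : tensor_bundle K n).
Hypothesis char0 : forall m, m.+1%:R != 0 :> K.
Variable delta : {linear jet k V -> fibre W}.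
Hypothesis nat_delta : natural delta.
Variables (i : summand V) (j : summand W).
Local Notation germ := (on_germ delta).

Section Component.
Variables (a : 'I_(nfactors i)) (b : 'I_(nfactors j)).
Local Notation p := (@upper K n V i a).
Local Notation q := (@lower K n V i a).
Local Notation p' := (@upper K n W j b).
Local Notation q' := (@lower K n W j b).
Local Notation inja := (@inj K n V i a).
Local Notation proja := (@proj K n V i a).
Local Notation injb := (@inj K n W j b).
Local Notation idx d := (d.-tuple 'I_n).
Local Notation pb := (@proj_basis K n V i a).

(** Array of the component of delta from the factor a of V to the factor b of W. As injections and
    projections are equivariant, every component is natural by itself and can be treated alone. *)
Definition germ_symbol u (a' : idx p') (b' : idx q') (A : idx p) (B : idx q) : K :=
  injb (germ u (pb A B)) (a', b').

Lemma germ_symbol_sum (I : finType) (c : I -> K) (x : I -> fibre V) u a' b' :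
  injb (germ u (\sum_l c l *: x l)) (a', b') =
  \sum_l c l * injb (germ u (x l)) (a', b').
Proof.
rewrite on_germ_sumv; under eq_bigr do rewrite on_germZv.
exact: inj_sum.
Qed.

Lemma germ_symbol_equivariant g u u' a' b' C D : g \in unitmx ->
  (forall v, germ u (rho V g *m v) = rho W g *m germ u' v) ->
  \sum_d' \sum_A gpow g d' b' * gpow g A C * germ_symbol u a' d' A D =
  \sum_c' \sum_B gpow g a' c' * gpow g D B * germ_symbol u' c' b' C B.
Proof.
move=> Ug Eu; under eq_bigr do under eq_bigr do rewrite -mulrA.
under eq_bigr do rewrite -mulr_sumr -germ_symbol_sum proj_basis_equivariant // Eu.
rewrite inj_equivariant_dual //; apply: eq_bigr => c' _.
by rewrite germ_symbol_sum mulr_sumr; apply: eq_bigr => B _; rewrite mulrA.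
Qed.

Lemma germ_symbol0_equivariant : equivariant (germ_symbol 1).
Proof.
move=> g Ug a' b' C D; apply: germ_symbol_equivariant => // v.
exact: symbol0_equivariant.
Qed.

Local Notation first_symbol := (fun a' b' A l B => germ_symbol 'X_l a' b' A B).

Lemma germ_symbol1_equivariant : equivariant1 first_symbol.
Proof.
move=> g Ug a' b' C l D.
rewrite (@germ_symbol_equivariant g _ (\sum_m g l m *: 'X_m)) // => [|v].
  apply: eq_bigr => c' _; rewrite exchange_big; apply: eq_bigr => B _ /=.
  rewrite /germ_symbol on_germ_sump inj_sum mulr_sumr; apply: eq_bigr => m _.
  by rewrite !mulrA; congr (_ * _); rewrite -!mulrA [gpow g D B * _]mulrC.
by rewrite on_germ_sump; apply: symbol1_equivariant.
Qed.

Hypothesis k0 : (0 < k)%N.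
Hypothesis ord1 : order_le delta 1.

(** For y the m-th basis vector, [symbol1_drho] states that a quadratic form in c, with matrix beta,
    vanishes identically; the relation is its polarization. *)
Lemma germ_symbol_jet_invariant : jet_invariant first_symbol.
Proof.
move=> a' b' C D i0 j0 m.
pose beta l l' := \sum_t (tnth C t == l')%:R * germ_symbol 'X_l a' b' (upd C t m) D -
  \sum_t (tnth D t == m)%:R * germ_symbol 'X_l a' b' C (upd D t l').
suff: beta i0 j0 + beta j0 i0 = 0.
  rewrite /beta addrACA -opprD -[in X in _ - X]big_split /= => /eqP.
  rewrite subr_eq0 => /eqP->; apply: eq_bigr => t _.
  by rewrite mulrDr.
apply: quadratic_form0 => c.
pose y (l : 'I_n) : K := (l == m)%:R.
transitivity (\sum_l c l * injb (germ 'X_l (drho V (rank1_mx c y) *m pb C D)) (a', b')).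
  apply: eq_bigr => l _.
  have -> : drho V (rank1_mx c y) *m pb C D =
      \sum_t c (tnth C t) *: pb (upd C t m) D -
      \sum_t (tnth D t == m)%:R *: \sum_l' c l' *: pb C (upd D t l').
    rewrite drho_proj_basis //; congr (_ - _); apply: eq_bigr => t _.
      rewrite (bigD1 m) //= big1 ?addr0 => [|l' /negbTE ne].
        by rewrite mxE /y eqxx mul1r.
      by rewrite mxE /y ne mul0r scale0r.
    by rewrite scaler_sumr; apply: eq_bigr => l' _; rewrite mxE scalerA.
  have germB u v : germ 'X_l (u - v) = germ 'X_l u - germ 'X_l v.
    by rewrite on_germDv -scaleN1r on_germZv scaleN1r.
  rewrite germB linearB ffunE; under eq_bigr do rewrite -mulrA.
  rewrite -mulr_sumr; congr (_ * _).
  rewrite /beta; under eq_bigr do rewrite mulrBr.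
  rewrite sumrB [in RHS]ffunE !germ_symbol_sum; congr (_ - _).
    under eq_bigr do rewrite mulr_sumr; rewrite exchange_big; apply: eq_bigr => t _ /=.
    under eq_bigr do rewrite mulrCA eq_sym.
    by rewrite sum_eql.
  under eq_bigr do rewrite mulr_sumr; rewrite exchange_big; apply: eq_bigr => t _ /=.
  under eq_bigr do rewrite mulrCA.
  by rewrite -mulr_sumr germ_symbol_sum.
rewrite -(inj_sum c (fun l => germ 'X_l _)) symbol1_drho //.
by rewrite linear0 ffunE.
Qed.

End Component.
End Symbols.

(** * Assembling the operation from its components *)

Section Along.
Variables (K : fieldType) (n k : nat) (V W : tensor_bundle K n).
Variable conj : {rmorphism K -> K}.
Hypothesis char0 : forall m, m.+1%:R != 0 :> K.
Hypothesis conj_pos : forall (I : finType) (f : I -> K),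
  \sum_i f i * conj (f i) = 0 -> forall i, f i = 0.
Variable delta : {linear jet k V -> fibre W}.
Hypothesis nat_delta : natural delta.
Hypothesis k0 : (0 < k)%N.
Hypothesis ord1 : order_le delta 1.
Local Notation germ := (on_germ delta).

(** The map h stands for evaluation at a point, alone or after a partial derivative; both commute
    with the injection, whose coefficients are constants. *)
Lemma meval_inj_section (i : summand V) a (v : psection V) (h : {mpoly K[n]} -> K) x :
  {morph h : s t / s + t} -> (forall c s, h (c *: s) = c * h s) ->
  h (@inj_section K n V i a v x) = @inj K n V i a (\col_m h (v m 0)) x.
Proof.
move=> hD hZ; have h0 : h 0 = 0 by rewrite -[0 in LHS](scale0r 0) hZ mul0r.
rewrite ffunE (big_morph h hD h0).
have -> : \col_m h (v m 0) = \sum_m h (v m 0) *: delta_mx m 0 :> fibre V.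
  apply/colP => o; rewrite mxE summxE (bigD1 o) //= big1 ?addr0 => [|m /negbTE ne].
    by rewrite !mxE !eqxx mulr1.
  by rewrite !mxE eq_sym ne mulr0.
by rewrite inj_sum; apply: eq_bigr => m _; rewrite hZ mulrC.
Qed.

Lemma germ_symbol_apply (i : summand V) (j : summand W) a b u (v : fibre V) a' b' :
  \sum_A \sum_B @germ_symbol K n k V W delta i j a b u a' b' A B *
    @inj K n V i a v (A, B) =
  @inj K n W j b (germ u (@proj K n V i a (@inj K n V i a v))) (a', b').
Proof.
rewrite proj_expand on_germ_sumv linear_sum sum_ffunE; apply: eq_bigr => A _.
by rewrite germ_symbol_sum; apply: eq_bigr => B _; rewrite mulrC.
Qed.

Lemma first_order_obtained (i : summand V) (j : summand W) : obtained_along delta i j.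
Proof.
pose X a b := @germ_symbol K n k V W delta i j a b 1.
pose D a b a' b' A l B := @germ_symbol K n k V W delta i j a b 'X_l a' b' A B.
have obt a b : exists E, obtained_from_d E /\
    (fun t => 1 *: dapp (D a b) t + kapp (X a b) t) =1 E.
  have obD : is_obtained (dapp (D a b)).
    apply: (natural_symbol_obtained char0 conj_pos); split.
      exact: germ_symbol1_equivariant.
    exact: germ_symbol_jet_invariant.
  have obX : is_obtained (kapp (X a b)).
    apply: (@equivariant_obtained _ _ char0 _ _ _ _ _ _ _ id).
      exact: germ_symbol0_equivariant.
    by apply: is_obtained_op; apply: is_op_id.
  by have [E obE eqE] := is_obtained_lin 1 obD obX; exists E; split=> // t; rewrite eqE.
(* The choice is made in b and then in a, because the type of E depends on both. *)
have obt' a : exists E : forall b, _,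
    forall b, obtained_from_d (E b) /\
    (fun t => 1 *: dapp (D a b) t + kapp (X a b) t) =1 E b.
  by   by have [E HE] := fin_all_exists (obt a); exists E.
have [E HE] := fin_all_exists obt'; exists E; split=> [a b|v z].
  exact: (HE a b).1.
pose v0 : fibre V := \col_m (v m 0).@[fun l => z l 0].
pose v1 l : fibre V := \col_m (v m 0)^`M(l).@[fun l => z l 0].
(* The maps pi a add up to the identity of V, and their analogues do so on W; inserting both
   decompositions splits delta into its components. *)
pose pi a v : fibre V := @proj K n V i a (@inj K n V i a v).
pose w a := germ 1 (pi a v0) + \sum_l germ 'X_l (pi a (v1 l)).
have Ew a b : tensor_at z (E a b (inj_section a v)) = @inj K n W j b (w a).
  apply/ffunP => -[a' b']; rewrite ffunE -(HE a b).2 scale1r !ffunE mevalD addrC.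
  rewrite /w linearD ffunE; congr (_ + _).
    rewrite -germ_symbol_apply raddf_sum; apply: eq_bigr => A _ /=.
    rewrite raddf_sum; apply: eq_bigr => B _ /=; rewrite mevalZ; congr (_ * _).
    apply: (@meval_inj_section i a v (meval (fun l => z l 0))) => [s t|c s].
      exact: mevalD.
    exact: mevalZ.
  rewrite [X in _ = fun_of_fin X _]linear_sum sum_ffunE raddf_sum /=.
  under eq_bigr do rewrite raddf_sum /=.
  rewrite exchange_big; apply: eq_bigr => l _; rewrite -germ_symbol_apply.
  apply: eq_bigr => A _; rewrite raddf_sum; apply: eq_bigr => B _ /=.
  rewrite mevalZ; congr (_ * _).
  apply: (@meval_inj_section i a v (fun s => (s^`M(l)).@[fun l => z l 0])) => [s t|c s].
    by rewrite mderivD mevalD.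
  by rewrite mderivZ mevalZ.
rewrite (first_order_jet_at ord1) -/v0.
rewrite (eq_bigr (fun a => w a)) => [|a _]; last first.
  by rewrite -[RHS](injK j); apply: eq_bigr => b _; rewrite Ew.
rewrite /w big_split /=; congr (_ + _).
  by rewrite -on_germ_sumv injK.
by rewrite exchange_big; apply: eq_bigr => l _; rewrite -on_germ_sumv injK.
Qed.

End Along.

Lemma natural_obtained (K : fieldType) (conj : {rmorphism K -> K}) n k
    (V W : tensor_bundle K n) (delta : {linear jet k V -> fibre W}) l :
  (forall m, m.+1%:R != 0 :> K) ->
  (forall (I : finType) (f : I -> K),
     \sum_i f i * conj (f i) = 0 -> forall i, f i = 0) ->
  natural delta -> has_order delta l -> (0 < l)%N -> is_obtained_from_d delta.
Proof.
move=> char0 conj_pos nat_delta ord_l l0.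
have [k0 ord1] := natural_order_one char0 nat_delta ord_l l0.
split; first exact: (summand_exists char0 conj_pos).
split; first exact: (summand_exists char0 conj_pos).
move=> i j; exact: (@first_order_obtained _ _ _ _ _ conj char0 conj_pos delta nat_delta k0 ord1).
Qed.

(** Squares over R, with conj the identity, and squared moduli over C are nonnegative. *)
Lemma ground_field_conj (R : realType) (F : ground) :
  exists conj : {rmorphism ground_field R F -> ground_field R F},
    forall (I : finType) (f : I -> ground_field R F),
      \sum_i f i * conj (f i) = 0 -> forall i, f i = 0.
Proof.
case: F => /=.
  exists idfun => I f /eqP; rewrite Num.Theory.psumr_eq0 => [/allP f0 i|i _].
    by have := f0 i (mem_index_enum i); rewrite /= mulf_eq0 orbb => /eqP.
  by rewrite /= -expr2 Num.Theory.sqr_ge0.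
exists (@Num.conj R[i]) => I f /eqP; rewrite Num.Theory.psumr_eq0 => [/allP f0 i|i _].
  have := f0 i (mem_index_enum i).
  by rewrite /= Num.Theory.mul_conjC_eq0 => /eqP.
exact: Num.Theory.mul_conjC_ge0.
Qed.

Lemma ground_field_char0 (R : realType) (F : ground) m :
  m.+1%:R != 0 :> ground_field R F.
Proof. by case: F; rewrite Num.Theory.pnatr_eq0. Qed.

Theorem theorem4 (R : realType) (F : ground) (n : nat)
    (V W : tensor_bundle (ground_field R F) n) (k : nat)
    (delta : {linear jet k V -> fibre W}) (l : nat) :
  natural delta -> has_order delta l -> (0 < l)%N ->
  is_obtained_from_d delta.
Proof.
have [conj conj_pos] := ground_field_conj R F.
exact: natural_obtained (@ground_field_char0 R F) conj_pos.
Qed.
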